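(* Let $q\in\mathbb{C}$ be non-zero and not a root of unity, and let $t\ge2$. The algebra homomorphism $\Upsilon:BW_t(-q^{2n},q)\to\mathcal{C}_t$ defined by $\Upsilon: g_i\mapsto-\check R_i$ ($1\le i\le t-1$) yields a representation of the Birman-Wenzl-Murakami algebra $BW_t(-q^{2n},q)$ in $\mathcal{C}_t$ (that is, the assignment $g_i\mapsto-\check R_i$ extends to a well-defined algebra homomorphism). Here $\mathcal{C}_t$ is the subalgebra of $\mathrm{End}_{U_q(osp(1|2n))}(V^{\otimes t})$ generated by $\check R_i^{\pm1}$, $1\le i\le t-1$, with $\check R_i=\mathrm{id}^{\otimes(i-1)}\otimes\check{\mathcal R}_{V,V}\otimes\mathrm{id}^{\otimes(t-i-1)}$.
   Context: **The Birman-Wenzl-Murakami algebra.** For nonzero $r,q\in\mathbb{C}$ (with $q\neq q^{-1}$) and $t\ge2$, $BW_t(r,q)$ is the $\mathbb{C}$-algebra generated by invertible elements $g_1,\dots,g_{t-1}$ subject to: $g_ig_j=g_jg_i$ for $|i-j|>1$; $g_ig_{i+1}g_i=g_{i+1}g_ig_{i+1}$ for $1\le i\le t-2$; $e_ig_i=r^{-1}e_i$ for $1\le i\le t-1$; $e_ig_{i-1}^{\pm1}e_i=r^{\pm1}e_i$ for $2\le i\le t-1$; where $e_i$ is defined by $(q-q^{-1})(1-e_i)=g_i-g_i^{-1}$. **The quantum superalgebra.** Let $n\ge 1$ and let $q\in\mathbb{C}$ be nonzero and not a root of unity. Let $H^*$ be the complex vector space with basis $\epsilon_1,\dots,\epsilon_n$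 and bilinear form $(\epsilon_i,\epsilon_j)=\delta_{ij}$. Put $\alpha_i=\epsilon_i-\epsilon_{i+1}$ for $1\le i<n$, $\alpha_n=\epsilon_n$, and $a_{ij}=2(\alpha_i,\alpha_j)/(\alpha_i,\alpha_i)$. Let $\mathfrak g=osp(1|2n)$. $U_q(\mathfrak g)$ is the unital associative $\mathbb{Z}_2$-graded $\mathbb{C}$-algebra generated by $e_i,f_i,K_i^{\pm1}$ ($1\le i\le n$; these $e_i$ are not the $e_i$ of $BW_t$), all even except $e_n,f_n$, which are odd, with relations $e_if_j-(-1)^{[e_i][f_j]}f_je_i=\delta_{ij}(K_i-K_i^{-1})/(q-q^{-1})$, $K_ie_jK_i^{-1}=q^{(\alpha_i,\alpha_j)}e_j$, $K_if_jK_i^{-1}=q^{-(\alpha_i,\alpha_j)}f_j$, the $K_i^{\pm1}$ commute, $K_iK_i^{-1}=K_i^{-1}K_i=1$, and $(\mathrm{ad}_qe_i)^{1-a_{ij}}e_j=0=(\mathrm{ad}_qf_i)^{1-a_{ij}}f_j$ for $i\ne j$, where $(\mathrm{ad}_qe_i)X=e_iX-(-1)^{[e_i][X]}K_iXK_i^{-1}e_i$ and $(\mathrm{ad}_qf_i)X=f_iX-(-1)^{[f_i][X]}K_i^{-1}XK_if_i$. Here $[x]\in\mathbb{Z}_2$ denotes the grading of a homogeneous $x$. It is a $\mathbb{Z}_2$-graded Hopf algebra with $\Delta(e_i)=e_i\otimes K_i+1\otimes e_i$, $\Delta(f_i)=f_i\otimes1+K_i^{-1}\otimes f_i$, $\Delta(K_i^{\pm1})=K_i^{\pm1}\otimes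 K_i^{\pm1}$, $\epsilon(e_i)=\epsilon(f_i)=0$, $\epsilon(K_i^{\pm1})=1$, $S(e_i)=-e_iK_i^{-1}$, $S(f_i)=-K_if_i$, $S(K_i^{\pm1})=K_i^{\mp1}$. Tensor products follow the sign rule $(a\otimes b)(v\otimes w)=(-1)^{[b][v]}av\otimes bw$; $U_q(\mathfrak g)$ acts on tensor products via (iterated) $\Delta$. For $\beta=\sum m_i\alpha_i$, $m_i\in\mathbb{Z}$, put $K_\beta=\prod K_i^{m_i}$. Homomorphisms of graded modules are linear maps commuting with the action and homogeneous of degree $0$. **The fundamental module.** $V=V_{\epsilon_1}$ has basis $v_k$, $-n\le k\le n$, with $v_0$ even and all $v_k$, $k\ne0$, odd, and (for $1\le i<n$, $1\le j\le n$, $\epsilon_0=0$, $\epsilon_{-k}=-\epsilon_k$) $f_iv_i=v_{i+1}$, $f_nv_n=v_0$, $f_nv_0=v_{-n}$, $f_iv_{-i-1}=v_{-i}$, $e_iv_{i+1}=v_i$, $e_nv_0=v_n$, $e_nv_{-n}=-v_0$, $e_iv_{-i}=v_{-i-1}$, $K_j^{\pm1}v_k=q^{\pm(\alpha_j,\epsilon_k)}v_k$, all other actions of the $e$'s and $f$'s being zero. The representation is $\pi$. **The element $\widetilde R$.** Let $\phi=\{\epsilon_i\pm\epsilon_j,\epsilon_k\mid 1\le i<j\le n,1\le k\le n\}$. A normal ordering of $\phi$ is a total order $\prec$ such that $\alpha\prec\beta$ and $\alpha+\beta\in\phi$ imply $\alpha\prec\alpha+\beta\prec\beta$; fix one. Put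 $E_{\alpha_i}=e_i$, $F_{\alpha_i}=f_i$. Recursively, if $\gamma=\alpha+\beta$ with $\alpha,\beta,\gamma\in\phi$, $\alpha\prec\beta$, and there are no other $\alpha',\beta'\in\phi$ with $\alpha'+\beta'=\gamma$, $\alpha\prec\alpha'\prec\beta$, $\alpha\prec\beta'\prec\beta$, put $E_\gamma=E_\alpha E_\beta-(-1)^{[E_\alpha][E_\beta]}q^{(\alpha,\beta)}E_\beta E_\alpha$ and $F_\gamma=F_\beta F_\alpha-(-1)^{[F_\alpha][F_\beta]}q^{-(\alpha,\beta)}F_\alpha F_\beta$. The nonzero scalar $a_\gamma$ is defined by $E_\gamma F_\gamma-(-1)^{[E_\gamma]}F_\gamma E_\gamma=a_\gamma(K_\gamma-K_\gamma^{-1})/(q-q^{-1})$. With $[k]_z=(1-z^k)/(1-z)$, $[k]_z!=[k]_z\cdots[1]_z$, $[0]_z!=1$, $\exp_z(x)=\sum_{k\ge0}x^k/[k]_z!$ and $q_\gamma=(-1)^{[E_\gamma]}q^{-(\gamma,\gamma)}$, put $\widetilde R_\gamma=\exp_{q_\gamma}\big((-1)^{[E_\gamma]}a_\gamma^{-1}(q-q^{-1})E_\gamma\otimes F_\gamma\big)$ and $\widetilde R=\widetilde R_{\gamma_1}\widetilde R_{\gamma_2}\cdots\widetilde R_{\gamma_k}$ where $\gamma_1\prec\gamma_2\prec\cdots\prec\gamma_k$ are the elements of $\phi$. This is a formal infinite sum of which only finitely many terms act nontrivially on a tensor product of finite-dimensional irreducible modules. **The braiding.** Let $\mathcal{E}(v_i\otimes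 v_j)=q^{(\epsilon_i,\epsilon_j)}v_i\otimes v_j$ on $V\otimes V$, and let $P(v\otimes w)=(-1)^{[v][w]}w\otimes v$. Then $\check{\mathcal R}_{V,V}=P\circ\mathcal{E}\circ(\pi\otimes\pi)(\widetilde R)\in\mathrm{End}_{U_q(\mathfrak g)}(V\otimes V)$, an invertible map. *)

(* Defs.v *)
From HB Require Import structures.
From mathcomp Require Import all_boot all_order all_algebra.
From mathcomp Require Import generic_quotient ring_quotient.
From mathcomp Require Import boolp classical_sets fsbigop reals.
From mathcomp Require Import complex.
From mathcomp Require Import finmap monalg.

Set Implicit Arguments.
Unset Strict Implicit.
Unset Printing Implicit Defensive.

Import GRing.Theory.
Local Open Scope ring_scope.
Local Open Scope quotient_scope.
Local Open Scope classical_set_scope.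

(* Algebras given by generators and relations: the quotient of the free
   algebra by the two-sided ideal generated by a set of elements; a relation
   lhs = rhs is encoded as the element lhs - rhs.  The zero algebra is not
   excluded, hence a pzRingType and an lmodType rather than an algType. *)
Section Presentation.
Variables (F : fieldType) (X : choiceType).

Definition free_alg := {malg F[{fmonom X}]}.

Definition fgen (x : X) : free_alg := << fmu x >>.

Lemma free_scaleAr (c : F) (x y : free_alg) : c *: (x * y) = x * (c *: y).
Proof.
rewrite (malgMEw (fsubset_refl _) (msuppZ_le c y)) malgME.
rewrite scaler_sumr; apply: eq_bigr => k1 _.
rewrite scaler_sumr; apply: eq_bigr => k2 _.
by apply/malgP => k; rewrite mcoeffZ !mcoeffU mcoeffZ mulrCA mulrnAr.
Qed.

Variable rel : set free_alg.

Definition two_sided_ideal (I : set free_alg) : Prop :=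
  [/\ I 0, forall x y, I x -> I y -> I (x - y)
    & forall a b x, I x -> I (a * x * b)].

Definition rel_ideal : {pred free_alg} :=
  fun x => `[< forall I : set free_alg, two_sided_ideal I -> rel `<=` I -> I x >].

Lemma rel_idealM a b x : x \in rel_ideal -> a * x * b \in rel_ideal.
Proof.
move=> /asboolP Ix; apply/asboolP => I HI HR; case: (HI) => _ _; apply.
exact: Ix.
Qed.

Lemma rel_ideal_zmod : zmod_closed rel_ideal.
Proof.
split=> [|x y /asboolP Ix /asboolP Iy]; apply/asboolP => I HI HR.
  by case: HI.
by case: (HI) => _ IB _; apply: IB; [apply: Ix | apply: Iy].
Qed.

HB.instance Definition _ :=
  GRing.isZmodClosed.Build free_alg rel_ideal rel_ideal_zmod.

Definition pres_alg := Quotient.quot rel_ideal.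

HB.instance Definition _ := GRing.Zmodule.on pres_alg.

Definition pres_pi (x : free_alg) : pres_alg := \pi_pres_alg x.

Lemma pres_piP x y : reflect (pres_pi x = pres_pi y) (x - y \in rel_ideal).
Proof. by rewrite Quotient.idealrBE; apply: (iffP eqP). Qed.

Lemma pres_piK (u : pres_alg) : pres_pi (repr u) = u.
Proof. exact: reprK. Qed.

Lemma pres_piD x y : pres_pi (x + y) = pres_pi x + pres_pi y.
Proof. exact: pi_addr. Qed.

Definition pres_one : pres_alg := pres_pi 1.
Definition pres_mul (u v : pres_alg) : pres_alg := pres_pi (repr u * repr v).
Definition pres_scale (c : F) (u : pres_alg) : pres_alg :=
  pres_pi (c *: repr u).

Lemma pres_piM x y : pres_pi (x * y) = pres_mul (pres_pi x) (pres_pi y).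
Proof.
apply/pres_piP.
have /pres_piP Ix : pres_pi x = pres_pi (repr (pres_pi x)) by rewrite pres_piK.
have /pres_piP Iy : pres_pi y = pres_pi (repr (pres_pi y)) by rewrite pres_piK.
set x' := repr _ in Ix *; set y' := repr _ in Iy *.
have -> : x * y - x' * y' = 1 * (x - x') * y + x' * (y - y') * 1.
  by rewrite mul1r mulr1 mulrBl mulrBr addrA subrK.
by apply: rpredD; apply: rel_idealM.
Qed.

Lemma pres_piZ c x : pres_pi (c *: x) = pres_scale c (pres_pi x).
Proof.
apply/pres_piP.
have /pres_piP Ix : pres_pi x = pres_pi (repr (pres_pi x)) by rewrite pres_piK.
rewrite -scalerBr -[_ - _]mul1r -[_ *: _]mulr1 scalerAl.
exact: rel_idealM.
Qed.

Lemma pres_mulA : associative pres_mul.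
Proof.
move=> u v w; rewrite -[u]pres_piK -[v]pres_piK -[w]pres_piK.
by rewrite -!pres_piM mulrA.
Qed.

Lemma pres_mul1 : left_id pres_one pres_mul.
Proof. by move=> u; rewrite -[u]pres_piK -pres_piM mul1r. Qed.

Lemma pres_mulr1 : right_id pres_one pres_mul.
Proof. by move=> u; rewrite -[u]pres_piK -pres_piM mulr1. Qed.

Lemma pres_mulDl : left_distributive pres_mul +%R.
Proof.
move=> u v w; rewrite -[u]pres_piK -[v]pres_piK -[w]pres_piK.
by rewrite -pres_piD -!pres_piM mulrDl pres_piD.
Qed.

Lemma pres_mulDr : right_distributive pres_mul +%R.
Proof.
move=> u v w; rewrite -[u]pres_piK -[v]pres_piK -[w]pres_piK.
by rewrite -pres_piD -!pres_piM mulrDr pres_piD.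
Qed.

HB.instance Definition _ := GRing.Zmodule_isPzRing.Build pres_alg
  pres_mulA pres_mul1 pres_mulr1 pres_mulDl pres_mulDr.

Lemma pres_scaleA a b u :
  pres_scale a (pres_scale b u) = pres_scale (a * b) u.
Proof. by rewrite -[u]pres_piK -!pres_piZ scalerA. Qed.

Lemma pres_scale1 : left_id 1 pres_scale.
Proof. by move=> u; rewrite -[u]pres_piK -pres_piZ scale1r. Qed.

Lemma pres_scaleDr : right_distributive pres_scale +%R.
Proof.
move=> c u v; rewrite -[u]pres_piK -[v]pres_piK.
by rewrite -pres_piD -!pres_piZ scalerDr pres_piD.
Qed.

Lemma pres_scaleDl u : {morph pres_scale^~ u : a b / a + b}.
Proof. by move=> a b; rewrite -[u]pres_piK -!pres_piZ scalerDl pres_piD. Qed.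

HB.instance Definition _ := GRing.Zmodule_isLmodule.Build F pres_alg
  pres_scaleA pres_scale1 pres_scaleDr pres_scaleDl.

Lemma pres_pi1 : pres_pi 1 = 1.
Proof. by []. Qed.

Lemma pres_pi_mul x y : pres_pi (x * y) = pres_pi x * pres_pi y.
Proof. exact: pres_piM. Qed.

Lemma pres_pi_scale c x : pres_pi (c *: x) = c *: pres_pi x.
Proof. exact: pres_piZ. Qed.

Lemma pres_scaleAl (c : F) (u v : pres_alg) : c *: (u * v) = (c *: u) * v.
Proof.
rewrite -[u]pres_piK -[v]pres_piK -pres_pi_mul -!pres_pi_scale.
by rewrite scalerAl pres_pi_mul.
Qed.

Lemma pres_scaleAr (c : F) (u v : pres_alg) : c *: (u * v) = u * (c *: v).
Proof.
rewrite -[u]pres_piK -[v]pres_piK -pres_pi_mul -!pres_pi_scale.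
by rewrite free_scaleAr pres_pi_mul.
Qed.

Definition pgen (x : X) : pres_alg := pres_pi (fgen x).

End Presentation.

(* The Birman-Wenzl-Murakami algebra.  Generators: (i, false) is g_i and
   (i, true) is its inverse; the index set {1, .., t - 1} is shifted to
   'I_t.-1. *)
Section BMW.
Variables (F : fieldType) (t : nat) (r q : F).

Definition BW_gen : choiceType := ('I_t.-1 * bool)%type.

Local Notation A := (free_alg F BW_gen).

Definition BW_sg (i : 'I_t.-1) : A := fgen F ((i, false) : BW_gen).
Definition BW_sgV (i : 'I_t.-1) : A := fgen F ((i, true) : BW_gen).
Definition BW_se (i : 'I_t.-1) : A :=
  1 - (q - q^-1)^-1 *: (BW_sg i - BW_sgV i).

Local Notation g := BW_sg.
Local Notation gV := BW_sgV.
Local Notation e := BW_se.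

Inductive BW_rel : A -> Prop :=
| BW_mulgV i : BW_rel (g i * gV i - 1)
| BW_mulVg i : BW_rel (gV i * g i - 1)
| BW_comm (i j : 'I_t.-1) : (i.+1 < j)%N || (j.+1 < i)%N ->
    BW_rel (g i * g j - g j * g i)
| BW_braid (i j : 'I_t.-1) : j = i.+1 :> nat ->
    BW_rel (g i * g j * g i - g j * g i * g j)
| BW_twist i : BW_rel (e i * g i - r^-1 *: e i)
| BW_loop (i j : 'I_t.-1) : j = i.+1 :> nat ->
    BW_rel (e j * g i * e j - r *: e j)
| BW_loopV (i j : 'I_t.-1) : j = i.+1 :> nat ->
    BW_rel (e j * gV i * e j - r^-1 *: e j).

Definition BW := pres_alg BW_rel.

HB.instance Definition _ := GRing.PzRing.on BW.
HB.instance Definition _ := GRing.Lmodule.on BW.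

Definition BW_g (i : 'I_t.-1) : BW := pgen BW_rel ((i, false) : BW_gen).

End BMW.

(* Weights are the integral combinations of epsilon_1, .., epsilon_n. *)
Section Roots.
Variable n : nat.

Definition weight := 'rV[int]_n.

Definition wform (x y : weight) : int := \sum_i x 0 i * y 0 i.

(* epsilon_k for -n <= k <= n, with epsilon_0 = 0 and
   epsilon_(-k) = - epsilon_k. *)
Definition eps (k : int) : weight :=
  \row_i ((k == i.+1%:Z)%:R - (k == - i.+1%:Z)%:R).

(* alpha i is the simple root alpha_(i+1) *)
Definition alpha (i : 'I_n) : weight :=
  if (i.+1 < n)%N then eps i.+1%:Z - eps i.+2%:Z else eps i.+1%:Z.

(* the division is exact *)
Definition cartan (i j : 'I_n) : int :=
  (2 * wform (alpha i) (alpha j) %/ wform (alpha i) (alpha i))%Z.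

Definition is_root (x : weight) : bool :=
  [exists i : 'I_n, x == eps i.+1%:Z]
  || [exists i : 'I_n, exists j : 'I_n, (i < j)%N &&
        ((x == eps i.+1%:Z - eps j.+1%:Z) || (x == eps i.+1%:Z + eps j.+1%:Z))].

(* x = \sum_i (alpha_coef x i) alpha_(i+1), because
   epsilon_j = alpha_j + .. + alpha_n *)
Definition alpha_coef (x : weight) (i : 'I_n) : int :=
  \sum_(j < n | (j <= i)%N) x 0 j.

(* The parity of a vector of weight x in U_q: the parity of the coefficient of
   alpha_n in x, as e_n and f_n are the only odd generators. *)
Definition wpar (x : weight) : bool := odd `|(\sum_j x 0 j)%R|%N.

(* A total order on the roots is given by their increasing enumeration. *)
Definition prec (s : seq weight) (x y : weight) : bool :=
  (index x s < index y s)%N.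

Definition normal_ordering (s : seq weight) : Prop :=
  [/\ uniq s, forall x, (x \in s) = is_root x
    & forall x y, x \in s -> y \in s -> prec s x y -> x + y \in s ->
        prec s x (x + y) /\ prec s (x + y) y].

Definition minimal_pair (s : seq weight) (x y : weight) : Prop :=
  [/\ x \in s, y \in s, prec s x y
    & forall x' y', x' \in s -> y' \in s -> x' + y' = x + y ->
        ~~ [&& prec s x x', prec s x' y, prec s x y' & prec s y' y]].

End Roots.

(* Super vector spaces with a homogeneous basis and their endomorphisms: the
   entry ent A y x is the coefficient of y in the image of x, so the product of
   matrices is the composition of maps. *)
Record superspace := SuperSpace { sbasis :> finType; spar : sbasis -> bool }.

Section Operators.
Variable F : fieldType.

Definition op (B : superspace) := 'M[F]_#|sbasis B|.

HB.instance Definition _ B := GRing.PzRing.on (op B).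
HB.instance Definition _ B := GRing.Lmodule.on (op B).

Definition mkop (B : superspace) (f : B -> B -> F) : op B :=
  \matrix_(i, j) f (enum_val i) (enum_val j).

Definition ent (B : superspace) (A : op B) (y x : B) : F :=
  A (enum_rank y) (enum_rank x).

Definition unit_space : superspace := @SuperSpace unit (fun=> false).

Definition tens_space (B C : superspace) : superspace :=
  @SuperSpace (B * C)%type (fun x => spar x.1 (+) spar x.2).

(* The bilinear extension of (a (x) b)(v (x) w) = (-1)^([b][v]) av (x) bw for
   homogeneous b: a coefficient of b from x.2 to y.2 has parity [y.2] + [x.2]. *)
Definition tens (B C : superspace) (a : op B) (b : op C) : op (tens_space B C) :=
  @mkop (tens_space B C) (fun y x =>
    (-1) ^+ ((spar y.2 (+) spar x.2) && spar x.1)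
      * (ent a y.1 x.1 * ent b y.2 x.2)).

Definition even_op (B : superspace) (A : op B) : Prop :=
  forall x y : B, spar x != spar y -> ent A y x = 0.

End Operators.

(* Generators of U_q(osp(1|2n)): (GE, i), (GF, i), (GK, i), (GKV, i) stand for
   e_(i+1), f_(i+1), K_(i+1), K_(i+1)^-1. *)
Variant gkind := GE | GF | GK | GKV.

Definition gkind_code (x : gkind) : bool * bool :=
  match x with GE => (false, false) | GF => (false, true)
             | GK => (true, false) | GKV => (true, true) end.
Definition gkind_decode (x : bool * bool) : gkind :=
  match x with (false, false) => GE | (false, true) => GF
             | (true, false) => GK | (true, true) => GKV end.
Lemma gkind_codeK : cancel gkind_code gkind_decode.
Proof. by case. Qed.
HB.instance Definition _ := Finite.copy gkind (can_type gkind_codeK).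

Section QuantumGroup.
Variables (F : fieldType) (n : nat) (q : F).

Definition Uq_gen : choiceType := (gkind * 'I_n)%type.

Definition gpar (i : 'I_n) : bool := (i.+1 == n)%N.

Definition qwt (x y : weight n) : F := q ^ wform x y.

Section Relations.
Local Notation A := (free_alg F Uq_gen).

Definition Uq_se (i : 'I_n) : A := fgen F ((GE, i) : Uq_gen).
Definition Uq_sf (i : 'I_n) : A := fgen F ((GF, i) : Uq_gen).
Definition Uq_sK (i : 'I_n) : A := fgen F ((GK, i) : Uq_gen).
Definition Uq_sKV (i : 'I_n) : A := fgen F ((GKV, i) : Uq_gen).
Definition Uq_sKpm (b : bool) (i : 'I_n) : A :=
  if b then Uq_sKV i else Uq_sK i.

Local Notation e := Uq_se.
Local Notation f := Uq_sf.
Local Notation K := Uq_sK.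
Local Notation KV := Uq_sKV.
Local Notation Kpm := Uq_sKpm.

(* the adjoint actions, on elements paired with their parity *)
Definition ad_e (i : 'I_n) (x : bool * A) : bool * A :=
  (gpar i (+) x.1,
   e i * x.2 - (-1) ^+ (gpar i && x.1) *: (K i * x.2 * KV i * e i)).

Definition ad_f (i : 'I_n) (x : bool * A) : bool * A :=
  (gpar i (+) x.1,
   f i * x.2 - (-1) ^+ (gpar i && x.1) *: (KV i * x.2 * K i * f i)).

Definition serre_exp (i j : 'I_n) : nat := `|1 - cartan i j|%N.

Inductive Uq_rel : A -> Prop :=
| Uq_ef i j : Uq_rel
    (e i * f j - (-1) ^+ (gpar i && gpar j) *: (f j * e i)
       - (i == j)%:R *: ((q - q^-1)^-1 *: (K i - KV i)))
| Uq_Ke i j : Uq_rel (K i * e j * KV i - qwt (alpha i) (alpha j) *: e j)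
| Uq_Kf i j : Uq_rel (K i * f j * KV i - (qwt (alpha i) (alpha j))^-1 *: f j)
| Uq_KK a b i j : Uq_rel (Kpm a i * Kpm b j - Kpm b j * Kpm a i)
| Uq_mulKV i : Uq_rel (K i * KV i - 1)
| Uq_mulVK i : Uq_rel (KV i * K i - 1)
| Uq_serre_e i j : i != j ->
    Uq_rel (iter (serre_exp i j) (ad_e i) (gpar j, e j)).2
| Uq_serre_f i j : i != j ->
    Uq_rel (iter (serre_exp i j) (ad_f i) (gpar j, f j)).2.

End Relations.

Definition Uq := pres_alg Uq_rel.

HB.instance Definition _ := GRing.PzRing.on Uq.
HB.instance Definition _ := GRing.Lmodule.on Uq.

Definition Uq_of (x : Uq_gen) : Uq := pgen Uq_rel x.

Definition Uq_Kpow (i : 'I_n) (m : int) : Uq :=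
  match m with
  | Posz k => Uq_of (GK, i) ^+ k
  | Negz k => Uq_of (GKV, i) ^+ k.+1
  end.

Definition Uq_K (x : weight n) : Uq := \prod_(i < n) Uq_Kpow i (alpha_coef x i).

(* E and F are root vectors for the normal ordering s; when a root has several
   minimal decompositions any of them may be used. *)
Definition root_vectors (s : seq (weight n)) (E Fv : weight n -> Uq) : Prop :=
  (forall i, E (alpha i) = Uq_of (GE, i) /\ Fv (alpha i) = Uq_of (GF, i)) /\
  (forall z, is_root z -> (forall i, z != alpha i) ->
     exists x y, [/\ minimal_pair s x y, z = x + y,
       E z = E x * E y
             - ((-1) ^+ (wpar x && wpar y) * qwt x y) *: (E y * E x)
     & Fv z = Fv y * Fv x
             - ((-1) ^+ (wpar x && wpar y) * (qwt x y)^-1) *: (Fv x * Fv y)]).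

Definition root_scalars (E Fv : weight n -> Uq) (a : weight n -> F) : Prop :=
  forall z, is_root z -> a z != 0 /\
    E z * Fv z - (-1) ^+ (wpar z) *: (Fv z * E z)
      = (a z / (q - q^-1)) *: (Uq_K z - Uq_K (- z)).

(* A module on a superspace is given by the action of the generators. *)
Definition action (B : superspace) := Uq_gen -> op F B.

Definition counit_action : action unit_space := fun x =>
  match x.1 with GE | GF => 0 | GK | GKV => 1 end.

Definition coprod_action (B C : superspace) (a : action B) (b : action C) :
    action (tens_space B C) := fun x =>
  match x with
  | (GE, i) => tens (a (GE, i)) (b (GK, i)) + tens 1 (b (GE, i))
  | (GF, i) => tens (a (GF, i)) 1 + tens (a (GKV, i)) (b (GF, i))
  | (GK, i) => tens (a (GK, i)) (b (GK, i))
  | (GKV, i) => tens (a (GKV, i)) (b (GKV, i))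
  end.

(* The fundamental module; label b is the k such that b stands for v_k. *)
Definition label (b : 'I_n.*2.+1) : int := b%:Z - n%:Z.

Definition V : superspace := @SuperSpace 'I_n.*2.+1 (fun b => label b != 0).

(* the map v_l |-> v_k, killing the other basis vectors *)
Definition vunit (k l : int) : op F V :=
  @mkop F V (fun y x => ((label y == k) && (label x == l))%:R).

Definition V_action : action V := fun x =>
  let: (c, i) := x in let k := i.+1%:Z in
  match c with
  | GE => if (i.+1 < n)%N then vunit k (k + 1) + vunit (- k - 1) (- k)
          else vunit k 0 - vunit 0 (- k)
  | GF => if (i.+1 < n)%N then vunit (k + 1) k + vunit (- k) (- k - 1)
          else vunit 0 k + vunit (- k) 0
  | GK => @mkop F V (fun y x => (y == x)%:R * qwt (alpha i) (eps n (label x)))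
  | GKV => @mkop F V (fun y x => (y == x)%:R / qwt (alpha i) (eps n (label x)))
  end.

Fixpoint Vpow (t : nat) : superspace :=
  if t is t'.+1 then tens_space V (Vpow t') else unit_space.

Fixpoint Vpow_action (t : nat) : action (Vpow t) :=
  if t is t'.+1 then coprod_action V_action (@Vpow_action t') else counit_action.

Definition affords_V (pi : {linear Uq -> op F V}) : Prop :=
  GRing.monoid_morphism pi /\ forall x, pi (Uq_of x) = V_action x.

(* Homogeneous endomorphisms of degree 0 commuting with U_q, i.e. with its
   generators. *)
Definition End_Uq (t : nat) : set (op F (Vpow t)) :=
  [set A | even_op A /\ forall x, A * Vpow_action t x = Vpow_action t x * A].

Definition qfact (z : F) (k : nat) : F :=
  \prod_(1 <= j < k.+1) ((1 - z ^+ j) / (1 - z)).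

(* the infinite sum is a sum over the finite support of its terms *)
Definition qexp (z : F) (B : superspace) (A : op F B) : op F B :=
  \sum_(k \in [set: nat]) (qfact z k)^-1 *: A ^+ k.

Section Braiding.
Variables (s : seq (weight n)) (E Fv : weight n -> Uq) (a : weight n -> F).
Variable pi : {linear Uq -> op F V}.

Local Notation VV := (tens_space V V).

(* (pi (x) pi)(R~_z) *)
Definition Rroot (z : weight n) : op F VV :=
  qexp ((-1) ^+ (wpar z) * (qwt z z)^-1)
    (((-1) ^+ (wpar z) * (a z)^-1 * (q - q^-1)) *: tens (pi (E z)) (pi (Fv z))).

Definition Rtilde : op F VV := \prod_(z <- s) Rroot z.

Definition Ecal : op F VV := @mkop F VV (fun y x =>
  (y == x)%:R * qwt (eps n (label x.1)) (eps n (label x.2))).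

Definition swap : op F VV := @mkop F VV (fun y x =>
  ((y.1 == x.2) && (y.2 == x.1))%:R * (-1) ^+ (spar x.1 && spar x.2)).

Definition Rcheck : op F VV := swap * Ecal * Rtilde.

(* A (x) id on V (x) (V (x) W) = (V (x) V) (x) W *)
Definition tens_head (W : superspace) (A : op F VV) :
    op F (tens_space V (tens_space V W)) :=
  @mkop F (tens_space V (tens_space V W)) (fun y x =>
    ent (tens A (1 : op F W)) ((y.1, y.2.1), y.2.2) ((x.1, x.2.1), x.2.2)).

(* R_at t i is Rcheck acting on the tensor factors i+1 and i+2 of V^(x)t; the
   last case is never used for i < t - 1. *)
Fixpoint R_at (t i : nat) : op F (Vpow t) :=
  match t, i with
  | t'.+2, 0 => @tens_head (Vpow t') Rcheck
  | t'.+1, i'.+1 => tens 1 (R_at t' i')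
  | _, _ => 1
  end.

Definition subalgebra (B : superspace) (S : set (op F B)) : Prop :=
  [/\ S 1, forall c x y, S x -> S y -> S (c *: x + y)
    & forall x y, S x -> S y -> S (x * y)].

(* the subalgebra of End_Uq generated by the R_i^{+-1} *)
Definition Ct (t : nat) : set (op F (Vpow t)) :=
  [set A | End_Uq A /\
    forall S : set (op F (Vpow t)), subalgebra S -> S `<=` @End_Uq t ->
      (forall i : 'I_t.-1, S (R_at t i) /\ S (invmx (R_at t i))) -> S A].

End Braiding.

End QuantumGroup.

(* Main.v *)
(** Write z = q - q^-1, r = - q^(2n) and let G be minus the braiding on V (x) V.
    Multiplying the factors of R~ one root at a time, the partial products depend
    on the normal ordering only through the set of roots already passed, so the
    matrix of G is the same for all normal orderings, and from its entries one
    checks that G commutes with U_q.  Over U_q, V (x) V is generated by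
    v_1 (x) v_(-1) and V (x) V (x) V by the vectors v_1 (x) v_b (x) v_(-1), so an
    identity between operators commuting with U_q has to be checked on these
    vectors only.  There G permutes the tensor factors up to scalars, which gives
    the braid relation.  The operator e = (r / z) (1 + z G - G^2) kills
    v_a (x) v_b unless b = - a and sends v_1 (x) v_(-1) to a multiple of an
    invariant vector Omega with G Omega = r^-1 Omega (a geometric sum).  Hence
    e G = r^-1 e, G^-1 = G - z + z e and e = 1 - (G - G^-1) / z, and the two loop
    relations reduce to the values of e at v_1 (x) v_(-1) and v_(-1) (x) v_1. *)

Require Import Defs.
From HB Require Import structures.
From mathcomp Require Import all_boot all_order all_algebra.
From mathcomp Require Import boolp classical_sets cardinality fsbigop reals complex.
From mathcomp Require Import finmap monalg.
From mathcomp Require Import zify ring.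

Set Implicit Arguments.
Unset Strict Implicit.
Unset Printing Implicit Defensive.

Import Order.TTheory GRing.Theory Num.Theory.
Local Open Scope ring_scope.

(** * Operators on super vector spaces *)

Section Ops.
Variable F : fieldType.
Implicit Types B C D W : superspace.

(** The obstacle is that the root vectors are not explicit: their matrix entries in [V], and hence
    those of each factor of R~, depend on the normal ordering and on the chosen decompositions. The
    bracket relation with [a_gamma] fixes only the product of the entry of [E_gamma] from [v_a] to
    [v_b] with the entry of [F_gamma] back. This is enough on [v_a (x) v_b] with [b] not dual to
    [a]. On the zero weight space the [E] entry of the pair [(a, b)] meets the [F] entry of the dual
    pair, so the ratio of the two [E] entries is needed. This ratio, [rho a b], is a sign times a
    product of factors [- q^-1] or [- q], one for each label [c] strictly between [a] and [b] other
    than that of [v_0], according to whether the root [gam a c] precedes [gamma]. It is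
    multiplicative along a minimal decomposition, up to one factor that absorbs the bracket
    coefficient: roots of a normal ordering lie between their summands, and minimality excludes the
    interleavings that would spoil the product. Short roots, whose squares act on the zero weight
    space, cause most of the case distinctions. *)

Lemma ent_mkop B (f : B -> B -> F) y x : ent (mkop f) y x = f y x.
Proof. by rewrite /ent mxE !enum_rankK. Qed.

Lemma opP B (A A' : op F B) : (forall y x, ent A y x = ent A' y x) -> A = A'.
Proof.
move=> h; apply/matrixP => i j.
by have := h (enum_val i) (enum_val j); rewrite /ent !enum_valK.
Qed.

Lemma entM B (A A' : op F B) y x :
  ent (A * A') y x = \sum_(m : B) ent A y m * ent A' m x.
Proof.
rewrite /ent mxE (reindex_onto enum_rank enum_val) /=; last first.
  by move=> i _; rewrite enum_valK.
by apply: eq_bigl => m; rewrite enum_rankK eqxx.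
Qed.

Lemma ent1 B (y x : B) : ent (1 : op F B) y x = (y == x)%:R.
Proof. by rewrite /ent mxE (inj_eq enum_rank_inj). Qed.

Lemma ent0 B (y x : B) : ent (0 : op F B) y x = 0.
Proof. by rewrite /ent mxE. Qed.

Lemma entD B (A A' : op F B) y x : ent (A + A') y x = ent A y x + ent A' y x.
Proof. by rewrite /ent mxE. Qed.

Lemma entN B (A : op F B) y x : ent (- A) y x = - ent A y x.
Proof. by rewrite /ent mxE. Qed.

Lemma entZ B c (A : op F B) y x : ent (c *: A) y x = c * ent A y x.
Proof. by rewrite /ent mxE. Qed.

Lemma ent_tens B C (a : op F B) (b : op F C) (y x : tens_space B C) :
  ent (tens a b) y x =
  (-1) ^+ ((spar y.2 (+) spar x.2) && spar x.1)
    * (ent a y.1 x.1 * ent b y.2 x.2).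
Proof. exact: ent_mkop. Qed.

Lemma op_scaleAl B c (A A' : op F B) : c *: (A * A') = (c *: A) * A'.
Proof. exact: scalemxAl. Qed.

Lemma op_scaleAr B c (A A' : op F B) : c *: (A * A') = A * (c *: A').
Proof. exact: scalemxAr. Qed.

Lemma even_op1 B : even_op (1 : op F B).
Proof. by move=> x y h; rewrite ent1; case: (eqVneq y x) h => // ->; rewrite eqxx. Qed.

Lemma even_opD B (A A' : op F B) : even_op A -> even_op A' -> even_op (A + A').
Proof. by move=> hA hA' x y h; rewrite entD hA // hA' // addr0. Qed.

Lemma even_opZ B c (A : op F B) : even_op A -> even_op (c *: A).
Proof. by move=> hA x y h; rewrite entZ hA // mulr0. Qed.

Lemma even_opM B (A A' : op F B) : even_op A -> even_op A' -> even_op (A * A').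
Proof.
move=> hA hA' x y h; rewrite entM big1 // => m _.
have [hm|hm] := eqVneq (spar x) (spar m); last by rewrite hA' ?mulr0.
by rewrite hA ?mul0r // -hm.
Qed.

Lemma tens11 B C : tens (1 : op F B) (1 : op F C) = 1.
Proof.
apply: opP => -[y1 y2] [x1 x2]; rewrite ent_tens !ent1 /= xpair_eqE.
by case: (y1 == x1); case: eqVneq => [->|_] /=;
  rewrite ?addbb ?mul0r ?mulr0 ?mulr1 ?expr0.
Qed.

Lemma tensDl B C (a a' : op F B) (b : op F C) :
  tens (a + a') b = tens a b + tens a' b.
Proof. by apply: opP => y x; rewrite entD !ent_tens entD mulrDl mulrDr. Qed.

Lemma tensDr B C (a : op F B) (b b' : op F C) :
  tens a (b + b') = tens a b + tens a b'.
Proof. by apply: opP => y x; rewrite entD !ent_tens entD mulrDr mulrDr. Qed.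

Lemma tensZr B C c (a : op F B) (b : op F C) : tens a (c *: b) = c *: tens a b.
Proof. by apply: opP => y x; rewrite entZ !ent_tens entZ; ring. Qed.

(** Moving [b] past [a'] costs a sign of exponent [[b][a']], which is trivial as soon as one of the
    two is even: the entries with a wrong sign vanish. *)
Lemma tensM B C (a a' : op F B) (b b' : op F C) : even_op a' \/ even_op b ->
  tens a b * tens a' b' = tens (a * a') (b * b').
Proof.
move=> h; apply: opP => -[y1 y2] [x1 x2].
rewrite entM ent_tens !entM /= big_distrlr /= mulr_sumr.
under [RHS]eq_bigr do rewrite mulr_sumr.
rewrite pair_big /=; apply: eq_bigr => -[m1 m2] _; rewrite !ent_tens /=.
have -> : (-1) ^+ ((spar y2 (+) spar m2) && spar m1) *
    (ent a y1 m1 * ent b y2 m2) *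
    ((-1) ^+ ((spar m2 (+) spar x2) && spar x1) * (ent a' m1 x1 * ent b' m2 x2))
  = ((-1) ^+ ((spar y2 (+) spar m2) && spar m1) *
     (-1) ^+ ((spar m2 (+) spar x2) && spar x1)) * 
    (ent a y1 m1 * ent a' m1 x1 * (ent b y2 m2 * ent b' m2 x2)) by ring.
have [h1|h1] := eqVneq (spar m1) (spar x1).
  congr (_ * _); rewrite -signr_addb h1.
  by case: (spar x1); rewrite ?andbF ?andbT // addbA addbK.
have [h2|h2] := eqVneq (spar y2) (spar m2).
  by congr (_ * _); rewrite -signr_addb h2 addbb.
case: h => h; first by rewrite [ent a' _ _]h ?mulr0 ?mul0r ?mulr0 // eq_sym.
by rewrite [ent b _ _]h ?mulr0 ?mul0r ?mulr0 // eq_sym.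
Qed.

Lemma tens1M B C (b b' : op F C) :
  tens (1 : op F B) (b * b') = tens 1 b * tens 1 b'.
Proof. by rewrite tensM ?mulr1 //; left; apply: even_op1. Qed.

Lemma even_tens1 B C (b : op F C) : even_op b -> even_op (tens (1 : op F B) b).
Proof.
move=> hb [x1 x2] [y1 y2] /= h; rewrite ent_tens ent1 /=.
case: (eqVneq y1 x1) h => [->|]; last by rewrite mul0r mulr0.
by rewrite (inj_eq (can_inj (addKb _))) => h; rewrite hb // !mulr0.
Qed.

Section Reassoc.
Variables B C D : superspace.

Definition reassoc (A : op F (tens_space (tens_space B C) D)) :
    op F (tens_space B (tens_space C D)) :=
  @mkop F (tens_space B (tens_space C D)) (fun y x =>
    ent A ((y.1, y.2.1), y.2.2) ((x.1, x.2.1), x.2.2)).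

Lemma ent_reassoc A (y x : tens_space B (tens_space C D)) :
  ent (reassoc A) y x = ent A ((y.1, y.2.1), y.2.2) ((x.1, x.2.1), x.2.2).
Proof. exact: ent_mkop. Qed.

Lemma reassocD A A' : reassoc (A + A') = reassoc A + reassoc A'.
Proof. by apply: opP => y x; rewrite entD !ent_reassoc entD. Qed.

Lemma reassocM A A' : reassoc (A * A') = reassoc A * reassoc A'.
Proof.
apply: opP => -[y1 [y2 y3]] [x1 [x2 x3]]; rewrite ent_reassoc !entM /=.
rewrite (reindex (fun m : B * (C * D) => ((m.1, m.2.1), m.2.2))) /=; last first.
  by exists (fun m : (B * C) * D => (m.1.1, (m.1.2, m.2))) => [[? []]|[[]]].
by apply: eq_bigr => -[m1 [m2 m3]] _; rewrite !ent_reassoc.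
Qed.

Lemma reassoc1 : reassoc 1 = 1.
Proof.
apply: opP => -[y1 [y2 y3]] [x1 [x2 x3]]; rewrite ent_reassoc !ent1 /=.
by rewrite !xpair_eqE andbA.
Qed.

(** Both bracketings give the sign exponent [([y2]+[x2])[x1] + ([y3]+[x3])([x1]+[x2])]. *)
Lemma reassoc_tens (a : op F B) (b : op F C) (c : op F D) :
  reassoc (tens (tens a b) c) = tens a (tens b c).
Proof.
apply: opP => -[y1 [y2 y3]] [x1 [x2 x3]]; rewrite ent_reassoc !ent_tens /=.
by case: (spar y2) (spar y3) (spar x1) (spar x2) (spar x3)
  => [] [] [] [] [] /=; ring.
Qed.

End Reassoc.

End Ops.

(** * Even operators commuting with the quantum group *)

Section Commutant.
Variables (F : fieldType) (n : nat) (q : F).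

Definition commutes_with B (a : action F n B) (A : op F B) : Prop :=
  forall x, A * a x = a x * A.

(** For the action on [Vpow n t] this is membership in [End_Uq]. An arbitrary action is allowed so
    that the notion passes to tensor products. *)
Definition super_commutant B (a : action F n B) (A : op F B) : Prop :=
  even_op A /\ commutes_with a A.

Lemma super_commutant1 B (a : action F n B) : super_commutant a 1.
Proof. by split=> [|x]; [apply: even_op1 | rewrite mul1r mulr1]. Qed.

Lemma super_commutantD B (a : action F n B) A A' :
  super_commutant a A -> super_commutant a A' -> super_commutant a (A + A').
Proof.
move=> [eA cA] [eA' cA']; split=> [|x]; first exact: even_opD.
by rewrite mulrDl mulrDr cA cA'.
Qed.

Lemma super_commutantZ B (a : action F n B) c A :
  super_commutant a A -> super_commutant a (c *: A).
Proof.
move=> [eA cA]; split=> [|x]; first exact: even_opZ.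
by rewrite -op_scaleAl -op_scaleAr cA.
Qed.

Lemma super_commutantN B (a : action F n B) A :
  super_commutant a A -> super_commutant a (- A).
Proof. by rewrite -scaleN1r; apply: super_commutantZ. Qed.

Lemma super_commutantM B (a : action F n B) A A' :
  super_commutant a A -> super_commutant a A' -> super_commutant a (A * A').
Proof.
move=> [eA cA] [eA' cA']; split=> [|x]; first exact: even_opM.
by rewrite -mulrA cA' mulrA cA mulrA.
Qed.

Lemma super_commutant_tens1 B C (a : action F n B) (b : action F n C) A :
  super_commutant b A -> super_commutant (coprod_action a b) (tens 1 A).
Proof.
move=> [eA cA]; have e1 := @even_op1 F.
have cl x b' : tens 1 A * tens x b' = tens x (A * b') :> op F (tens_space B C).
  by rewrite tensM ?mul1r //; right.
have cr x b' : tens x b' * tens 1 A = tens x (b' * A) :> op F (tens_space B C).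
  by rewrite tensM ?mulr1 //; left.
split=> [|[[] i]] /=; first exact: even_tens1.
all: by rewrite ?mulrDl ?mulrDr !cl !cr ?cA ?mulr1 ?mul1r.
Qed.

Lemma super_commutant_tensA1 B C (a : action F n B) (b : action F n C) A :
  super_commutant a A -> super_commutant (coprod_action a b) (tens A 1).
Proof.
move=> [eA cA]; have e1 := @even_op1 F.
have cl x b' : tens A 1 * tens x b' = tens (A * x) b' :> op F (tens_space B C).
  by rewrite tensM ?mul1r //; right.
have cr x b' : tens x b' * tens A 1 = tens (x * A) b' :> op F (tens_space B C).
  by rewrite tensM ?mulr1 //; left.
split=> [|[[] i]] /=; last first.
1-4: by rewrite ?mulrDl ?mulrDr !cl !cr ?cA ?mulr1 ?mul1r.
move=> [x1 x2] [y1 y2] /= h; rewrite ent_tens ent1 /=.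
case: (eqVneq y2 x2) h => [->|]; last by rewrite !mulr0.
by rewrite (inj_eq (can_inj (addbK _))) => h; rewrite eA // mul0r mulr0.
Qed.

(** Coassociativity of the coproduct, checked on generators. *)
Lemma coprod_action_reassoc B C D (a : action F n B) (b : action F n C)
    (c : action F n D) x :
  coprod_action a (coprod_action b c) x =
  reassoc (coprod_action (coprod_action a b) c x).
Proof.
case: x => [[] i] /=; rewrite ?reassocD ?reassoc_tens //.
- by rewrite !tensDr tensDl reassocD -tens11 !reassoc_tens addrA.
- by rewrite tensDl reassocD !reassoc_tens tensDr tens11 addrA.
Qed.

Lemma super_commutant_reassoc B C D (a : action F n B) (b : action F n C)
    (c : action F n D) A :
  super_commutant (coprod_action (coprod_action a b) c) A ->
  super_commutant (coprod_action a (coprod_action b c)) (reassoc A).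
Proof.
move=> [eA cA]; split=> [|x].
  by move=> [x1 [x2 x3]] [y1 [y2 y3]] /= h; rewrite ent_reassoc eA //= -!addbA.
by rewrite !coprod_action_reassoc -!reassocM cA.
Qed.

End Commutant.

(** * Operators on neighbouring tensor factors *)

Section Local.
Variables (F : fieldType) (n : nat) (q : F).
Local Notation V := (V n).
Local Notation VV := (tens_space V V).
Local Notation T3 := (tens_space V VV).

Lemma tens_headE W (A : op F VV) : @tens_head F n W A = reassoc (tens A (1 : op F W)).
Proof. by []. Qed.

(** The recursion of [R_at] with an arbitrary operator in place of [Rcheck], so that identities on
    [V (x) V] can be transported to the tensor power. Outside the range [i + 1 < t] the value is 1,
    which respects products but not sums. *)
Fixpoint op_at (A : op F VV) (t i : nat) : op F (Vpow n t) :=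
  match t, i with
  | t'.+2, 0 => @tens_head F n (Vpow n t') A
  | t'.+1, i'.+1 => tens 1 (op_at A t' i')
  | _, _ => 1
  end.

Lemma op_at0 A t : op_at A t.+2 0 = reassoc (tens A (1 : op F (Vpow n t))).
Proof. by []. Qed.

Lemma op_atS A t i : op_at A t.+1 i.+1 = tens 1 (op_at A t i).
Proof. by case: t. Qed.

Definition head3 W (A : op F T3) :
    op F (tens_space V (tens_space V (tens_space V W))) :=
  @mkop F (tens_space V (tens_space V (tens_space V W))) (fun y x =>
    ent (tens A (1 : op F W)) ((y.1, (y.2.1, y.2.2.1)), y.2.2.2)
                              ((x.1, (x.2.1, x.2.2.1)), x.2.2.2)).

Lemma ent_head3 W A (y x : tens_space V (tens_space V (tens_space V W))) :
  ent (head3 W A) y x =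
  ent A (y.1, (y.2.1, y.2.2.1)) (x.1, (x.2.1, x.2.2.1))
    * (y.2.2.2 == x.2.2.2)%:R.
Proof.
rewrite ent_mkop ent_tens ent1 /=.
case: (eqVneq y.2.2.2 x.2.2.2) => [->|]; last by rewrite !mulr0.
by rewrite addbb mul1r.
Qed.

Lemma head3M W A A' : head3 W (A * A') = head3 W A * head3 W A'.
Proof.
apply: opP => -[y1 [y2 [y3 y4]]] [x1 [x2 [x3 x4]]].
rewrite entM ent_head3 entM /= mulr_suml.
pose f (m : T3) (w : W) : tens_space V (tens_space V (tens_space V W)) :=
  (m.1, (m.2.1, (m.2.2, w))).
rewrite [RHS](reindex (fun m : T3 * W => f m.1 m.2)) /=; last first.
  exists (fun m => ((m.1, (m.2.1, m.2.2.1)), m.2.2.2)).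
    by move=> [[? [? ?]] ?].
  by move=> [? [? [? ?]]].
pose g m w : F := ent (head3 W A) (y1, (y2, (y3, y4))) (f m w) *
   ent (head3 W A') (f m w) (x1, (x2, (x3, x4))).
rewrite -(pair_bigA _ g) /=.
apply: eq_bigr => -[m1 [m2 m3]] _.
rewrite (bigD1 y4) //= big1 ?addr0 => [|w hw]; rewrite /g !ent_head3 /=.
  by rewrite eqxx mulr1 mulrA.
by rewrite [y4 == w]eq_sym (negbTE hw) mulr0 mul0r.
Qed.

Definition op12 (A : op F VV) : op F T3 := reassoc (tens A (1 : op F V)).
Definition op23 (A : op F VV) : op F T3 := tens (1 : op F V) A.

Lemma ent_tens_head W A (y x : tens_space V (tens_space V W)) :
  ent (@tens_head F n W A) y x =
  ent A (y.1, y.2.1) (x.1, x.2.1) * (y.2.2 == x.2.2)%:R.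
Proof.
rewrite ent_mkop ent_tens ent1 /=.
case: (eqVneq y.2.2 x.2.2) => [->|]; last by rewrite !mulr0.
by rewrite addbb mul1r.
Qed.

Lemma head3_op12 W A : head3 W (op12 A) = tens_head (tens_space V W) A.
Proof.
apply: opP => -[y1 [y2 [y3 y4]]] [x1 [x2 [x3 x4]]].
rewrite ent_head3 ent_tens_head ent_reassoc ent_tens ent1 /= xpair_eqE.
case: (eqVneq y3 x3) => [->|] /=; last by rewrite !mulr0 ?mul0r.
by rewrite addbb /= mul1r mulr1.
Qed.

Lemma head3_op23 W A : head3 W (op23 A) = tens 1 (tens_head W A).
Proof.
apply: opP => -[y1 [y2 [y3 y4]]] [x1 [x2 [x3 x4]]].
rewrite ent_head3 !ent_tens ent_tens_head ent1 /=.
case: (eqVneq y4 x4) => [->|]; last by rewrite !mulr0.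
rewrite !mulr1; congr (_ ^+ (_ && _) * _).
by case: (label y2 != 0) (label y3 != 0) (label x2 != 0) (label x3 != 0)
  (spar x4) => [] [] [] [] [].
Qed.

(** A relation between the positions [i] and [i + 1] is proved once on three factors and then
    transported by [op3_at12] and [op3_at23]. *)
Fixpoint op3_at (A : op F T3) (t i : nat) : op F (Vpow n t) :=
  match t, i with
  | t'.+3, 0 => head3 (Vpow n t') A
  | t'.+1, i'.+1 => tens 1 (op3_at A t' i')
  | _, _ => 1
  end.

Lemma op_atM A A' t i : op_at (A * A') t i = op_at A t i * op_at A' t i.
Proof.
elim: i t => [|i IH] [|[|t]] /=; rewrite ?mulr1 //.
- rewrite !tens_headE -reassocM tensM ?mulr1 //; right; exact: even_op1.
- by rewrite IH tens1M.
- by rewrite IH tens1M.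
Qed.

Lemma op_at1 t i : op_at 1 t i = 1.
Proof.
elim: i t => [|i IH] [|[|t]] //=; last 2 first.
- by rewrite IH tens11.
- by rewrite IH tens11.
- by rewrite tens_headE tens11 reassoc1.
Qed.

Lemma op_atD A A' t i : (i.+1 < t)%N ->
  op_at (A + A') t i = op_at A t i + op_at A' t i.
Proof.
elim: i t => [|i IH] [|[|t]] //= h.
  by rewrite !tens_headE tensDl reassocD.
by rewrite IH // tensDr.
Qed.

Lemma op_atZ c A t i : (i.+1 < t)%N -> op_at (c *: A) t i = c *: op_at A t i.
Proof.
elim: i t => [|i IH] [|[|t]] //= h.
  by apply: opP => y x; rewrite entZ !ent_tens_head entZ mulrA.
by rewrite IH // tensZr.
Qed.

Lemma op3_atM A A' t i : op3_at (A * A') t i = op3_at A t i * op3_at A' t i.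
Proof.
elim: i t => [|i IH] [|[|[|t]]] /=; rewrite ?mulr1 // ?head3M //;
  by rewrite ?IH ?tens1M.
Qed.

Lemma op3_at12 A t i : (i.+2 < t)%N -> op3_at (op12 A) t i = op_at A t i.
Proof.
elim: i t => [|i IH] [|[|[|t]]] //= h; first by rewrite head3_op12.
by rewrite IH.
Qed.

Lemma op3_at23 A t i : (i.+2 < t)%N -> op3_at (op23 A) t i = op_at A t i.+1.
Proof.
elim: i t => [|i IH] [|[|[|t]]] //= h; first by rewrite head3_op23.
by rewrite IH.
Qed.

(** Once the common leading factors are stripped, [A] sits on the first two factors and [A']
    strictly to their right; evenness of [A] removes the sign of the exchange. *)
Lemma op_at_far A A' t i j : even_op A -> (i.+1 < j)%N ->
  op_at A t i * op_at A' t j = op_at A' t j * op_at A t i.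
Proof.
move=> eA; elim: i t j => [|i IH] [|[|t]] [|[|j]] // h; last 2 first.
- by have /(congr1 (@tens F V _ 1)) := IH 0%N j.+1 h; rewrite !tens1M.
- by have /(congr1 (@tens F V _ 1)) := IH t.+1 j.+1 h; rewrite !tens1M.
- by rewrite mulr1 mul1r.
rewrite op_at0 !op_atS -(reassoc_tens 1 1) tens11 -!reassocM.
by rewrite !tensM ?mulr1 ?mul1r //; [left | right; apply: even_op1].
Qed.

Lemma op_at_commutant A t i :
  super_commutant (coprod_action (V_action q) (V_action q)) A ->
  super_commutant (@Vpow_action F n q t) (op_at A t i).
Proof.
move=> hA; elim: i t => [|i IH] [|t]; try exact: super_commutant1.
- case: t => [|t]; first exact: super_commutant1.
  by apply: super_commutant_reassoc; apply: super_commutant_tensA1.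
- by rewrite op_atS; apply: super_commutant_tens1; apply: IH.
Qed.

End Local.

(** * Representations of presented algebras *)

Section Presentation.
Local Open Scope fset_scope.
Local Open Scope ring_scope.
Variables (F : fieldType) (X : choiceType) (B : superspace) (h : X -> op F B).

Definition mon_rep (k : {fmonom X}) : op F B := \prod_(x <- (k : seq X)) h x.

Definition free_rep (x : free_alg F X) : op F B :=
  \sum_(k <- msupp x) x@_k *: mon_rep k.

Lemma free_repEw (d : {fset {fmonom X}}) x : msupp x `<=` d ->
  free_rep x = \sum_(k <- d) x@_k *: mon_rep k.
Proof.
move=> le; rewrite [LHS](big_fset_incl _ le) => //= k kd /mcoeff_outdom ->.
by rewrite scale0r.
Qed.

Lemma free_rep_is_linear c (x y : free_alg F X) :
  free_rep (c *: x + y) = c *: free_rep x + free_rep y.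
Proof.
have hx : msupp x `<=` (msupp x `|` msupp y)%fset by apply: fsubsetUl.
have hy : msupp y `<=` (msupp x `|` msupp y)%fset by apply: fsubsetUr.
have hxy : msupp (c *: x + y) `<=` (msupp x `|` msupp y)%fset.
  apply: (fsubset_trans (msuppD_le _ _)).
  by apply: fsetSU; apply: msuppZ_le.
rewrite (free_repEw hx) (free_repEw hy) (free_repEw hxy) scaler_sumr -big_split.
by apply: eq_bigr => k _; rewrite mcoeffD mcoeffZ scalerDl scalerA.
Qed.

HB.instance Definition _ := GRing.isLinear.Build F (free_alg F X) (op F B) _
  free_rep free_rep_is_linear.

Lemma free_repU c k : free_rep << c *g k >> = c *: mon_rep k.
Proof. by rewrite (free_repEw msuppU_le) big_seq_fset1 mcoeffUU. Qed.

Lemma free_rep_gen x : free_rep (fgen F x) = h x.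
Proof. by rewrite free_repU scale1r /mon_rep fmU big_seq1. Qed.

Lemma free_repM x y : free_rep (x * y) = free_rep x * free_rep y.
Proof.
rewrite malgME linear_sum /= [RHS]big_distrlr /=; apply: eq_bigr => k1 _.
rewrite linear_sum; apply: eq_bigr => k2 _ /=.
rewrite free_repU /mon_rep fmM big_cat /= -scalerA op_scaleAr.
by rewrite -op_scaleAl -op_scaleAr.
Qed.

Lemma free_rep1 : free_rep 1 = 1.
Proof.
have -> : (1 : free_alg F X) = << (1 : F) *g fmone X >> by [].
by rewrite free_repU scale1r /mon_rep fmoneE big_nil.
Qed.

(** The premises have the shape of the closure conditions in [subalgebra]; this is how every value
    of the representation is shown to lie in [Ct]. *)
Lemma free_alg_ind (P : free_alg F X -> Prop) :
  P 1 -> (forall x, P (fgen F x)) ->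
  (forall c x y, P x -> P y -> P (c *: x + y)) ->
  (forall x y, P x -> P y -> P (x * y)) -> forall x, P x.
Proof.
move=> P1 Pg PD PM x; rewrite [x]monalgE.
have P0 : P 0 by have := PD (-1) _ _ P1 P1; rewrite scaleN1r addNr.
have PZ c y : P y -> P (c *: y) by move=> Py; have := PD c _ _ Py P0; rewrite addr0.
apply: big_ind => //= [y z Py Pz|k _].
  by have := PD 1 _ _ Py Pz; rewrite scale1r.
have -> : << x@_k *g k >> = x@_k *: (<< (1 : F) *g k >> : free_alg F X).
  by apply/malgP => k'; rewrite mcoeffZ !mcoeffU mulrnAr mulr1.
apply: PZ; case: k => r; elim: r => [|i r IH].
  suff -> : << (1 : F) *g FMonom [::] >> = (1 : free_alg F X) by [].
  by congr << _ *g _ >>; apply/val_inj; rewrite /= fm1.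
have -> : << (1 : F) *g FMonom (i :: r) >> = fgen F i * << (1 : F) *g FMonom r >>.
  rewrite malgME !msuppU !oner_eq0 !big_seq_fset1 !mcoeffUU mulr1.
  by congr << _ *g _ >>; apply/val_inj; rewrite /= fmM fmU.
exact: PM.
Qed.

Variable rel : set (free_alg F X).
Hypothesis rep_rel : forall x, rel x -> free_rep x = 0.

(** The kernel of [free_rep] is a two-sided ideal containing [rel], hence contains the smallest
    one. *)
Lemma free_rep_ideal x : x \in rel_ideal rel -> free_rep x = 0.
Proof.
move=> /asboolP /(_ (fun y => free_rep y = 0)); apply=> //=.
split=> /= [|y z hy hz|a b y hy]; first exact: linear0.
  by rewrite linearB /= hy hz subr0.
by rewrite !free_repM hy mulr0 mul0r.
Qed.

(** The proof that the relations hold is made an argument, because the linear structure attached to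
    this function depends on it. *)
Definition pres_rep of (forall x, rel x -> free_rep x = 0) :=
  fun u : pres_alg rel => free_rep (repr u).

Local Notation rep := (pres_rep rep_rel).

Lemma pres_rep_pi x : rep (pres_pi rel x) = free_rep x.
Proof.
apply/eqP; rewrite -subr_eq0 -linearB /=; apply/eqP; apply: free_rep_ideal.
by apply/pres_piP; rewrite pres_piK.
Qed.

Lemma pres_rep_is_linear c u v : rep (c *: u + v) = c *: rep u + rep v.
Proof.
rewrite -[u]pres_piK -[v]pres_piK -pres_pi_scale -pres_piD !pres_rep_pi.
exact: linearP.
Qed.

HB.instance Definition _ := GRing.isLinear.Build F (pres_alg rel) (op F B) _
  rep pres_rep_is_linear.

Lemma pres_rep_monoid : GRing.monoid_morphism rep.
Proof.
split=> [|u v]; first by rewrite -pres_pi1 pres_rep_pi free_rep1.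
rewrite -[u]pres_piK -[v]pres_piK -pres_pi_mul !pres_rep_pi.
exact: free_repM.
Qed.

Lemma pres_rep_gen x : rep (pgen rel x) = h x.
Proof. by rewrite pres_rep_pi free_rep_gen. Qed.

End Presentation.

(** * Weights of the fundamental module *)

Ltac split_ifs :=
  repeat match goal with |- context [if ?c then _ else _] =>
    lazymatch c with context [if _ then _ else _] => fail | _ =>
      let h := fresh in destruct c eqn:h end end.

Section Labels.
Variable n : nat.
Implicit Types (a b c : V n) (x y z : weight n).

Definition pos_nat (p : nat) : nat :=
  if (p < n)%N then (n - p.+1)%N
  else if p == n then n else ((3 * n).+1 - p)%N.

(* [pos] numbers v_(-1), .., v_(-n), v_0, v_n, .., v_1 from 0 to 2n, so that
   weights increase; its inverse [vx] is junk beyond 2n, and [dual] exchanges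
   v_k and v_(-k). *)
Definition pos (b : V n) : nat := pos_nat b.
Definition vx (p : nat) : V n := inord (pos_nat p).
Definition dual (b : V n) : V n := rev_ord b.

Lemma ltn_label b : (b < (2 * n).+1)%N.
Proof. by have : (b < n.*2.+1)%N := ltn_ord b; lia. Qed.

(** The map reverses each of the blocks [0 .. n - 1] and [n + 1 .. 2 n] and fixes [n], so it serves
    both as the numbering and as its inverse. *)
Lemma pos_natK p : (p <= 2 * n)%N -> pos_nat (pos_nat p) = p.
Proof. by rewrite /pos_nat => h; split_ifs; lia. Qed.

Lemma pos_nat_le p : (p <= 2 * n)%N -> (pos_nat p <= 2 * n)%N.
Proof. by rewrite /pos_nat => h; split_ifs; lia. Qed.

Lemma pos_le b : (pos b <= 2 * n)%N.
Proof. by apply: pos_nat_le; have := ltn_label b. Qed.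

Lemma vx_val p : (p <= 2 * n)%N -> vx p = pos_nat p :> nat.
Proof.
by move=> h; rewrite /vx inordK // ltnS; have := pos_nat_le h; lia.
Qed.

Lemma posK b : vx (pos b) = b.
Proof.
apply/val_inj => /=; rewrite vx_val ?pos_le // pos_natK //.
by have := ltn_label b.
Qed.

Lemma vxK p : (p <= 2 * n)%N -> pos (vx p) = p.
Proof. by move=> h; rewrite /pos vx_val // pos_natK. Qed.

Lemma pos_inj : injective pos.
Proof. exact: can_inj posK. Qed.

Lemma pos_eq a b : (pos a == pos b) = (a == b).
Proof. exact: inj_eq pos_inj _ _. Qed.

Lemma dualK : involutive dual.
Proof. exact: rev_ordK. Qed.

Lemma dual_eq a b : (dual a == dual b) = (a == b).
Proof. exact: inj_eq (can_inj dualK) _ _. Qed.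

Lemma dual_val b : dual b = (2 * n - b)%N :> nat.
Proof. by rewrite /= subSS; lia. Qed.

Lemma pos_dual b : pos (dual b) = (2 * n - pos b)%N.
Proof.
have := ltn_label b; rewrite /pos dual_val /pos_nat => h.
by split_ifs; lia.
Qed.

Definition mid : V n := vx n.

Lemma pos_mid : pos mid = n.
Proof. by rewrite vxK // leq_pmull. Qed.

Lemma mid_val : mid = n :> nat.
Proof. by rewrite vx_val ?leq_pmull // /pos_nat ltnn eqxx. Qed.

Lemma dual_mid : dual mid = mid.
Proof. by apply: pos_inj; rewrite pos_dual pos_mid; lia. Qed.

Lemma label_pos b : label b =
  if (pos b < n)%N then - (pos b).+1%:Z
  else if pos b == n then 0 else (2 * n).+1%:Z - (pos b)%:Z.
Proof.
have := ltn_label b; rewrite /label /pos /pos_nat => h.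
by split_ifs; lia.
Qed.

Lemma label_eq0 b : (label b == 0) = (b == mid).
Proof.
rewrite -pos_eq pos_mid label_pos; have := pos_le b.
by split_ifs; lia.
Qed.

Lemma spar_mid b : spar b = (b != mid).
Proof. by rewrite /= label_eq0. Qed.

Definition wt (b : V n) : weight n := eps n (label b).

Lemma wtE b i : wt b 0 i = (label b == i.+1%:Z)%:R - (label b == - i.+1%:Z)%:R.
Proof. by rewrite mxE. Qed.

Lemma label_dual b : label (dual b) = - label b.
Proof. by rewrite /label dual_val; have := ltn_label b; lia. Qed.

Lemma wt_dual b : wt (dual b) = - wt b.
Proof.
apply/rowP => i; rewrite [RHS]mxE !wtE label_dual eqr_opp eqr_oppLR.
by rewrite opprB.
Qed.

Lemma wt_mid : wt mid = 0.
Proof. by apply/rowP => i; rewrite wtE [RHS]mxE /label mid_val subrr. Qed.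

Lemma wformDl x y z : wform (x + y) z = wform x z + wform y z.
Proof. by rewrite -big_split; apply: eq_bigr => i _; rewrite mxE mulrDl. Qed.

Lemma wformC x y : wform x y = wform y x.
Proof. by apply: eq_bigr => i _; rewrite mulrC. Qed.

Lemma wformDr x y z : wform z (x + y) = wform z x + wform z y.
Proof. by rewrite ![wform z _]wformC wformDl. Qed.

Lemma wformNl x y : wform (- x) y = - wform x y.
Proof. by rewrite -sumrN; apply: eq_bigr => i _; rewrite mxE mulNr. Qed.

Lemma wformNr x y : wform x (- y) = - wform x y.
Proof. by rewrite wformC wformNl wformC. Qed.

Lemma wform0l x : wform 0 x = 0.
Proof. by rewrite /wform big1 // => i _; rewrite mxE mul0r. Qed.

Definition wformE := (wformDl, wformDr, wformNl, wformNr).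

Lemma label_inj : injective (@label n).
Proof. by move=> a b /addIr /= [] /val_inj. Qed.

(** The two indicators cancel at [mid], the only self-dual label, whose weight is zero. Passing from
    [b] to its dual changes the sign of both sides, so positive labels suffice. *)
Lemma wform_wt a b : wform (wt a) (wt b) = (a == b)%:R - (a == dual b)%:R.
Proof.
wlog hb : b / 0 < label b => [H|].
  have [h|h|h] := ltrgtP 0 (label b); first exact: H.
    have := H (dual b); rewrite label_dual oppr_gt0 => /(_ h).
    rewrite wt_dual wformNr dualK => /(canRL opprK) ->.
    by rewrite opprB.
  have /eqP : label b == 0 by rewrite -h.
  move/eqP; rewrite label_eq0 => /eqP ->.
  by rewrite wt_mid wformC wform0l dual_mid subrr.
have hn := ltn_label b.
have hi : (b - n.+1 < n)%N by move: hb; rewrite /label; lia.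
have li : (Ordinal hi).+1%:Z = label b by move: hb; rewrite /label /=; lia.
rewrite /wform (bigD1 (Ordinal hi)) //= big1 ?addr0 => [|i ne].
  rewrite !wtE li eqxx !(inj_eq label_inj).
  rewrite -label_dual !(inj_eq label_inj).
  rewrite -(inj_eq label_inj b) label_dual.
  have -> : (label b == - label b) = false by apply/negbTE; lia.
  by rewrite subr0 mulr1.
have ne' : (i : nat) != (b - n.+1)%N by [].
rewrite [wt b 0 i]wtE.
have -> : (label b == i.+1) = false by move: ne' hb; rewrite /label; lia.
have -> : (label b == - i.+1%:Z) = false by move: ne' hb; rewrite /label; lia.
by rewrite subr0 mulr0.
Qed.

(** The height of [x]: [epsilon_(j+1)] is a sum of [n - j] simple roots. *)
Definition ht x : int := \sum_j x 0 j * (n%:Z - j%:Z).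

Lemma htD x y : ht (x + y) = ht x + ht y.
Proof. by rewrite -big_split; apply: eq_bigr => i _; rewrite mxE mulrDl. Qed.

Lemma htN x : ht (- x) = - ht x.
Proof. by rewrite -sumrN; apply: eq_bigr => i _; rewrite mxE mulNr. Qed.

Lemma ht_wt b : ht (wt b) = (pos b)%:Z - n%:Z.
Proof.
wlog hb : b / 0 < label b => [H|].
  have [h|h|h] := ltrgtP 0 (label b); first exact: H.
    have := H (dual b); rewrite label_dual oppr_gt0 => /(_ h).
    rewrite wt_dual htN pos_dual => /(canRL opprK) ->.
    by have := pos_le b; lia.
  have : label b == 0 by rewrite -h.
  rewrite label_eq0 => /eqP ->; rewrite wt_mid pos_mid subrr /ht big1 // => i _.
  by rewrite mxE mul0r.
have hn := ltn_label b.
have hi : (b - n.+1 < n)%N by move: hb; rewrite /label; lia.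
have li : (Ordinal hi).+1%:Z = label b by move: hb; rewrite /label /=; lia.
rewrite /ht (bigD1 (Ordinal hi)) //= big1 ?addr0 => [|i ne].
  rewrite !wtE li eqxx.
  have -> : (label b == - label b) = false by apply/negbTE; lia.
  rewrite subr0 mul1r /pos /pos_nat; move: hb; rewrite /label.
  by split_ifs; lia.
have ne' : (i : nat) != (b - n.+1)%N by [].
rewrite [wt b 0 i]wtE.
have -> : (label b == i.+1) = false by move: ne' hb; rewrite /label; lia.
have -> : (label b == - i.+1%:Z) = false by move: ne' hb; rewrite /label; lia.
by rewrite subr0 mul0r.
Qed.

Lemma wt_inj : injective wt.
Proof.
by move=> a b /(congr1 ht); rewrite !ht_wt => /addIr [] /pos_inj.
Qed.

Lemma wform_ge0 x : 0 <= wform x x.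
Proof. by apply: sumr_ge0 => i _; rewrite -expr2 sqr_ge0. Qed.

(** An integral vector of norm at most 1 is zero or, up to sign, a unit vector. *)
Lemma wform_le1 x : wform x x <= 1 -> exists b, x = wt b.
Proof.
move=> h; have [h0|[i xi]] : (forall i, x 0 i = 0) \/ exists i, x 0 i != 0.
  have [/existsP [i hi]|] := boolP [exists i, x 0 i != 0]; first by right; exists i.
  by rewrite negb_exists => /forallP h0; left=> i; apply/eqP; have := h0 i; rewrite negbK.
  by exists mid; apply/rowP => i; rewrite wt_mid h0 mxE.
have hj j : j != i -> x 0 j = 0.
  move=> ji; apply/eqP; apply: contraTT h => xj; rewrite -ltNge.
  rewrite /wform (bigD1 i) //= (bigD1 j) //=.
  have : 0 <= \sum_(k < n | (k != i) && (k != j)) x 0 k * x 0 k.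
    by apply: sumr_ge0 => k _; rewrite -expr2 sqr_ge0.
  have : 0 < x 0 i * x 0 i by rewrite -expr2 lt_def sqr_ge0 sqrf_eq0 xi.
  have : 0 < x 0 j * x 0 j by rewrite -expr2 lt_def sqr_ge0 sqrf_eq0 xj.
  move: (\sum_(k < n | _) _) (x 0 i * x 0 i) (x 0 j * x 0 j) => S u v.
  by lia.
have xi1 : x 0 i = 1 \/ x 0 i = -1.
  move: h; rewrite /wform (bigD1 i) //= big1 ?addr0 => [|j /hj ->]; last by rewrite mul0r.
  by move: xi; set u := x 0 i; nia.
pose b : V n := inord (n + i.+1).
have hi := ltn_ord i.
have lb : label b = i.+1%:Z by rewrite /label inordK; lia.
have wb : wt b = \row_j (j == i)%:R.
  apply/rowP => j; rewrite wtE mxE lb.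
  have -> : (i.+1%:Z == - j.+1%:Z) = false by lia.
  by rewrite subr0 eqz_nat eqSS eq_sym.
case: xi1 => e; [exists b | exists (dual b)]; apply/rowP => j.
  by rewrite wb mxE; have [->//|/hj] := eqVneq j i.
by rewrite wt_dual wb !mxE; have [->//|/hj ->] := eqVneq j i; rewrite oppr0.
Qed.

(** The pairs between which a root vector of root [z] can have a nonzero entry. Dual labels are left
    out because their weights differ by twice a short root, which is not in [phi]. *)
Definition pair_of z a b := [/\ (pos a < pos b)%N, b != dual a & z = wt b - wt a].

Lemma eps_wt (i : 'I_n) : exists2 b, pos b = (2 * n - i)%N & wt b = eps n i.+1.
Proof.
have hi := ltn_ord i; exists (vx (2 * n - i)); first by rewrite vxK //; lia.
by rewrite /wt label_pos vxK; [split_ifs; try lia; congr (eps _ _); lia|lia].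
Qed.

(** Labels on the same side of [mid] give [epsilon_i - epsilon_j], labels on opposite sides give
    [epsilon_i + epsilon_j], and the label [mid] gives the short roots. *)
Lemma is_rootP z : reflect (exists a b, pair_of z a b) (is_root z).
Proof.
apply: (iffP idP) => [/orP[/existsP[i /eqP ->]|
    /existsP[i /existsP[j /andP[ij /orP[]/eqP->]]]]|[a [b [ab nab ->]]]].
- have [b pb <-] := eps_wt i; exists mid, b; split; last by rewrite wt_mid subr0.
    by rewrite pos_mid pb; have := ltn_ord i; lia.
  by rewrite dual_mid -pos_eq pos_mid pb; have := ltn_ord i; lia.
- have [b pb <-] := eps_wt i; have [a pa <-] := eps_wt j.
  have := ltn_ord i; have := ltn_ord j.
  by exists a, b; split=> //; rewrite -?pos_eq ?pos_dual ?pb ?pa; lia.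
- have [b pb <-] := eps_wt i; have [a pa <-] := eps_wt j.
  have := ltn_ord i; have := ltn_ord j.
  by exists (dual a), b; split=> //; rewrite -?pos_eq ?dualK ?pos_dual ?pb ?pa ?wt_dual ?opprK //; lia.
have epsE c : (n < pos c)%N -> {i : 'I_n | wt c = eps n i.+1 & pos c = (2 * n - i)%N}.
  move=> hc; have lc := pos_le c; have hi : (2 * n - pos c < n)%N by lia.
  exists (Ordinal hi) => /=; last by lia.
  rewrite /wt label_pos; repeat case: ifP => ?; try lia.
  by congr (eps _ _); lia.
have la := pos_le a; have lb := pos_le b.
have [ha|ha|ha] := ltngtP n (pos a).
- have [j ej pj] := epsE _ ha; have [i ei pi] := epsE b (ltn_trans ha ab).
  apply/orP; right; apply/existsP; exists i; apply/existsP; exists j.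
  have := ltn_ord i; have := ltn_ord j.
  by rewrite ei ej eqxx andbT; lia.
- have [hb|hb|hb] := ltngtP n (pos b).
  + have hda : (n < pos (dual a))%N by rewrite pos_dual; lia.
    have [j ej pj] := epsE _ hda; have [i ei pi] := epsE _ hb.
    rewrite -[wt a]opprK -wt_dual ei ej opprK.
    have := ltn_ord i; have := ltn_ord j => lj li.
    have ij : (i : nat) != j.
      by apply: contraNneq nab => e; rewrite -pos_eq pi pj e.
    apply/orP; right; have [lij|lij] : (i < j)%N \/ (j < i)%N by lia.
      by apply/existsP; exists i; apply/existsP; exists j; rewrite lij eqxx orbT.
    by apply/existsP; exists j; apply/existsP; exists i; rewrite lij addrC eqxx orbT.
  + have hda : (n < pos (dual a))%N by rewrite pos_dual; lia.
    have hdb : (n < pos (dual b))%N by rewrite pos_dual; lia.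
    have [j ej pj] := epsE _ hda; have [i ei pi] := epsE _ hdb.
    have -> : wt b - wt a = wt (dual a) - wt (dual b).
      by rewrite !wt_dual opprK addrC.
    rewrite ei ej.
    apply/orP; right; apply/existsP; exists j; apply/existsP; exists i.
    have := ltn_ord i; have := ltn_ord j; rewrite eqxx andbT.
    by move: pi pj; rewrite !pos_dual; lia.
  + have -> : b = mid by apply: pos_inj; rewrite pos_mid.
    have hda : (n < pos (dual a))%N by rewrite pos_dual; lia.
    have [j ej pj] := epsE _ hda.
    rewrite wt_mid sub0r -wt_dual ej; apply/orP; left; apply/existsP.
    by exists j.
- have -> : a = mid by apply: pos_inj; rewrite pos_mid.
  have hb : (n < pos b)%N by lia.
  by have [i ei pi] := epsE _ hb; rewrite wt_mid subr0 ei; apply/orP; left; apply/existsP; exists i.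
Qed.

End Labels.

(** * Normal orderings and root vectors *)

Section Normal.
Variables (n : nat) (s : seq (weight n)).
Hypothesis s_normal : normal_ordering s.
Implicit Types (a b c m : V n) (x y z : weight n).

Definition idx z : nat := index z s.

(** Betweenness without a direction: reversing a normal ordering gives a normal ordering, and the
    arguments below do not distinguish the two. *)
Definition btw (i j k : nat) : bool :=
  ((i < j) && (j < k) || (k < j) && (j < i))%N.

Lemma precE x y : prec s x y = (idx x < idx y)%N.
Proof. by []. Qed.

Lemma mem_normal z : (z \in s) = is_root z.
Proof. by case: s_normal. Qed.

Lemma idx_inj x y : is_root x -> idx x = idx y -> x = y.
Proof.
rewrite -mem_normal /idx => xs e.
have ys : y \in s by rewrite -index_mem -e index_mem.
by rewrite -(nth_index 0 xs) e nth_index.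
Qed.

Lemma pair_norm z a b : pair_of z a b ->
  wform z z = wform (wt a) (wt a) + wform (wt b) (wt b).
Proof.
case=> ab nab ->; rewrite !wformE (wformC (wt b) (wt a)) !(wform_wt a b).
have -> : (a == b) = false by apply/eqP => e; rewrite e ltnn in ab.
rewrite -dual_eq dualK eq_sym (negbTE nab) subrr; lia.
Qed.

Lemma wt_norm a : wform (wt a) (wt a) = (a != mid n)%:R.
Proof.
rewrite wform_wt eqxx -[a in a == _]dualK dual_eq -!pos_eq pos_dual pos_mid.
by have := pos_le a; case: eqP; case: eqP; lia.
Qed.

Lemma root_norm z : is_root z -> wform z z = 1 \/ wform z z = 2.
Proof.
move=> /is_rootP [a [b h]]; rewrite (pair_norm h) !wt_norm.
case: h => ab nab _; have [ea|_] := eqVneq a (mid n); last by case: eqP; lia.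
by case: eqP => [eb|_]; [rewrite ea eb ltnn in ab | left].
Qed.

Lemma root_sum x y : is_root x -> is_root y -> is_root (x + y) ->
  btw (idx x) (idx (x + y)) (idx y).
Proof.
move=> rx ry rxy; case: s_normal => _ _ H.
have [l|l|e] := ltngtP (idx x) (idx y).
- have := H x y; rewrite !mem_normal rx ry rxy /prec -!/(idx _) /btw => /(_ isT isT l isT).
  by case=> -> ->.
- have := H y x; rewrite !mem_normal rx ry [y + x]addrC rxy /prec -!/(idx _) /btw.
  by move=> /(_ isT isT l isT) [-> ->]; rewrite orbT.
(* Equal indices force [x = y], but [x + x] has four times the norm of [x], while roots have norm 1
   or 2. *)
- have exy := idx_inj rx e; rewrite -exy in rxy.
  by have [] := root_norm rxy; have [] := root_norm rx; rewrite !wformE; lia.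
Qed.

(* The root by which the weights of v_a and v_b differ or, when b is dual to a,
   half of that difference: the short root whose square sends v_a to v_b. *)
Definition gam a b : weight n := if b == dual a then wt b else wt b - wt a.

Lemma gamE a b : b != dual a -> gam a b = wt b - wt a.
Proof. by rewrite /gam => /negbTE ->. Qed.

Lemma pair_gam z a b : pair_of z a b -> gam a b = z.
Proof. by case=> _ /gamE -> ->. Qed.

Lemma gam_dual a b : pair_of (gam a b) a b ->
  pair_of (gam a b) (dual b) (dual a).
Proof.
case=> ab nab ->; split; last by rewrite !wt_dual opprK addrC.
  by rewrite !pos_dual; have := pos_le b; lia.
by rewrite dualK eq_sym -dual_eq dualK eq_sym; apply: contraNneq nab => ->; rewrite dualK.
Qed.

Lemma pair_root z a b : pair_of z a b -> is_root z.
Proof. by move=> h; apply/is_rootP; exists a, b. Qed.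

Lemma mid_pair a : (pos (mid n) < pos a)%N -> pair_of (wt a) (mid n) a.
Proof.
move=> h; split; rewrite ?wt_mid ?subr0 // dual_mid.
by apply: contraTneq h => ->; rewrite ltnn.
Qed.

Lemma pair_mid a : (pos a < pos (mid n))%N -> pair_of (- wt a) a (mid n).
Proof.
move=> h; split; rewrite ?wt_mid ?sub0r //.
apply: contraTneq h => /(congr1 (@dual n)); rewrite dualK dual_mid => <-.
by rewrite ltnn.
Qed.

Lemma gam_root a b : (pos a < pos b)%N -> is_root (gam a b).
Proof.
move=> ab; have [e|ne] := eqVneq b (dual a); last first.
  by rewrite gamE //; apply: (@pair_root _ a b).
rewrite /gam e eqxx; apply: pair_root; apply: mid_pair.
by move: ab; rewrite e pos_dual pos_mid; lia.
Qed.

(* With D short, G - D, G, G + D, D are consecutive on a root string, so every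
   normal ordering lists them in this order or in the opposite one. *)
Lemma string_order (D G : weight n) :
  is_root D -> is_root G -> is_root (G - D) -> is_root (G + D) ->
  btw (idx (G - D)) (idx G) (idx D) /\ btw (idx G) (idx (G + D)) (idx D).
Proof.
move=> rD rG rGD rGD'; split; last exact: root_sum.
by have := root_sum rGD rD; rewrite subrK; apply.
Qed.

(** In the excluded case the three roots coincide, see [gam_mid]. If no two of the labels are dual,
    the outer roots add up to the middle one; if two are dual, one root is halved and [string_order]
    replaces additivity. *)
Lemma gam_btw a m b : (pos a < pos m)%N -> (pos m < pos b)%N ->
  ~~ ((m == mid n) && (b == dual a)) ->
  btw (idx (gam a m)) (idx (gam a b)) (idx (gam m b)).
Proof.
move=> am mb; have ab := ltn_trans am mb.
have rab := gam_root ab; have ram := gam_root am; have rmb := gam_root mb.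
have [eb|nb] := eqVneq b (dual a); rewrite ?andbT ?andbF => hm.
  have nm : m != dual a.
    by apply: contraTneq mb => ->; rewrite eb ltnn.
  have nb : b != dual m.
    by apply: contraTneq am => e; rewrite -(dualK m) -e eb dualK ltnn.
  have [pm|pm|pm] := ltngtP (pos m) (pos (mid n)); last first.
  - by move/pos_inj: pm hm => ->; rewrite eqxx.
  - have rm := pair_root (mid_pair pm).
    have hD : gam m b = gam a b - wt m by rewrite gamE // /gam eb eqxx.
    have hG : gam a m = gam a b + wt m.
      by rewrite gamE // /gam eb eqxx wt_dual addrC.
    have := string_order rm rab; rewrite -hD -hG => /(_ rmb ram).
    by rewrite /btw; lia.
  - have rm := pair_root (pair_mid pm).
    have hD : gam a m = gam a b - (- wt m).
      by rewrite gamE // /gam eb eqxx wt_dual opprK addrC.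
    have hG : gam m b = gam a b + - wt m by rewrite gamE // /gam eb eqxx.
    have := string_order rm rab; rewrite -hD -hG => /(_ ram rmb).
    by rewrite /btw; lia.
have [em|nm] := eqVneq m (dual a).
  have nbm : b != dual m by rewrite em dualK; apply: contraTneq ab => ->; rewrite ltnn.
  have pb : (pos (mid n) < pos b)%N.
    by move: am mb; rewrite em pos_dual pos_mid; have := pos_le a; lia.
  have rG := pair_root (mid_pair pb).
  have hD : gam m b = wt b - gam a m by rewrite gamE // /gam em eqxx.
  have hG : gam a b = wt b + gam a m by rewrite gamE // /gam em eqxx wt_dual.
  have := string_order ram rG; rewrite -hD -hG => /(_ rmb rab).
  by rewrite /btw; lia.
have [ebm|nbm] := eqVneq b (dual m).
  have pa : (pos a < pos (mid n))%N.
    by move: am mb; rewrite ebm pos_dual pos_mid; have := pos_le m; lia.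
  have rG := pair_root (pair_mid pa).
  have hD : gam a m = - wt a - gam m b.
    by rewrite gamE // /gam ebm eqxx wt_dual opprK addrC.
  have hG : gam a b = - wt a + gam m b by rewrite gamE // /gam ebm eqxx addrC.
  have := string_order rmb rG; rewrite -hD -hG => /(_ ram rab).
  by rewrite /btw; lia.
have e : gam a b = gam a m + gam m b by rewrite !gamE // [RHS]addrC addrA subrK.
by have := root_sum ram rmb; rewrite -e; apply.
Qed.

Lemma gam_mid a : (pos a < pos (mid n))%N ->
  gam a (mid n) = gam a (dual a) /\ gam (mid n) (dual a) = gam a (dual a).
Proof.
move=> h; have e : gam a (dual a) = - wt a by rewrite /gam eqxx wt_dual.
rewrite e (pair_gam (pair_mid h)) gamE ?wt_dual ?wt_mid ?subr0 //.
by rewrite dual_eq; apply: contraTneq h => ->; rewrite ltnn.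
Qed.

(** The form of [minimal_pair] symmetric in [x] and [y]: a route from [v_a] to [v_b] may begin with
    either root. *)
Definition minimal x y : Prop := forall x' y', x' \in s -> y' \in s ->
  x' + y' = x + y ->
  ~ [/\ (minn (idx x) (idx y) < idx x')%N, (idx x' < maxn (idx x) (idx y))%N,
       (minn (idx x) (idx y) < idx y')%N & (idx y' < maxn (idx x) (idx y))%N].

Lemma minimalC x y : minimal x y -> minimal y x.
Proof.
by move=> h x' y' xs ys; rewrite [y + x]addrC minnC maxnC => e; apply: h.
Qed.

Lemma minimal_pair_minimal x y : minimal_pair s x y -> minimal x y.
Proof.
case=> xs ys xy h x' y' xs' ys' e [h1 h2 h3 h4].
have := h x' y' xs' ys' e; rewrite /prec -!/(idx _).
by move: xy; rewrite /prec -!/(idx _); lia.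
Qed.

Section Split.
Variables a m b : V n.
Hypothesis am : pair_of (gam a m) a m.
Hypothesis mb : pair_of (gam m b) m b.
Hypothesis ab : pair_of (gam a b) a b.
Hypothesis min_amb : minimal (gam a m) (gam m b).

Let A := idx (gam a m).
Let B := idx (gam m b).

Lemma gam_add : gam a m + gam m b = gam a b.
Proof.
by case: am mb ab => _ _ -> [_ _ ->] [_ _ ->]; rewrite addrC addrA subrK.
Qed.

(** If [c] is dual to [a] or to [b], the roots [gam a c] and [gam c b] do not add up to [gam a b].
    One of them is then replaced by a short root which [string_order] places between the two, and
    minimality applies to the new pair. *)
Lemma not_inside c : (pos a < pos c)%N -> (pos c < pos b)%N -> c != mid n ->
  ~ [/\ (minn A B < idx (gam a c))%N, (idx (gam a c) < maxn A B)%N,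
       (minn A B < idx (gam c b))%N & (idx (gam c b) < maxn A B)%N].
Proof.
move=> ac cb nc [h1 h2 h3 h4].
have rac := gam_root ac; have rcb := gam_root cb; have rab := pair_root ab.
have key x y : is_root x -> is_root y -> x + y = gam a b ->
    (minn A B < idx x < maxn A B)%N -> (minn A B < idx y < maxn A B)%N -> False.
  move=> rx ry e /andP [? ?] /andP [? ?].
  have := min_amb; rewrite /minimal gam_add -/A -/B => /(_ x y).
  by rewrite !mem_normal => /(_ rx ry e); apply.
case: ab => pab nab eab.
have [ec|nac] := eqVneq c (dual a).
  have pb : (pos (mid n) < pos b)%N.
    by move: ac cb; rewrite ec pos_dual pos_mid; have := pos_le a; lia.
  have nbc : b != dual c by rewrite ec dualK; apply: contraTneq pab => ->; rewrite ltnn.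
  have rG := pair_root (mid_pair pb).
  have hD : gam c b = wt b - gam a c by rewrite gamE // /gam ec eqxx.
  have hG : gam a b = wt b + gam a c by rewrite eab /gam ec eqxx wt_dual.
  have := string_order rac rG; rewrite -hD -hG => /(_ rcb rab); rewrite /btw => h.
  by apply: (key (wt b) (gam a c)) => //; lia.
have [ebc|nbc] := eqVneq b (dual c).
  have pa : (pos a < pos (mid n))%N.
    by move: ac cb; rewrite ebc pos_dual pos_mid; have := pos_le c; lia.
  have rG := pair_root (pair_mid pa).
  have hD : gam a c = - wt a - gam c b.
    by rewrite gamE // /gam ebc eqxx wt_dual opprK addrC.
  have hG : gam a b = - wt a + gam c b by rewrite eab /gam ebc eqxx addrC.
  have := string_order rcb rG; rewrite -hD -hG => /(_ rac rab); rewrite /btw => h.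
  by apply: (key (- wt a) (gam c b)) => //; lia.
apply: (key (gam a c) (gam c b)) => //; try lia.
by rewrite eab !gamE // addrC addrA subrK.
Qed.

(** Any order of the roots that violates the equality puts both [gam a c] and [gam c b] strictly
    between [gam a m] and [gam m b], against [not_inside]. With [split_left] this lets the set of
    labels [c] counted for [gam a b] be read off from its two halves. *)
Lemma split_right c : (pos m < pos c)%N -> (pos c < pos b)%N -> c != mid n ->
  (idx (gam m c) < idx (gam m b))%N = (idx (gam a c) < idx (gam a b))%N.
Proof.
case: (am) (mb) (ab) => pam nam _ [pmb nmb _] [pab nab _] mc cb nc.
have ac := ltn_trans pam mc.
have h1 : btw A (idx (gam a b)) B.
  by apply: gam_btw => //; rewrite (negbTE nab) andbF.
have h2 : btw (idx (gam m c)) B (idx (gam c b)).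
  by apply: gam_btw => //; rewrite (negbTE nmb) andbF.
have h3 : btw (idx (gam a c)) (idx (gam a b)) (idx (gam c b)).
  by apply: gam_btw => //; rewrite (negbTE nab) andbF.
have h4 : btw A (idx (gam a c)) (idx (gam m c)) \/
    (A = idx (gam a c) /\ A = idx (gam m c)).
  have [/andP [/eqP em /eqP ec]|h] := boolP ((m == mid n) && (c == dual a)).
    right; rewrite /A em ec.
    by have [-> ->] : gam a (mid n) = gam a (dual a) /\
      gam (mid n) (dual a) = gam a (dual a) by apply: gam_mid; rewrite -em.
  by left; apply: gam_btw.
have h5 := @not_inside c ac cb nc.
rewrite -/A -/B; move: h1 h2 h3 h4; rewrite /btw => h1 h2 h3 h4.
by apply/idP/idP => h; apply: contra_notT h5 => h'; split; lia.
Qed.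

Lemma split_left c : (pos a < pos c)%N -> (pos c < pos m)%N -> c != mid n ->
  (idx (gam a c) < idx (gam a m))%N = (idx (gam a c) < idx (gam a b))%N.
Proof.
case: (am) (mb) (ab) => pam nam _ [pmb nmb _] [pab nab _] ac cm nc.
have cb := ltn_trans cm pmb.
have h1 : btw A (idx (gam a b)) B.
  by apply: gam_btw => //; rewrite (negbTE nab) andbF.
have h2 : btw (idx (gam a c)) A (idx (gam c m)).
  by apply: gam_btw => //; rewrite (negbTE nam) andbF.
have h3 : btw (idx (gam a c)) (idx (gam a b)) (idx (gam c b)).
  by apply: gam_btw => //; rewrite (negbTE nab) andbF.
have h4 : btw (idx (gam c m)) (idx (gam c b)) B \/
    (B = idx (gam c b) /\ B = idx (gam c m)).
  have [/andP [/eqP em /eqP ec]|h] := boolP ((m == mid n) && (b == dual c)).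
    right; rewrite /B em ec.
    by have [-> ->] : gam c (mid n) = gam c (dual c) /\
      gam (mid n) (dual c) = gam c (dual c) by apply: gam_mid; rewrite -em.
  by left; apply: gam_btw.
have h5 := @not_inside c ac cb nc.
rewrite -/A; move: h1 h2 h3 h4; rewrite /btw => h1 h2 h3 h4.
by apply/idP/idP => h; apply: contra_notT h5 => h'; split; lia.
Qed.

End Split.

End Normal.

(** * Weights and matrix entries of the generators on [V] *)

Section VAction.
Variables (F : fieldType) (n : nat) (q : F).
Implicit Types (a b c m : V n) (x y z : weight n).

Lemma ent_vunit k l (y x : V n) :
  ent (vunit F n k l) y x = ((label y == k) && (label x == l))%:R.
Proof. exact: ent_mkop. Qed.

Lemma label_eqE b (k : int) : (`|k| <= n)%N ->
  (label b == k) = (pos b == if 0 < k then ((2 * n).+1 - `|k|)%N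
                              else if k == 0 then n else `|k|.-1).
Proof. by move=> hk; have := pos_le b; rewrite label_pos => h; split_ifs; lia. Qed.

(** The raising generator of index [i] moves this position up by one, and its mirror image
    [2 n - lowpos i - 1] as well. For the odd generator it is [n], the position of [v_0]. *)
Definition lowpos (i : 'I_n) : nat := (2 * n - i.+1)%N.

Lemma lowposE (i : 'I_n) : (n <= lowpos i < 2 * n)%N.
Proof. by rewrite /lowpos; have := ltn_ord i; lia. Qed.

(** The sign in [e_n v_(-n) = - v_0]. *)
Definition esign (i : 'I_n) : F := if (i.+1 < n)%N then 1 else -1.

Lemma ent_VE i (y x : V n) : ent (V_action q (GE, i)) y x =
  ((pos x == lowpos i) && (pos y == (lowpos i).+1))%:R +
  esign i * ((pos x == (2 * n - (lowpos i).+1)%N)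
             && (pos y == (2 * n - lowpos i)%N))%:R.
Proof.
have hi := ltn_ord i; rewrite /V_action /esign; case: ifP => hin;
  rewrite ?entD ?entN !ent_vunit !label_eqE /lowpos; try lia;
  rewrite ?mul1r ?mulN1r; congr (_%:R + _); try congr (- _);
  try congr (_%:R); split_ifs; lia.
Qed.

Lemma ent_VF i (y x : V n) : ent (V_action q (GF, i)) y x =
  ((pos x == (lowpos i).+1) && (pos y == lowpos i))%:R +
  ((pos x == (2 * n - lowpos i)%N)
             && (pos y == (2 * n - (lowpos i).+1)%N))%:R.
Proof.
have hi := ltn_ord i; rewrite /V_action; case: ifP => hin;
  rewrite ?entD ?entN !ent_vunit !label_eqE /lowpos; try lia;
  congr (_%:R + _%:R); split_ifs; lia.
Qed.

Lemma alphaE (i : 'I_n) :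
  alpha i = wt (vx n (lowpos i).+1) - wt (vx n (lowpos i)).
Proof.
have hi := ltn_ord i; have hl := lowposE i; rewrite /alpha /wt.
have -> : label (vx n (lowpos i).+1) = i.+1%:Z.
  by apply/eqP; rewrite label_eqE ?vxK /lowpos; split_ifs; lia.
case: ifP => hin.
  have -> : label (vx n (lowpos i)) = i.+2%:Z; last by [].
  by apply/eqP; rewrite label_eqE ?vxK /lowpos; split_ifs; lia.
have -> : vx n (lowpos i) = mid n by congr (vx n _); rewrite /lowpos; lia.
by rewrite -/(wt _) wt_mid subr0.
Qed.

Definition wt_hom (x : weight n) (A : op F (V n)) : Prop :=
  forall b a, wt b != wt a + x -> ent A b a = 0.

Lemma dual_vx p : (p <= 2 * n)%N -> dual (vx n p) = vx n (2 * n - p).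
Proof. by move=> h; apply: pos_inj; rewrite pos_dual !vxK //; lia. Qed.

Lemma vx_dual p : (p <= 2 * n)%N -> wt (vx n (2 * n - p)) = - wt (vx n p).
Proof. by move=> h; rewrite -dual_vx // wt_dual. Qed.

Lemma hom_VE i : wt_hom (alpha i) (V_action q (GE, i)).
Proof.
move=> b a; rewrite ent_VE alphaE; have hl := lowposE i.
rewrite -{1}[b]posK -{1}[a]posK => h.
have [/andP [/eqP ea /eqP eb]|_] := boolP (_ && _).
  by move: h; rewrite ea eb addrC subrK eqxx.
have [/andP [/eqP ea /eqP eb]|_] := boolP (_ && _); last by rewrite mulr0 addr0.
have h1 : (lowpos i <= 2 * n)%N by lia.
have h2 : ((lowpos i).+1 <= 2 * n)%N by lia.
move: h; rewrite ea eb (vx_dual h1) (vx_dual h2).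
by rewrite addrA addNr add0r eqxx.
Qed.

Lemma hom_VF i : wt_hom (- alpha i) (V_action q (GF, i)).
Proof.
move=> b a; rewrite ent_VF alphaE; have hl := lowposE i.
rewrite -{1}[b]posK -{1}[a]posK => h.
have [/andP [/eqP ea /eqP eb]|_] := boolP (_ && _).
  by move: h; rewrite ea eb opprB addrC subrK eqxx.
have [/andP [/eqP ea /eqP eb]|_] := boolP (_ && _); last by rewrite addr0.
have h1 : (lowpos i <= 2 * n)%N by lia.
have h2 : ((lowpos i).+1 <= 2 * n)%N by lia.
move: h; rewrite ea eb (vx_dual h1) (vx_dual h2).
by rewrite opprB addrA addNr add0r eqxx.
Qed.

Lemma homM x y A B : wt_hom x A -> wt_hom y B -> wt_hom (x + y) (A * B).
Proof.
move=> hA hB b a ne; rewrite entM big1 // => m _.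
have [em|/hB ->] := eqVneq (wt m) (wt a + y); last by rewrite mulr0.
by rewrite hA ?mul0r // em -addrA [y + x]addrC.
Qed.

Lemma homMr x y A B : wt_hom x A -> wt_hom y B -> wt_hom (y + x) (A * B).
Proof. by rewrite addrC; apply: homM. Qed.

Lemma homB x A B : wt_hom x A -> wt_hom x B -> wt_hom x (A - B).
Proof. by move=> hA hB b a h; rewrite entD entN hA // hB // subr0. Qed.

Lemma homZ x (k : F) A : wt_hom x A -> wt_hom x (k *: A).
Proof. by move=> hA b a h; rewrite entZ hA // mulr0. Qed.

Lemma ent_homM y A B b a m : wt_hom y B -> wt m = wt a + y ->
  ent (A * B) b a = ent A b m * ent B m a.
Proof.
move=> hB em; rewrite entM (bigD1 m) //= big1 ?addr0 // => c nc.
rewrite [ent B _ _]hB ?mulr0 // -em; apply: contra nc => /eqP e.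
by apply/eqP/wt_inj.
Qed.

Lemma ent_homM0 y A B b a : wt_hom y B -> (forall m, wt m != wt a + y) ->
  ent (A * B) b a = 0.
Proof.
by move=> hB h; rewrite entM big1 // => m _; rewrite [ent B _ _]hB ?mulr0.
Qed.

Lemma prod_between (f : V n -> F) a m b : (pos a < pos m)%N -> (pos m < pos b)%N ->
  \prod_(c : V n | (pos a < pos c < pos b)%N) f c =
  \prod_(c : V n | (pos a < pos c < pos m)%N) f c * f m *
  \prod_(c : V n | (pos m < pos c < pos b)%N) f c.
Proof.
move=> am mb; rewrite (bigD1 m) /=; last by rewrite am mb.
rewrite (bigID (fun c => pos c < pos m)%N) /= mulrA [f m * _]mulrC.
congr (_ * _ * _); apply: eq_bigl => c; rewrite -pos_eq; lia.
Qed.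

Lemma htB_root z a b : pair_of z a b -> ht z = (pos b)%:Z - (pos a)%:Z.
Proof. by case=> _ _ ->; rewrite htD htN !ht_wt; lia. Qed.

Lemma ht_gt0 z : is_root z -> 0 < ht z.
Proof.
by move=> /is_rootP [a [b h]]; rewrite (htB_root h); case: h => ab _ _; lia.
Qed.

(** An integer and its square have the same parity, coordinate by coordinate; consequently the odd
    roots are the short ones. *)
Lemma wpar_norm x : exists k : int, wform x x = (\sum_j x 0 j) + 2 * k.
Proof.
rewrite /wform; elim/big_rec2: _ => [|j u v _ [k ->]]; first by exists 0; lia.
have [m hm] : exists m : int, x 0 j = 2 * m \/ x 0 j = 2 * m + 1.
  by exists (x 0%R j %/ 2)%Z; lia.
by case: hm => ->; [exists (k - m + 2 * m * m) | exists (k + m + 2 * m * m)]; ring.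
Qed.

Lemma wpar_root z : is_root z -> wpar z = (wform z z == 1).
Proof.
by move=> /root_norm; have [k] := wpar_norm z; rewrite /wpar; lia.
Qed.

Lemma pair_of_root z a b : is_root z -> wt b = wt a + z -> pair_of z a b.
Proof.
move=> rz e; have ez : z = wt b - wt a by rewrite e addrC addKr.
split=> //; first by have := ht_gt0 rz; rewrite ez htD htN !ht_wt; lia.
apply/eqP => eb; move: (root_norm rz); rewrite ez eb wt_dual; rewrite !wformE wt_norm.
by case: (a != _); lia.
Qed.

Lemma sum_delta (f g : V n -> F) (P : pred (V n)) b :
  (forall c, P c = (c == b)) -> \sum_c f c * ((P c)%:R * g c) = f b * g b.
Proof.
move=> h; rewrite (bigD1 b) //= h eqxx mul1r big1 ?addr0 // => c nc.
by rewrite h (negbTE nc) mul0r mulr0.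
Qed.

Lemma sum_delta0 (f g : V n -> F) (P : pred (V n)) :
  (forall c, P c = false) -> \sum_c f c * ((P c)%:R * g c) = 0.
Proof. by move=> h; rewrite big1 // => c _; rewrite h mul0r mulr0. Qed.

Lemma sum_delta1 (f : V n -> F) b : \sum_c f c * (c == b)%:R = f b.
Proof.
rewrite (bigD1 b) //= eqxx mulr1 big1 ?addr0 // => c nc.
by rewrite (negbTE nc) mulr0.
Qed.

End VAction.

(** * Entries of a root vector at a pair and at the dual pair *)

Section Ratio.
Variables (F : fieldType) (n : nat) (q : F) (s : seq (weight n)).
Hypothesis q_neq0 : q != 0.
Hypothesis s_normal : normal_ordering s.
Implicit Types (a b c m : V n) (x y z : weight n).

Local Notation idx := (idx s).

(** Here [k] counts the roots already passed: the label [c] contributes [- q] until the root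
    [gam a c] is passed and [- q^-1] afterwards. *)
Definition theta (k : nat) a c : F :=
  if c == mid n then 1 else if (idx (gam a c) < k)%N then - q^-1 else - q.

Definition PI k a b : F :=
  \prod_(c : V n | (pos a < pos c < pos b)%N) theta k a c.

(** Sign correction for [v_0], the only even basis vector. *)
Definition eta a b : F := if (a == mid n) || (b == mid n) then -1 else 1.

(* The ratio of the coefficients of a root vector from v_a to v_b and from
   v_(b dual) to v_(a dual). *)
Definition rho a b : F := eta a b * PI (idx (gam a b)) a b.

Lemma PI_adj k a b : (pos b <= (pos a).+1)%N -> PI k a b = 1.
Proof. by move=> h; rewrite /PI big_pred0 // => c; lia. Qed.

(** The product over the labels between [a] and [b] is cut at [m], and [split_left] and
    [split_right] turn comparisons with [gam a b] into comparisons with the two halves. The factor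
    left over at [m] will match the coefficient in the bracket that defines the root vector. *)
Lemma rho_split a m b :
  pair_of (gam a m) a m -> pair_of (gam m b) m b -> pair_of (gam a b) a b ->
  minimal s (gam a m) (gam m b) ->
  rho a b = rho a m * theta (idx (gam a b)) a m * rho m b.
Proof.
move=> pam pmb pab hmin; case: (pam) (pmb) (pab) => am nam _ [mb nmb _] [ab nab _].
rewrite /rho {1}/PI (prod_between _ am mb).
have -> : \prod_(c : V n | (pos a < pos c < pos m)%N) theta (idx (gam a b)) a c
   = PI (idx (gam a m)) a m.
  apply: eq_bigr => c /andP [ac cm]; rewrite /theta; case: eqVneq => // nc.
  by rewrite (split_left s_normal pam pmb pab).
have -> : \prod_(c : V n | (pos m < pos c < pos b)%N) theta (idx (gam a b)) a c
   = PI (idx (gam m b)) m b.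
  apply: eq_bigr => c /andP [mc cb]; rewrite /theta; case: eqVneq => // nc.
  by rewrite (split_right s_normal pam pmb pab).
have -> : eta a b = eta a m * eta m b.
  rewrite /eta; have [em|nm] := eqVneq m (mid n).
    rewrite orbT /=; case: eqP => [ea|_]; first by rewrite ea em ltnn in am.
    by case: eqP => [eb|_]; [rewrite eb em ltnn in mb | rewrite mulrNN mul1r].
  rewrite orbF /=; case: eqP => [ea|_] /=; case: eqP => [eb|_];
    rewrite ?mulr1 ?mul1r //.
  by rewrite ea eb ltnn in ab.
ring.
Qed.

Section RootVectors.
Variables (E Fv : weight n -> Uq n q).
Hypothesis EF_root : root_vectors s E Fv.
Variable pi : {linear Uq n q -> op F (V n)}.
Hypothesis pi_V : affords_V pi.

Lemma piM u v : pi (u * v) = pi u * pi v.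
Proof. by case: pi_V => -[_ h] _; apply: h. Qed.

Lemma piB (u v : Uq n q) : pi (u - v) = pi u - pi v.
Proof. exact: raddfB. Qed.

Lemma piZ (k : F) (u : Uq n q) : pi (k *: u) = k *: pi u.
Proof. exact: linearZZ. Qed.

Lemma pi_bracketE (u v : Uq n q) (k : F) :
  pi (u * v - k *: (v * u)) = pi u * pi v - k *: (pi v * pi u).
Proof.
have h1 := piB (u * v) (k *: (v * u)); have h2 := piZ k (v * u).
have h3 := piM u v; have h4 := piM v u.
exact: (etrans h1 (congr2 (fun A A' => A - A') h3 (etrans h2 (congr1 ( *:%R k) h4)))).
Qed.

Lemma pi_bracket (u v w : Uq n q) (k : F) : w = u * v - k *: (v * u) ->
  pi w = pi u * pi v - k *: (pi v * pi u).
Proof. by move=> ->; apply: pi_bracketE. Qed.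

(* The squared norms of wt a + x and wt a + y add up to |x|^2 + |y|^2 and have
   known parities, so exactly one of them is at most 1. *)
Lemma unique_route x y a b : is_root x -> is_root y ->
  pair_of (x + y) a b -> is_root (x + y) ->
  (exists2 m, wt m = wt a + y & forall m, wt m != wt a + x) \/
  (exists2 m, wt m = wt a + x & forall m, wt m != wt a + y).
Proof.
move=> rx ry pab rxy; have nz := pair_norm pab.
have na := wt_norm a; have nb := wt_norm b.
have eb : wform (wt b) (wt b) = wform (wt a + (x + y)) (wt a + (x + y)).
  by case: pab => _ _ ->; rewrite addrC subrK.
have w0x := wform_ge0 (wt a + x); have w0y := wform_ge0 (wt a + y).
have w1 x' m : wt m = x' -> wform x' x' <= 1.
  by move=> <-; rewrite wt_norm; case: (_ != _).
have H : (wform (wt a + y) (wt a + y) <= 1) && (1 < wform (wt a + x) (wt a + x))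
      || (wform (wt a + x) (wt a + x) <= 1) && (1 < wform (wt a + y) (wt a + y)).
  move: nz eb w0x w0y na nb (root_norm rx) (root_norm ry) (root_norm rxy).
  rewrite !wformE (wformC y x) (wformC x (wt a)) (wformC y (wt a)).
  case: (a != mid n); case: (b != mid n) => /=; lia.
case/orP: H => /andP [h1 h2]; [left|right];
  have [m em] := wform_le1 h1; exists m => // m'; apply/eqP => e;
  by have := w1 _ _ e; lia.
Qed.

(** The norms of the three pairs determine [(x, y)]: it is 0, with both roots odd, when the route
    passes through [v_0], and -1, with not both roots odd, otherwise. *)
Lemma route_factor x y a m b : is_root x -> is_root y -> is_root (x + y) ->
  pair_of x a m -> pair_of y m b -> pair_of (x + y) a b ->
  (-1) ^+ (wpar x && wpar y) * qwt q x y = if m == mid n then -1 else q^-1.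
Proof.
move=> rx ry rz pa pb pz; rewrite /qwt !wpar_root //.
have := root_norm rx; have := root_norm ry; have := root_norm rz.
move: (pair_norm pa) (pair_norm pb) (pair_norm pz).
rewrite [wform (x + y) _]wformDl !wformDr (wformC y x) !wt_norm.
case: (m == mid n) => /= => h1 h2 h3 h4 h5 h6.
  have [-> -> ->] : [/\ wform x x = 1, wform y y = 1 & wform x y = 0].
    by move: h1 h2 h3 h4 h5 h6; case: (a != _); case: (b != _) => /=; split; lia.
  by rewrite eqxx expr0z expr1 mulr1.
have [-> ->] : wform x y = -1 /\ (wform x x == 1) && (wform y y == 1) = false.
  by move: h1 h2 h3 h4 h5 h6; case: (a != _); case: (b != _) => /=; split; lia.
by rewrite expr0 mul1r.
Qed.

(** Arithmetic of the base case: for a simple root no label lies strictly between [a] and [b], so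
    [rho] reduces to [eta] and must match the sign [esign]. *)
Lemma simple_root_sign (N l p : nat) (c : F) : (N <= l < 2 * N)%N ->
  c = (if (N < l)%N then 1 else -1) ->
  (p == l)%:R + c * (p == 2 * N - l.+1)%N%:R =
  (if (p == N) || (p.+1 == N) then -1 else 1)
    * ((p == 2 * N - l.+1)%N%:R + c * (p == l)%:R).
Proof.
move=> hl ->; case: ifP => hNl.
  have [e|ne] := eqVneq p l; have [e'|ne'] := eqVneq p (2 * N - l.+1)%N;
    case: ifP => h /=; try ring; exfalso; lia.
have el : l = N by lia.
have e2 : (p.+1 == N) = (p == 2 * N - N.+1)%N by lia.
rewrite el e2; case: eqVneq => [e|ne]; case: eqVneq => [e'|ne'] /=; try ring.
all: exfalso; lia.
Qed.

(** Induction on the height. For [z = x + y] only one order of [x] and [y] leads from [v_a] to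
    [v_b], and the opposite order leads from the dual of [b] to the dual of [a]. So one of the two
    entries is a plain product and the other carries minus the bracket coefficient. *)
Lemma root_coef z : is_root z ->
  [/\ wt_hom z (pi (E z)), wt_hom (- z) (pi (Fv z))
    & forall a b, pair_of z a b ->
        ent (pi (E z)) b a = rho a b * ent (pi (E z)) (dual a) (dual b)].
Proof.
have [k] := ubnP `|ht z|%N; elim: k z => // k IH z hk rz.
have [hs hr] := EF_root.
have [/existsP [i /eqP ez]|] := boolP [exists i : 'I_n, z == alpha i].
  rewrite ez; have [-> ->] := hs i; case: pi_V => _ hV; rewrite !hV.
  split; [exact: hom_VE | exact: hom_VF | move=> a b pab].
  case: (pab) => ab nab eab; have hl := lowposE i.
  have := htB_root pab; rewrite alphaE htD htN !ht_wt !vxK; try lia.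
  move=> hab; have pb : pos b = (pos a).+1 by lia.
  rewrite !ent_VE /rho PI_adj ?pb // mulr1 !pos_dual pb /eta -!pos_eq pb pos_mid.
  have la := pos_le a; have lb := pos_le b; rewrite pb in lb.
  have e1 : ((2 * n - (pos a).+1)%N == lowpos i) = (pos a == (2 * n - (lowpos i).+1)%N).
    by clear - hl la lb; lia.
  have e2 : ((2 * n - pos a)%N == (lowpos i).+1) = (pos a == (2 * n - (lowpos i).+1)%N).
    by clear - hl la lb; lia.
  have e3 : ((2 * n - (pos a).+1)%N == (2 * n - (lowpos i).+1)%N) = (pos a == lowpos i).
    by clear - hl la lb; lia.
  have e4 : ((2 * n - pos a)%N == (2 * n - lowpos i)%N) = (pos a == lowpos i).
    by clear - hl la lb; lia.
  have e5 : ((pos a).+1 == (2 * n - lowpos i)%N) = (pos a == (2 * n - (lowpos i).+1)%N).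
    by clear - hl la lb; lia.
  rewrite e1 e2 e3 e4 e5 eqSS !andbb; apply: simple_root_sign => //.
  rewrite /esign /lowpos; have hi := ltn_ord i; clear -hi.
  by case: ifP; case: ifP => //; lia.
rewrite negb_exists => /forallP nalpha.
have [x [y [hmin ez ee ef]]] := hr z rz nalpha.
have [xs ys xy _] := hmin; have mxy := minimal_pair_minimal hmin.
rewrite !(mem_normal s_normal) in xs ys.
have hz : ht z = ht x + ht y by rewrite ez htD.
have hx := ht_gt0 xs; have hy := ht_gt0 ys.
have [hEx hFx rx] : [/\ wt_hom x (pi (E x)), wt_hom (- x) (pi (Fv x))
    & forall a b, pair_of x a b ->
        ent (pi (E x)) b a = rho a b * ent (pi (E x)) (dual a) (dual b)].
  by apply: IH => //; lia.
have [hEy hFy ry] : [/\ wt_hom y (pi (E y)), wt_hom (- y) (pi (Fv y))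
    & forall a b, pair_of y a b ->
        ent (pi (E y)) b a = rho a b * ent (pi (E y)) (dual a) (dual b)].
  by apply: IH => //; lia.
rewrite (pi_bracket ee) (pi_bracket ef).
split.
- by rewrite ez; apply: homB; [apply: homM | apply/homZ/homMr].
- by rewrite ez opprD; apply: homB; [apply: homMr | apply/homZ/homM].
move=> a b pab; rewrite !entD !entN !entZ; set sg := (_ * qwt q x y).
rewrite ez in rz pab.
have eb : wt b = wt a + (x + y) by case: pab => _ _ ->; rewrite addrC subrK.
have [[m em nm]|[m em nm]] := unique_route xs ys pab rz.
- have pam := pair_of_root ys em.
  have pmb : pair_of x m b.
    by apply: pair_of_root; rewrite // em eb -addrA [y + x]addrC.
  have dm : wt (dual m) = wt (dual b) + x.
    by rewrite !wt_dual em eb (addrC x) addrA [in RHS]opprD subrK.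
  have nm' m' : wt m' != wt (dual b) + y.
    apply/eqP => e; have := nm (dual m'); rewrite wt_dual e wt_dual eb.
    by case/eqP; rewrite opprD opprK addrA addrK.
  rewrite (ent_homM _ _ hEy em) (ent_homM0 _ _ hEx nm) (ent_homM0 _ _ hEy nm').
  rewrite (ent_homM _ _ hEx dm) mulr0 subr0 sub0r (rx _ _ pmb) (ry _ _ pam).
  have gx := pair_gam pmb; have gy := pair_gam pam; have gz := pair_gam pab.
  have -> : rho a b = rho a m * theta (idx (x + y)) a m * rho m b.
    rewrite -gz; apply: rho_split; rewrite ?gx ?gy ?gz //; exact: minimalC.
  have : - sg * theta (idx (x + y)) a m = 1.
    have -> : sg = (-1) ^+ (wpar y && wpar x) * qwt q y x.
      by rewrite /sg andbC /qwt wformC.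
    rewrite (@route_factor y x a m b) // 1?[y + x]addrC // /theta gy.
    case: ifP => _; first by rewrite opprK mulr1.
    have -> : (idx y < idx (x + y)%R)%N = false.
      have := root_sum s_normal xs ys rz.
      by move: xy; rewrite precE /btw; lia.
    by rewrite mulrNN mulVf.
  move=> h; transitivity (- sg * theta (idx (x + y)) a m *
    (rho m b * ent (pi (E x)) (dual m) (dual b) *
      (rho a m * ent (pi (E y)) (dual a) (dual m)))); last by ring.
  by rewrite h mul1r.
- have pam := pair_of_root xs em.
  have pmb : pair_of y m b by apply: pair_of_root; rewrite // em eb addrA.
  have dm : wt (dual m) = wt (dual b) + y.
    by rewrite !wt_dual em eb addrA [in RHS]opprD subrK.
  have nm' m' : wt m' != wt (dual b) + x.
    apply/eqP => e; have := nm (dual m'); rewrite wt_dual e wt_dual eb.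
    by case/eqP; rewrite opprD opprK (addrC x) addrA addrK.
  rewrite (ent_homM _ _ hEx em) (ent_homM0 _ _ hEy nm) (ent_homM0 _ _ hEx nm').
  rewrite (ent_homM _ _ hEy dm) mulr0 subr0 sub0r (ry _ _ pmb) (rx _ _ pam).
  have gy := pair_gam pmb; have gx := pair_gam pam; have gz := pair_gam pab.
  have -> : rho a b = rho a m * theta (idx (x + y)) a m * rho m b.
    by rewrite -gz; apply: rho_split; rewrite ?gx ?gy ?gz.
  (* The route begins with [x], which comes before [x + y], so [theta] is [- q^-1]; through [mid]
     both sides are 1. *)
  have -> : theta (idx (x + y)) a m = - sg.
    rewrite /sg (@route_factor x y a m b) // /theta gx.
    case: ifP => _; first by rewrite opprK.
    have -> // : (idx x < idx (x + y)%R)%N.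
      have := root_sum s_normal xs ys rz.
      by move: xy; rewrite precE /btw; lia.
  by ring.
Qed.

End RootVectors.
End Ratio.

(** * Products of root factors *)

Section ZeroWeight.
Variables (F : fieldType) (n : nat) (q : F) (s : seq (weight n)).
Hypothesis q_neq0 : q != 0.
Hypothesis s_normal : normal_ordering s.
Implicit Types (a b c m : V n) (x y w : weight n).

Local Notation idx := (idx s).
Local Notation PI := (PI q s).
Local Notation theta := (theta q s).
Local Notation rho := (rho q s).
Local Notation eta := (@eta F n).
Local Notation z := (q - q^-1).
Local Notation mid := (mid n).

(** The contribution of the path from [v_a] through [v_0] to [v_c]. It appears when the short root
    [gam a (dual a)] is passed before [gam a (dual c)] and is cancelled when the latter is passed,
    so it exists only at intermediate stages. *)
Definition extra k c a : F :=
  if [&& (pos a < pos (dual c))%N, (pos (dual c) < pos mid)%N,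
         (k <= idx (gam a (dual c)))%N, (idx (gam a (dual a)) < k)%N
       & (idx (gam (dual c) c) < k)%N]
  then - (z ^+ 2 * q * PI k a (dual c)) else 0.

(* The coefficient of v_c (x) v_(c dual) in the image of v_a (x) v_(a dual) under
   the product of the first k root factors; ZZ is that of a single factor. *)
Definition MM k c a : F :=
  if c == a then 1 else
  if ((pos a < pos c) && (idx (gam a c) < k))%N then
    z * (eta a c * PI k a c) + (c == dual a)%:R * (z * q) + extra k c a
  else 0.

Definition ZZ w b a : F :=
  (b == a)%:R + (wt b == wt a + w)%:R * (z * rho a b)
  + ((b == dual a) && (wt b == w))%:R * (z * (q + 1)).

Lemma MM_diag k a : MM k a a = 1.
Proof. by rewrite /MM eqxx. Qed.

Lemma MM_low k c a : c != a -> ~~ ((pos a < pos c) && (idx (gam a c) < k))%N ->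
  MM k c a = 0.
Proof. by rewrite /MM => /negbTE -> /negbTE ->. Qed.

Lemma MM_high k c a : (pos a < pos c)%N -> (idx (gam a c) < k)%N ->
  MM k c a = z * (eta a c * PI k a c) + (c == dual a)%:R * (z * q) + extra k c a.
Proof.
move=> h h'; rewrite /MM h h' /=; case: eqVneq => // e.
by rewrite e ltnn in h.
Qed.

Lemma theta_next k a m : idx (gam a m) <> k -> theta k.+1 a m = theta k a m.
Proof.
move=> h; rewrite /theta; case: eqP => // _.
by have -> : (idx (gam a m) < k.+1)%N = (idx (gam a m) < k)%N by lia.
Qed.

Lemma PI_next k a c :
  (forall m, (pos a < pos m)%N -> (pos m < pos c)%N -> m != mid -> idx (gam a m) <> k) ->
  PI k.+1 a c = PI k a c.
Proof.
move=> h; apply: eq_bigr => m /andP [am mc].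
have [->|nm] := eqVneq m mid; first by rewrite /theta eqxx.
by rewrite theta_next //; apply: h.
Qed.

Lemma eta_out a b : a != mid -> b != mid -> eta a b = 1.
Proof. by rewrite /eta => /negbTE -> /negbTE ->. Qed.

Lemma eta_mid b : eta mid b = -1.
Proof. by rewrite /eta eqxx. Qed.

Lemma neq_mid a : (pos a < pos mid)%N \/ (pos mid < pos a)%N -> a != mid.
Proof. by move=> h; rewrite -pos_eq; lia. Qed.

Lemma gam_midr d : (pos d < pos mid)%N -> gam d mid = gam d (dual d).
Proof. by move=> h; have [-> _] := gam_mid h. Qed.

Lemma gam_midl c : (pos mid < pos c)%N -> gam mid c = gam (dual c) c.
Proof.
move=> h; have h' : (pos (dual c) < pos mid)%N.
  by move: h; rewrite pos_dual pos_mid; have := pos_le c; lia.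
by have [_] := gam_mid h'; rewrite dualK.
Qed.

Section Step.
Variables (w : weight n) (k : nat).
Hypothesis w_root : is_root w.
Hypothesis w_idx : idx w = k.

Lemma idx_gam a m : (pos a < pos m)%N -> idx (gam a m) = k -> gam a m = w.
Proof.
by move=> am; rewrite -w_idx; apply: idx_inj => //; apply: gam_root.
Qed.

(** The formula depends on [k] through comparisons with indices of roots [gam a m]; if such a root
    were [w], then [m] or [mid] would have weight [wt a + w]. The short root of [c] that also occurs
    in [extra] is controlled by betweenness. *)
Lemma MM_step_none a c : (forall b, wt b != wt a + w) -> MM k.+1 c a = MM k c a.
Proof.
move=> nb.
have nk m : (pos a < pos m)%N -> idx (gam a m) <> k.
  move=> am /(idx_gam am); rewrite /gam; case: eqP => [em|_] e.
    by have := nb mid; rewrite -e em wt_dual wt_mid subrr eqxx.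
  by have := nb m; rewrite -e addrC subrK eqxx.
have [->|ca] := eqVneq c a; first by rewrite !MM_diag.
have [ac|ca'] := ltnP (pos a) (pos c); last first.
  by rewrite !MM_low // negb_and -leqNgt ca'.
have hc := nk _ ac; have [hk|hk] := boolP (idx (gam a c) < k)%N; last first.
  by rewrite !MM_low // negb_and ?hk ?orbT //; apply/orP; right; rewrite -leqNgt ltn_neqAle leqNgt hk andbT; apply/eqP/nesym.
rewrite !MM_high // ?PI_next //; try lia; first last.
  by move=> m am _ _; apply: nk.
congr (_ + _); rewrite /extra.
have [ad|_] //= := ltnP (pos a) (pos (dual c)).
have [dm|_] //= := ltnP (pos (dual c)) (pos mid).
have am := ltn_trans ad dm.
have had := nk _ ad.
have hb : btw (idx (gam a (dual c))) (idx (gam a mid)) (idx (gam (dual c) mid)).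
  by apply: gam_btw => //; rewrite negb_and orbC; apply/orP; left;
    rewrite eq_sym -dual_mid dual_eq; apply: neq_mid; left.
move: hb; rewrite !gam_midr // dualK => hb.
rewrite PI_next; last by move=> m h1 h2 _; apply: nk.
have nd : idx (gam a (dual a)) <> k by apply: nk; rewrite pos_dual; move: am; rewrite pos_mid; lia.
have -> : (k.+1 <= idx (gam a (dual c)))%N = (k <= idx (gam a (dual c)))%N by lia.
have -> : (idx (gam a (dual a)) < k.+1)%N = (idx (gam a (dual a)) < k)%N by lia.
move: hb; rewrite /btw => hb.
by case: ifP => h1; case: ifP => h2 //; exfalso; lia.
Qed.

Section Pair.
Variables a b : V n.
Hypothesis ab : pair_of w a b.

Lemma pair_lt : (pos a < pos b)%N. Proof. by case: ab. Qed.

Lemma gam_w : gam a b = w. Proof. exact: pair_gam ab. Qed.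

Lemma idx_eq m : (pos a < pos m)%N -> idx (gam a m) = k ->
  m = b \/ (m = dual a /\ b = mid).
Proof.
move=> am /(idx_gam am); case: ab => _ _ ->; rewrite /gam; case: eqP => [em e|_].
  right; split=> //; apply: wt_inj; rewrite wt_mid.
  by have := e; rewrite em wt_dual => /eqP; rewrite -subr_eq0 opprB addrA addNr add0r oppr_eq0 => /eqP.
by move/addIr/wt_inj; left.
Qed.

Lemma inv_shift m : (pos b < pos m)%N -> ~~ ((b == mid) && (m == dual a)) ->
  (idx (gam a m) < k)%N = (idx (gam b m) < k)%N /\
  (k < idx (gam a m))%N = (k < idx (gam b m))%N /\
  (idx (gam a m) <> k /\ idx (gam b m) <> k).
Proof.
move=> bm h; have := gam_btw s_normal pair_lt bm h.
by rewrite gam_w w_idx /btw; lia.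
Qed.

Lemma theta_shift m : (pos b < pos m)%N -> ~~ ((b == mid) && (m == dual a)) ->
  theta k a m = theta k b m.
Proof. by move=> bm h; rewrite /theta; have [-> _] := inv_shift bm h. Qed.

Lemma theta_pair : b != mid -> theta k a b = - q /\ theta k.+1 a b = - q^-1.
Proof. by rewrite /theta => /negbTE ->; rewrite gam_w w_idx ltnn ltnSn. Qed.

Lemma PI_shift c : (pos b < pos c)%N ->
  (b = mid -> (pos c <= pos (dual a))%N) ->
  PI k a c = PI k a b * theta k a b * PI k b c.
Proof.
move=> bc hbm; rewrite {1}/PI (prod_between _ pair_lt bc); congr (_ * _).
apply: eq_bigr => m /andP [bm mc]; apply: theta_shift => //.
apply/negP => /andP [/eqP eb /eqP em]; have h := hbm eb.
by move: mc; rewrite em ltnNge h.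
Qed.

Lemma PI_shift_next c : b != mid -> (pos b < pos c)%N ->
  PI k.+1 a c = PI k a b * - q^-1 * PI k b c.
Proof.
move=> nb bc; rewrite {1}/PI (prod_between _ pair_lt bc).
have [_ ->] := theta_pair nb; congr (_ * _ * _).
  apply: PI_next => m am mb nm /(idx_eq am) [em|[_ /eqP]]; last by rewrite (negbTE nb).
  by rewrite em ltnn in mb.
apply: eq_bigr => m /andP [bm mc].
have am := ltn_trans pair_lt bm.
have h : ~~ ((b == mid) && (m == dual a)) by rewrite (negbTE nb).
have [_ [_ [hm _]]] := inv_shift bm h.
rewrite (theta_next hm); exact: theta_shift.
Qed.

Lemma eta_shift c : b != mid -> (pos b < pos c)%N -> eta a c = eta a b * eta b c.
Proof.
move=> nb bc; rewrite /eta (negbTE nb) orbF /=.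
have [ea|na] := eqVneq a mid; have [ec|nc] := eqVneq c mid => /=; rewrite ?mulr1 ?mul1r //.
by have := ltn_trans pair_lt bc; rewrite ea ec ltnn.
Qed.

Lemma short_neq c : b != mid -> a != mid -> (pos (dual c) < pos mid)%N ->
  idx (gam (dual c) c) <> k.
Proof.
move=> nb na hd.
have dc : (pos (dual c) < pos c)%N by move: hd; rewrite pos_dual pos_mid; lia.
move/(idx_gam dc); rewrite /gam dualK eqxx => e.
have := pair_norm ab; rewrite -e !wt_norm nb na.
by case: (_ != _).
Qed.

(** Passing [w] turns the factor of [PI] at [b] from [- q] into [- q^-1]. The difference is [z], and
    for [c] beyond [b] it accounts for the product term on the right; for [c = b] the entry
    [z * rho a b] itself appears. *)
Lemma MM_step_pair c : b != mid ->
  MM k.+1 c a = MM k c a + z * rho a b * MM k c b.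
Proof.
move=> nb; have hab := pair_lt.
have rhoE : rho a b = eta a b * PI k a b by rewrite /rho gam_w w_idx.
have J m : (pos a < pos m)%N -> m != b -> idx (gam a m) <> k.
  by move=> am mb /(idx_eq am) [/eqP|[_ /eqP]]; rewrite ?(negbTE mb) ?(negbTE nb).
have nmid m : ~~ ((b == mid) && (m == dual a)) by rewrite (negbTE nb).
have ne_ab : a != b by rewrite -pos_eq; lia.
have [->|ca] := eqVneq c a.
  by rewrite !MM_diag MM_low // ?mulr0 ?addr0 // negb_and -leqNgt ltnW.
have [cb|cb] := eqVneq c b.
  rewrite cb MM_diag mulr1 (@MM_low k b a) 1?eq_sym //; last first.
    by rewrite gam_w w_idx ltnn andbF.
  rewrite MM_high ?gam_w ?w_idx // add0r.
  have -> : (b == dual a) = false by case: ab => _ /negbTE.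
  rewrite mul0r addr0 PI_next; last first.
    by move=> m am mb _; apply: J => //; rewrite -pos_eq; lia.
  rewrite /extra; case: ifP => [/and5P [h1 h2 h3 h4 h5]|_]; last by rewrite addr0 rhoE.
  have mb : (pos mid < pos b)%N by move: h2; rewrite pos_dual pos_mid; lia.
  have am := ltn_trans h1 h2.
  have := gam_btw s_normal am mb.
  have nba : b != dual a by case: ab.
  rewrite (negbTE nba) andbF => /(_ isT).
  rewrite gam_w w_idx (gam_midr am) (gam_midl mb) /btw; lia.
have [ac|ac] := ltnP (pos a) (pos c); last first.
  by rewrite !MM_low ?mulr0 ?addr0 // negb_and -!leqNgt ?ac // (leq_trans ac (ltnW hab)).
have Jc := J _ ac cb.
have dlt : (pos (dual c) < pos mid)%N -> (pos mid < pos c)%N.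
  by rewrite pos_dual pos_mid; lia.
have [bc|bc] := ltnP (pos b) (pos c); last first.
  have bc' : (pos c < pos b)%N by rewrite ltn_neqAle pos_eq cb.
  rewrite (@MM_low k c b) // ?mulr0 ?addr0; last by rewrite negb_and -leqNgt bc.
  have [hk|hk] := boolP (idx (gam a c) < k)%N; last first.
    by rewrite !MM_low // negb_and ?hk ?orbT //; apply/orP; right; rewrite -leqNgt ltn_neqAle leqNgt hk andbT; apply/eqP/nesym.
  rewrite !MM_high //; last by apply: ltnW.
  rewrite (@PI_next k a c); last first.
    by move=> m am mc _; apply: J => //; rewrite -pos_eq; lia.
  congr (_ + _); rewrite /extra.
  have [ad|_] //= := ltnP (pos a) (pos (dual c)).
  have [dm|_] //= := ltnP (pos (dual c)) (pos mid).
  have mc := dlt dm.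
  have na : a != mid by apply: neq_mid; left; apply: ltn_trans dm.
  have Jd : idx (gam a (dual c)) <> k by apply: J => //; rewrite -pos_eq; lia.
  have Ja : idx (gam a (dual a)) <> k.
    apply: J; last by case: ab => _; rewrite eq_sym.
    by move: ad dm; rewrite !pos_dual pos_mid; clear; lia.
  have Jdc := @short_neq c nb na dm.
  rewrite (@PI_next k a (dual c)); last first.
    by move=> m am md _; apply: J => //; rewrite -pos_eq; lia.
  by congr (if _ then _ else _); lia.
have [e1 [e2 [_ nbc]]] := inv_shift bc (nmid c).
have [hk|hk] := boolP (idx (gam a c) < k)%N; last first.
  rewrite !MM_low ?mulr0 ?addr0 // negb_and -?e1 ?hk ?orbT //.
  by apply/orP; right; rewrite -leqNgt ltn_neqAle leqNgt hk andbT; apply/eqP/nesym.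
rewrite !MM_high -?e1 //; last by apply: ltnW.
have hnb : b = mid -> (pos c <= pos (dual a))%N by move=> e; rewrite e eqxx in nb.
rewrite PI_shift // PI_shift_next // (eta_shift nb bc) rhoE.
have [tb _] := theta_pair nb; rewrite tb.
(* For [c = dual b] the summand [z * q] of [MM k c b] cancels the extra term of [a]; for the other
   [c] the extra terms of [a] and [b] obey the same recursion as [PI]. *)
have ext : extra k.+1 c a = extra k c a +
    z * (eta a b * PI k a b) * ((c == dual b)%:R * (z * q) + extra k c b).
  have [ecb|ncb] := eqVneq c (dual b).
    have bm : (pos b < pos mid)%N by move: bc; rewrite ecb pos_dual pos_mid; lia.
    have am := ltn_trans hab bm.
    have na : a != mid by apply: neq_mid; left.
    rewrite /extra ecb dualK gam_w w_idx ltnn !andbF ltnn /= hab bm leqnn /=.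
    rewrite eta_out // mul1r !mul1r addr0.
    have := inv_shift bm; rewrite (negbTE nb) => /(_ isT) [e3 _].
    rewrite (gam_midr am) (gam_midr bm) in e3.
    rewrite e3; have -> : (idx (gam b (dual b)) < k)%N by rewrite -ecb -e1.
    by rewrite /=; ring.
  rewrite mul0r add0r /extra.
  have [db|db] := ltnP (pos b) (pos (dual c)); last first.
    have db' : (pos (dual c) < pos b)%N.
      rewrite ltn_neqAle db andbT pos_eq; apply: contra ncb => /eqP <-.
      by rewrite dualK.
    rewrite /= mulr0 addr0.
    have [ad|_] //= := ltnP (pos a) (pos (dual c)).
    have [dm|_] //= := ltnP (pos (dual c)) (pos mid).
    have na : a != mid by apply: neq_mid; left; apply: ltn_trans dm.
    have Jd : idx (gam a (dual c)) <> k by apply: J => //; rewrite -pos_eq; lia.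
    have Ja : idx (gam a (dual a)) <> k.
      apply: J; last by case: ab => _; rewrite eq_sym.
      by move: ad dm; rewrite !pos_dual pos_mid; clear; lia.
    have Jdc := @short_neq c nb na dm.
    rewrite (@PI_next k a (dual c)); last first.
      by move=> m am md _; apply: J => //; rewrite -pos_eq; lia.
    by congr (if _ then _ else _); lia.
  have [dm|_] /= := ltnP (pos (dual c)) (pos mid); last first.
    by rewrite !andbF mulr0 addr0.
  have bm := ltn_trans db dm; have am := ltn_trans hab bm.
  have na : a != mid by apply: neq_mid; left.
  rewrite (ltn_trans hab db) /=.
  have [e3 [e4 [n3 n4]]] := inv_shift db (nmid _).
  have := inv_shift bm; rewrite (negbTE nb) => /(_ isT) [e5 [_ [n5 n6]]].
  rewrite (gam_midr am) (gam_midr bm) in e5 n5 n6.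
  have Jdc := @short_neq c nb na dm.
  have -> : (k < idx (gam a (dual c)))%N = (k <= idx (gam b (dual c)))%N by move: e4 n3 n4; clear; lia.
  have -> : (k <= idx (gam a (dual c)))%N = (k <= idx (gam b (dual c)))%N by move: e4 n3 n4; clear; lia.
  have -> : (idx (gam a (dual a)) < k.+1)%N = (idx (gam b (dual b)) < k)%N by move: e5 n5 n6; clear; lia.
  have -> : (idx (gam a (dual a)) < k)%N = (idx (gam b (dual b)) < k)%N by move: e5 n5 n6; clear; lia.
  have -> : (idx (gam (dual c) c) < k.+1)%N = (idx (gam (dual c) c) < k)%N by move: Jdc; clear; lia.
  case: ifP => _; last by rewrite mulr0 addr0.
  have hnb' : b = mid -> (pos (dual c) <= pos (dual a))%N by move=> e; rewrite e eqxx in nb.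
  rewrite PI_shift // PI_shift_next // tb eta_out //.
  by field.
rewrite ext; set X := extra k c a; set Y := extra k c b.
by field.
Qed.

End Pair.
Section Mid.
Variable a : V n.
Hypothesis am : pair_of w a mid.

Let amid : (pos a < pos mid)%N. Proof. by case: am. Qed.

Lemma mid_dual : (pos mid < pos (dual a))%N.
Proof. by move: amid; rewrite pos_dual pos_mid; lia. Qed.

Lemma idx_dual : idx (gam a (dual a)) = k /\ idx (gam mid (dual a)) = k.
Proof.
have [e1 e2] := gam_mid amid.
by rewrite e2 -e1 (gam_w am) w_idx.
Qed.

Lemma idx_eq_mid m : (pos a < pos m)%N -> m != mid -> m != dual a ->
  idx (gam a m) <> k.
Proof.
by move=> h nm nd /(idx_eq am h) [/eqP|[/eqP e _]]; [rewrite (negbTE nm)|rewrite e in nd].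
Qed.

(* Exactly one of gam a m and gam a (dual m) precedes the short root w lying
   between them. *)
Lemma theta_dual m : (pos a < pos m)%N -> (pos m < pos mid)%N ->
  theta k a m * theta k a (dual m) = 1.
Proof.
move=> h1 h2; have [e1 e2] := idx_dual.
have hd : (pos m < pos (dual a))%N := ltn_trans h2 mid_dual.
have := gam_btw s_normal h1 hd.
have nm : m != mid by apply: neq_mid; left.
have nd : dual m != mid by rewrite -[mid]dual_mid dual_eq.
rewrite (negbTE nm) => /(_ isT).
have nda : dual a != dual m by rewrite dual_eq; apply: contraTneq h1 => ->; rewrite ltnn.
have nma : dual m != dual a by rewrite eq_sym.
have -> : gam m (dual a) = gam a (dual m).
  by rewrite !gamE ?dualK // !wt_dual addrC.
rewrite e1 /theta (negbTE nm) (negbTE nd) /btw.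
by case: (ltngtP (idx (gam a m)) k); case: (ltngtP (idx (gam a (dual m))) k) => //= _ _ _;
  rewrite mulrNN ?mulVf ?mulfV.
Qed.

(** Each label below [mid] is paired with its dual, and the two factors are inverse by
    [theta_dual]. *)
Lemma prod_dual (d : V n) : (pos a <= pos d)%N -> (pos d < pos mid)%N ->
  \prod_(m : V n | (pos d < pos m < pos mid)%N) theta k a m *
  \prod_(m : V n | (pos mid < pos m < pos (dual d))%N) theta k a m = 1.
Proof.
move=> ad dm.
rewrite [X in _ * X](reindex_inj (can_inj (@dualK n))) /=.
rewrite [X in _ * X](eq_bigl (fun m : V n => (pos d < pos m < pos mid)%N)); last first.
  move=> m; rewrite !pos_dual pos_mid; have := pos_le m; have := pos_le d.
  by move: dm; rewrite pos_mid; lia.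
rewrite -big_split /= big1 // => m /andP [h1 h2].
by apply: theta_dual => //; apply: leq_ltn_trans h1.
Qed.

Lemma PI_mid_shift c : (pos c <= pos (dual a))%N ->
  PI k mid c = \prod_(m : V n | (pos mid < pos m < pos c)%N) theta k a m.
Proof.
move=> h; apply: eq_bigr => m /andP [h1 h2].
rewrite (theta_shift am h1) // negb_and; apply/orP; right.
by apply: contraTneq h2 => ->; rewrite -leqNgt.
Qed.

Lemma theta_mid k' b : theta k' b mid = 1.
Proof. by rewrite /theta eqxx. Qed.

Lemma PI_a_dual : PI k a (dual a) = 1.
Proof.
rewrite /PI (prod_between _ amid mid_dual) theta_mid mulr1.
exact: prod_dual.
Qed.

Lemma PI_next_a_dual : PI k.+1 a (dual a) = 1.
Proof.
rewrite -PI_a_dual; apply: PI_next => m h1 h2 nm; apply: idx_eq_mid => //.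
by apply: contraTneq h2 => ->; rewrite ltnn.
Qed.

Lemma PI_mid_mul : PI k a mid * PI k mid (dual a) = 1.
Proof. by rewrite (PI_mid_shift (leqnn _)); apply: prod_dual. Qed.

(** A short root [w] equals all three of [gam a mid], [gam mid (dual a)] and [gam a (dual a)], so
    both [w] and its square contribute. For [c] between [mid] and [dual a] the path through [v_0]
    leaves the term [extra]; beyond [dual a] the contributions combine by [PI_mid_mul]. *)
Lemma MM_step_mid c : MM k.+1 c a =
  MM k c a + z * rho a mid * MM k c mid + z * (q + 1) * MM k c (dual a).
Proof.
have hmd := mid_dual; have had := ltn_trans amid hmd.
have [e1 e2] := idx_dual.
have gw := gam_w am.
have na : a != mid by apply: neq_mid; left.
have nda : dual a != mid by apply: neq_mid; right.
have naa : a != dual a by rewrite -pos_eq; lia.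
have rhoE : rho a mid = - PI k a mid.
  by rewrite /rho gw w_idx /eta eqxx orbT mulN1r.
have [->|ca] := eqVneq c a.
  rewrite !MM_diag (@MM_low k a mid) // ?(@MM_low k a (dual a)) //; last 2 first.
  - by rewrite negb_and -leqNgt ltnW.
  - by rewrite negb_and -leqNgt ltnW.
  by ring.
have [->|cm] := eqVneq c mid.
  rewrite MM_diag (@MM_low k mid (dual a)) 1?eq_sym //; last first.
    by rewrite negb_and -leqNgt ltnW.
  rewrite (@MM_low k mid a) 1?eq_sym //; last by rewrite gw w_idx ltnn andbF.
  rewrite MM_high // ?gw ?w_idx // /extra dual_mid ltnn andbF.
  rewrite [mid == dual a]eq_sym (negbTE nda) PI_next; last first.
    move=> m h1 h2 nm; apply: idx_eq_mid => //.
    by apply: contraTneq h2 => ->; rewrite -leqNgt ltnW.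
  by rewrite rhoE /eta eqxx orbT /=; ring.
have [->|cd] := eqVneq c (dual a).
  rewrite MM_diag (@MM_low k (dual a) a) 1?eq_sym //; last by rewrite e1 ltnn andbF.
  rewrite (@MM_low k (dual a) mid) //; last by rewrite e2 ltnn andbF.
  rewrite MM_high // ?e1 // /extra dualK ltnn eqxx eta_out //=.
  by rewrite PI_next_a_dual; ring.
have [ac|ac] := ltnP (pos a) (pos c); last first.
  rewrite !MM_low ?mulr0 ?addr0 // negb_and -!leqNgt ?ac //; apply/orP; left; lia.
have Jc := idx_eq_mid ac cm cd.
have [mc|mc] := ltnP (pos mid) (pos c); last first.
  rewrite (@MM_low k c mid) // ?(@MM_low k c (dual a)) ?mulr0 ?addr0 //; last 2 first.
  - by rewrite negb_and -leqNgt; apply/orP; left; lia.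
  - by rewrite negb_and -leqNgt mc.
  have [hk|hk] := boolP (idx (gam a c) < k)%N; last first.
    by rewrite !MM_low // negb_and ?hk ?orbT //; apply/orP; right; rewrite -leqNgt ltn_neqAle leqNgt hk andbT; apply/eqP/nesym.
  rewrite !MM_high //; last by apply: ltnW.
  rewrite (@PI_next k a c); last first.
    move=> m h1 h2 nm; apply: idx_eq_mid => //.
    by apply: contraTneq h2 => ->; rewrite -leqNgt; lia.
  congr (_ + _); rewrite /extra.
  have -> : (pos (dual c) < pos mid)%N = false.
    by move: mc cm; rewrite -pos_eq pos_dual pos_mid; lia.
  by rewrite !andbF.
have [cda|cda] := ltnP (pos c) (pos (dual a)).
  rewrite (@MM_low k c (dual a)) // ?mulr0 ?addr0; last by rewrite negb_and -leqNgt ltnW.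
  have hcond : ~~ ((mid == mid) && (c == dual a)) by rewrite eqxx.
  have [f1 [f2 [_ f3]]] := inv_shift am mc hcond.
  have [hk|hk] := boolP (idx (gam a c) < k)%N; last first.
    rewrite !MM_low ?mulr0 ?addr0 // negb_and -?f1 ?hk ?orbT //.
    by apply/orP; right; rewrite -leqNgt ltn_neqAle leqNgt hk andbT; apply/eqP/nesym.
  have dc : (pos (dual c) < pos mid)%N by move: mc (pos_le c); rewrite pos_dual pos_mid; clear; lia.
  have ad : (pos a < pos (dual c))%N.
    by move: cda (pos_le a) (pos_le c); rewrite !pos_dual; clear; lia.
  have ndc : dual c != mid by apply: neq_mid; left.
  have h3 := gam_btw s_normal ad dc.
  rewrite (negbTE ndc) gw w_idx (gam_midr dc) dualK -(gam_midl mc) in h3.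
  have {}h3 := h3 isT.
  rewrite !MM_high -?f1 //; last by apply: ltnW.
  rewrite (negbTE cd) [dual mid]dual_mid (negbTE cm) (eta_out na cm).
  rewrite eta_mid (@PI_next k a c); last first.
    move=> m h1 h2 nm; apply: idx_eq_mid => //.
    by apply: contraTneq h2 => ->; rewrite -leqNgt ltnW.
  rewrite /extra e1 ltnn !andbF ad dc /= dual_mid.
  have -> : (pos mid < pos (dual c))%N = false by apply/negbTE; rewrite -leqNgt ltnW.
  rewrite -(gam_midl mc) /= ltnSn.
  have hk' : (idx (gam mid c) < k)%N by rewrite -f1.
  have hJd : (k < idx (gam a (dual c)))%N by move: h3 hk'; clear; rewrite /btw; lia.
  have -> : (idx (gam mid c) < k.+1)%N by apply: ltnW.
  rewrite hJd.
  rewrite /= (@PI_next k a (dual c)); last first.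
    move=> m h1 h2 nm; apply: idx_eq_mid => //.
    by apply: contraTneq h2 => ->; rewrite -leqNgt ltnW // (ltn_trans dc).
  rewrite rhoE.
  (* By [prod_dual] the factors strictly between [dual c] and [c] cancel. What remains is the factor
     [- q] at [dual c], the origin of the constant in [extra]. *)
  have key : PI k a mid * PI k mid c = - q * PI k a (dual c).
    rewrite {1}/PI (prod_between _ ad dc) (PI_mid_shift (ltnW cda)).
    have -> : theta k a (dual c) = - q.
      rewrite /theta (negbTE ndc).
      have -> // : (idx (gam a (dual c)) < k)%N = false.
      by apply/negbTE; rewrite -leqNgt ltnW.
    have := prod_dual (ltnW ad) dc; rewrite dualK => hp.
    by rewrite -!mulrA hp mulr1 mulrC.
  transitivity (z * (1 * PI k a c) + z ^+ 2 * (PI k a mid * PI k mid c)).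
    by rewrite key; ring.
  by ring.
have dac : (pos (dual a) < pos c)%N.
  by rewrite ltn_neqAle cda andbT pos_eq eq_sym.
have hcond : ~~ ((mid == mid) && (c == dual a)) by rewrite (negbTE cd) andbF.
have [f1 [f2 [_ f3]]] := inv_shift am mc hcond.
have shift m : (pos (dual a) < pos m)%N ->
    (idx (gam a m) < k)%N = (idx (gam (dual a) m) < k)%N /\
    (idx (gam a m) <> k).
  move=> h; have := gam_btw s_normal had h.
  by rewrite (negbTE nda) e1 /btw => /(_ isT); clear; lia.
have [f4 _] := shift c dac.
have [hk|hk] := boolP (idx (gam a c) < k)%N; last first.
  rewrite !MM_low ?mulr0 ?addr0 // negb_and -?f1 -?f4 ?hk ?orbT //.
  by apply/orP; right; rewrite -leqNgt ltn_neqAle leqNgt hk andbT; apply/eqP/nesym.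
have dca : (pos (dual c) < pos a)%N.
  by move: dac (pos_le a) (pos_le c); rewrite !pos_dual; clear; lia.
have noex k' (b : V n) : (pos a <= pos b)%N -> extra k' c b = 0.
  by move=> h; rewrite /extra; have -> : (pos b < pos (dual c))%N = false by apply/negbTE; rewrite -leqNgt ltnW // (leq_trans dca).
rewrite !MM_high -?f1 -?f4 //; last by apply: ltnW.
rewrite !(noex _ a (leqnn _)) (noex _ mid (ltnW amid)) (noex _ (dual a) (ltnW had)).
rewrite dualK dual_mid (negbTE cd) (negbTE cm) (negbTE ca).
rewrite (eta_out na cm) (eta_out nda cm) eta_mid !mul1r.
have Qa : \prod_(m : V n | (pos (dual a) < pos m < pos c)%N) theta k a m
    = PI k (dual a) c.
  by apply: eq_bigr => m /andP [h1 h2]; rewrite /theta; have [-> _] := shift m h1.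
have Qm : \prod_(m : V n | (pos (dual a) < pos m < pos c)%N) theta k mid m
    = PI k (dual a) c.
  rewrite -Qa; apply: eq_bigr => m /andP [h1 h2]; rewrite (theta_shift am) //.
    by apply: ltn_trans h1.
  by rewrite eqxx; apply: contraTneq h1 => ->; rewrite ltnn.
have -> : PI k a c = - q * PI k (dual a) c.
  rewrite {1}/PI (prod_between _ had dac) Qa -/(PI k a (dual a)) PI_a_dual mul1r.
  by rewrite /theta (negbTE nda) e1 ltnn.
have -> : PI k mid c = PI k mid (dual a) * - q * PI k (dual a) c.
  rewrite {1}/PI (prod_between _ hmd dac) Qm; congr (_ * _ * _).
  by rewrite /theta (negbTE nda) e2 ltnn.
have -> : PI k.+1 a c = - q^-1 * PI k (dual a) c.
  rewrite {1}/PI (prod_between _ had dac).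
  rewrite -[X in X * _ * _]/(PI k.+1 a (dual a)) PI_next_a_dual mul1r; congr (_ * _); first by rewrite /theta (negbTE nda) e1 ltnSn.
  rewrite -Qa; apply: eq_bigr => m /andP [h1 h2]; apply: theta_next.
  by have [] := shift m h1.
rewrite rhoE /=.
transitivity (- z * q * PI k (dual a) c +
   z ^+ 2 * (PI k a mid * PI k mid (dual a)) * - q * PI k (dual a) c +
   z * (q + 1) * (z * PI k (dual a) c)); last by ring.
by rewrite PI_mid_mul; field.
Qed.

End Mid.

Lemma MM_step a c : MM k.+1 c a = \sum_b MM k c b * ZZ w b a.
Proof.
rewrite /ZZ; under eq_bigr => b _ do rewrite !(mulrDr (MM k c b)).
rewrite !big_split /=.
rewrite sum_delta1.
have wtE (b' b : V n) : wt b = wt a + w -> (wt b' == wt a + w) = (b' == b).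
  by move=> <-; rewrite (inj_eq (@wt_inj n)).
have [/existsP [b /eqP eb]|nb] := boolP [exists b : V n, wt b == wt a + w]; last first.
  have {}nb b : wt b != wt a + w.
    by apply: contra nb => h; apply/existsP; exists b.
  rewrite sum_delta0; last by move=> b; apply/negbTE.
  rewrite sum_delta0 ?addr0; first exact: MM_step_none.
  move=> b; apply/negbTE/andP => -[/eqP e1 /eqP e2].
  by have := nb mid; rewrite wt_mid -e2 e1 wt_dual subrr eqxx.
have pab := pair_of_root w_root eb.
rewrite (sum_delta _ _ (b := b)); last by move=> b'; apply: wtE.
have [ebm|nbm] := eqVneq b mid; last first.
  rewrite sum_delta0 ?addr0; first by rewrite (MM_step_pair pab) // [in RHS]mulrC.
  move=> b'; apply/negbTE/andP => -[/eqP e1 /eqP e2].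
  by case/eqP: nbm; apply: wt_inj; rewrite eb -e2 e1 wt_dual wt_mid subrr.
rewrite ebm in eb pab *.
have ew : w = wt (dual a).
  by case: pab => _ _ ->; rewrite wt_mid sub0r wt_dual.
rewrite (sum_delta _ _ (b := dual a)); last first.
  by move=> b'; case: eqP => // ->; rewrite ew eqxx.
rewrite (MM_step_mid pab) -!addrA; congr (_ + _); congr (_ + _); exact: mulrC.
Qed.

End Step.
End ZeroWeight.

Lemma qexp3 (F : fieldType) B (z : F) (A : op F B) : A ^+ 3 = 0 ->
  qexp z A = 1 + (qfact z 1)^-1 *: A + (qfact z 2)^-1 *: (A * A).
Proof.
move=> A3; rewrite /qexp -(fsbig_widen `I_3 setT) //; last first.
  move=> k [_ /=] /negP; rewrite -leqNgt => hk.
  by rewrite -(subnK hk) exprD A3 mulr0 scaler0.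
rewrite -fsbig_ord 3!big_ord_recl big_ord0 /= addr0.
rewrite -[bump 0 (bump 0 0)]/2%N -[bump 0 0]/1%N.
have -> : qfact z 0 = 1 by rewrite /qfact big_geq.
by rewrite invr1 scale1r expr0 expr1 expr2 addrA.
Qed.

(** * The Cartan part acts by weights *)

Section CartanPart.
Variables (F : fieldType) (n : nat) (q : F).
Hypothesis q_neq0 : q != 0.
Implicit Types (a b c m : V n).

Lemma alpha_coord (i k : 'I_n) :
  alpha i 0 k = (k == i)%:R - (k == i.+1 :> nat)%:R.
Proof.
have hk := ltn_ord k.
have e1 : (i.+1%:Z == k.+1%:Z) = (k == i) by rewrite eqz_nat eqSS eq_sym.
have e2 : (i.+2%:Z == k.+1%:Z) = (k == i.+1 :> nat) by rewrite eqz_nat eqSS eq_sym.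
have e3 : (i.+1%:Z == - k.+1%:Z) = false by lia.
have e4 : (i.+2%:Z == - k.+1%:Z) = false by lia.
rewrite /alpha; case: ifP => hin; rewrite !mxE e1 ?e2 e3 ?e4 !subr0 //.
by have -> : ((k : nat) == i.+1) = false; [lia | rewrite subr0].
Qed.

(** Summation by parts: [alpha_coef x] consists of partial sums of coordinates, and simple roots are
    differences of consecutive unit vectors, the last one being a unit vector. *)
Lemma wform_alpha_coef (x y : weight n) :
  \sum_i alpha_coef x i * wform (alpha i) y = wform x y.
Proof.
rewrite /wform; under eq_bigr do rewrite mulr_sumr.
rewrite exchange_big /=; apply: eq_bigr => k _.
under eq_bigr do rewrite mulrA.
rewrite -mulr_suml; congr (_ * _).
under eq_bigr do rewrite alpha_coord mulrBr.
rewrite sumrB (bigD1 k) //= eqxx mulr1 big1 ?addr0; last first.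
  by move=> i ik; rewrite eq_sym (negbTE ik) mulr0.
rewrite /alpha_coef (bigD1 k) //=.
case: (posnP k) => [k0|k0].
  rewrite !big1 ?addr0 ?subr0 // => [i _|i]; first by rewrite k0 mulr0.
  by rewrite -val_eqE /= k0 leqn0 andbN.
have hk' : (k.-1 < n)%N by have := ltn_ord k; lia.
rewrite [X in _ - X](bigD1 (Ordinal hk')) //= prednK // eqxx mulr1.
rewrite [X in _ - (_ + X)]big1 ?addr0; last first.
  move=> i; rewrite -val_eqE /= => h.
  have -> : ((k : nat) == i.+1) = false by lia.
  by rewrite mulr0.
rewrite -[RHS]addr0 -addrA; congr (_ + _); apply/eqP; rewrite subr_eq0; apply/eqP.
by apply: eq_bigl => i; rewrite -val_eqE /=; lia.
Qed.

Definition diag_op (f : V n -> F) : op F (V n) :=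
  @mkop F (V n) (fun y x => (y == x)%:R * f x).

Lemma diag_opM f g : diag_op f * diag_op g = diag_op (fun x => f x * g x).
Proof.
apply: opP => y x; rewrite entM ent_mkop (bigD1 x) //= big1 ?addr0.
  by rewrite !ent_mkop eqxx mul1r mulrA.
by move=> m mx; rewrite !ent_mkop (negbTE mx) mul0r mulr0.
Qed.

Lemma diag_op1 : diag_op (fun=> 1) = 1.
Proof. by apply: opP => y x; rewrite ent_mkop ent1 mulr1. Qed.

Lemma eq_diag_op f g : f =1 g -> diag_op f = diag_op g.
Proof. by move=> h; apply: opP => y x; rewrite !ent_mkop h. Qed.

Variable pi : {linear Uq n q -> op F (V n)}.
Hypothesis pi_V : affords_V pi.

Lemma pi1 : pi 1 = 1.
Proof. by case: pi_V => -[h _] _; apply: h. Qed.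

Lemma pi_K i : pi (Uq_of q (GK, i)) = diag_op (fun a => q ^ wform (alpha i) (wt a)).
Proof. by case: pi_V => _ ->. Qed.

Lemma pi_KV i :
  pi (Uq_of q (GKV, i)) = diag_op (fun a => (q ^ wform (alpha i) (wt a))^-1).
Proof. by case: pi_V => _ ->. Qed.

Lemma diag_opX f k : diag_op f ^+ k = diag_op (fun a => f a ^+ k).
Proof.
elim: k => [|k IH]; first by rewrite expr0 -diag_op1.
rewrite exprS IH diag_opM; apply: eq_diag_op => a; by rewrite exprS.
Qed.

Lemma piX (u : Uq n q) k : pi (u ^+ k) = pi u ^+ k.
Proof.
elim: k => [|k IH]; first by rewrite !expr0 pi1.
by rewrite !exprS (piM pi_V) IH.
Qed.

Lemma pi_Kpow i (m : int) :
  pi (Uq_Kpow q i m) = diag_op (fun a => q ^ (m * wform (alpha i) (wt a))).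
Proof.
case: m => k; rewrite /Uq_Kpow piX ?pi_K ?pi_KV diag_opX; apply: eq_diag_op => a.
  by rewrite exprnP exprz_exp mulrC.
by rewrite exprVn exprnP exprz_exp invr_expz NegzE mulNr mulrC.
Qed.

Lemma pi_Uq_K x : pi (Uq_K q x) = diag_op (fun a => q ^ wform x (wt a)).
Proof.
rewrite /Uq_K (big_morph pi (piM pi_V) pi1).
have -> : diag_op (fun a => q ^ wform x (wt a)) =
    diag_op (fun a => \prod_(i < n) q ^ (alpha_coef x i * wform (alpha i) (wt a))).
  apply: eq_diag_op => a; rewrite -wform_alpha_coef.
  apply: (big_morph (fun k : int => q ^ k)) => [k l|]; last by rewrite expr0z.
  by rewrite expfzDr.
elim: (index_enum _) => [|i r IH].
  by rewrite big_nil -diag_op1; apply: eq_diag_op => a; rewrite big_nil.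
rewrite big_cons IH pi_Kpow diag_opM; apply: eq_diag_op => a.
by rewrite big_cons.
Qed.

End CartanPart.

(** * Norm estimates for differences of weights *)

Section PairForm.
Variable n : nat.
Implicit Types (a b c m : V n) (x y w : weight n).

Lemma eq_dual a b : (a == dual b) = (b == dual a).
Proof. by rewrite -(dual_eq a) dualK eq_sym. Qed.

Lemma pair_wform w a b : pair_of w a b ->
  wform w (wt b) = (b != mid n)%:R /\ wform w (wt a) = - (a != mid n)%:R.
Proof.
case=> ab nab ->; rewrite !wformE !wt_norm (wformC (wt b) (wt a)) (wform_wt a b).
have -> : (a == b) = false by apply/eqP => e; rewrite e ltnn in ab.
rewrite eq_dual (negbTE nab) subrr.
by rewrite oppr0 addr0 add0r.
Qed.

Lemma pair_neq w a b : pair_of w a b -> b != a.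
Proof. by case=> ab _ _; apply: contraTneq ab => ->; rewrite ltnn. Qed.

Lemma dual_neq_mid a : (dual a != mid n) = (a != mid n).
Proof. by rewrite -[mid n in LHS]dual_mid dual_eq. Qed.

Lemma pair_dual w a b : pair_of w a b -> pair_of w (dual b) (dual a).
Proof. by move=> h; have := h; rewrite -(pair_gam h); apply: gam_dual. Qed.

(** Three times a root has norm at least 9, whereas two weights of [V] differ by a vector of norm at
    most 4. This makes the cube of the exponent of a root factor vanish. *)
Lemma triple_root w a b : is_root w -> wt b != wt a + (w + w + w).
Proof.
move=> rw; apply/eqP => e.
have := wform_wt b b; have := wform_wt a b; have := wform_wt a a.
have ew : wform (wt b - wt a) (wt b - wt a) = 9 * wform w w.
  by rewrite e addrC addKr !wformE; lia.
move: ew; rewrite !wformE (wformC (wt b) (wt a)).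
have := root_norm rw; case: (a == b); case: (a == dual b); case: (a == a);
  case: (a == dual a); case: (b == b); case: (b == dual b); lia.
Qed.

(** Twice a root has norm at least 4, and among differences of weights this is reached only by a
    dual pair. *)
Lemma double_root w a b : is_root w -> wt b = wt a + (w + w) ->
  b = dual a /\ wt b = w.
Proof.
move=> rw e.
have ew : wform (wt b - wt a) (wt b - wt a) = 4 * wform w w.
  by rewrite e addrC addKr !wformE; lia.
have hb : b = dual a.
  apply/eqP; move: ew; rewrite !wformE (wformC (wt b) (wt a)).
  rewrite !wt_norm wform_wt -[b in a == dual b]dualK dualK.
  rewrite [a == dual b]eq_sym -[dual b == a]dual_eq dualK.
  have := root_norm rw; case: (a != _); case: (b != _); case: (a == b);
    case: (b == dual a) => //=; lia.
split=> //; have wD (x y : weight n) i : (x + y) 0 i = x 0 i + y 0 i by rewrite mxE.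
have wN (x : weight n) i : (- x) 0 i = - x 0 i by rewrite mxE.
apply/rowP => i; have := congr1 (fun x : weight n => x 0 i) e.
by rewrite hb wt_dual !wD wN; lia.
Qed.

(* The inner product with a nonzero one of the weights identifies the pair. *)
Lemma wt_pair_eq a1 a2 b1 b2 : a2 != dual a1 ->
  wt b1 + wt b2 = wt a1 + wt a2 -> (b1 == a1) && (b2 == a2) || (b1 == a2) && (b2 == a1).
Proof.
wlog na : a1 a2 / a1 != mid n => [H nd e|nd e].
  have [ea|] := eqVneq a1 (mid n); last by move=> na; apply: H.
  rewrite orbC; apply: H; last by rewrite e addrC.
  - by apply: contra nd => /eqP ->; rewrite ea dual_mid.
  - by rewrite -dual_eq dualK eq_sym.
have := congr1 (fun x => wform x (wt a1)) e; rewrite !wformE !wform_wt eqxx.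
have n1 : (a1 == dual a1) = false.
  apply/negbTE; apply: contra na => /eqP e1; rewrite -pos_eq pos_mid.
  by have := congr1 (@pos n) e1; rewrite pos_dual; have := pos_le a1; lia.
rewrite n1 (negbTE nd).
have [e1 _|n11] := eqVneq b1 a1.
  have /addrI/wt_inj -> : wt a1 + wt b2 = wt a1 + wt a2 by rewrite -e e1.
  by rewrite eqxx.
have [e2 _|n21] := eqVneq b2 a1.
  have /addIr/wt_inj -> : wt b1 + wt a1 = wt a2 + wt a1 by rewrite -{1}e2 e addrC.
  by rewrite eqxx orbT.
by case: (b1 == _); case: (b2 == _); case: (a2 == _).
Qed.

End PairForm.

(** * The matrix of a single root factor *)

Section RootMatrix.
Variables (F : fieldType) (n : nat) (q : F) (s : seq (weight n)).
Hypothesis q_neq0 : q != 0.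
Hypothesis q2_neq1 : q ^+ 2 != 1.
Hypothesis s_normal : normal_ordering s.
Variables (E Fv : weight n -> Uq n q).
Hypothesis EF_root : root_vectors s E Fv.
Variable sc : weight n -> F.
Hypothesis sc_root : root_scalars E Fv sc.
Variable pi : {linear Uq n q -> op F (V n)}.
Hypothesis pi_V : affords_V pi.
Implicit Types (a b c m : V n) (x y w : weight n).

Local Notation z := (q - q^-1).
Local Notation rho := (rho q s).
Local Notation eta := (@eta F n).
Local Notation mid := (mid n).
Local Notation VV := (tens_space (V n) (V n)).

Lemma qm1_neq0 : q - 1 != 0.
Proof.
by rewrite subr_eq0; apply: contra q2_neq1 => /eqP ->; rewrite expr1n.
Qed.

Lemma qp1_neq0 : q + 1 != 0.
Proof.
by rewrite addr_eq0; apply: contra q2_neq1 => /eqP ->; rewrite sqrrN expr1n.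
Qed.

Lemma z_neq0 : z != 0.
Proof.
have -> : z = (q ^+ 2 - 1) / q by field.
by rewrite mulf_neq0 ?invr_eq0 // subr_eq0.
Qed.

Let cE w a b := ent (pi (E w)) b a.
Let dF w a b := ent (pi (Fv w)) a b.

Lemma bracket_ent w b : is_root w ->
  ent (pi (E w) * pi (Fv w)) b b - (-1) ^+ (wpar w) * ent (pi (Fv w) * pi (E w)) b b
  = sc w / z * (q ^ wform w (wt b) - q ^ (- wform w (wt b))).
Proof.
move=> rw; have [_ h] := sc_root rw.
have hl : pi (E w * Fv w - (-1) ^+ wpar w *: (Fv w * E w)) =
    pi (E w) * pi (Fv w) - (-1) ^+ wpar w *: (pi (Fv w) * pi (E w)).
  exact: (pi_bracketE pi_V).
have hr : pi ((sc w / z) *: (Uq_K q w - Uq_K q (- w))) =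
    (sc w / z) *: (pi (Uq_K q w) - pi (Uq_K q (- w))).
  by rewrite piZ piB.
have := congr1 (fun A : op F (V n) => ent A b b) (etrans (esym hl) (etrans (congr1 pi h) hr)).
rewrite /= entD entN entZ => ->.
by rewrite entZ !(pi_Uq_K q_neq0 pi_V) entD entN !ent_mkop eqxx !mul1r wformNl.
Qed.

Lemma homE w : is_root w -> wt_hom w (pi (E w)).
Proof. by move=> /(root_coef q_neq0 s_normal EF_root pi_V) []. Qed.

Lemma homF w : is_root w -> wt_hom (- w) (pi (Fv w)).
Proof. by move=> /(root_coef q_neq0 s_normal EF_root pi_V) []. Qed.

Lemma cE_rho w a b : pair_of w a b -> cE w a b = rho a b * cE w (dual b) (dual a).
Proof.
move=> h; have [_ _] := root_coef q_neq0 s_normal EF_root pi_V (pair_root h).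
exact.
Qed.

(** The root vector [E w] cannot raise [v_b] any further, so the diagonal entry at [b] of the
    bracket relation has the single term [E F]. *)
Lemma sc_mul w a b : pair_of w a b -> b != mid -> cE w a b * dF w a b = sc w.
Proof.
move=> h nb; have rw := pair_root h; have := bracket_ent b rw.
have [hb ha] := pair_wform h.
have e1 : wt a = wt b + - w by case: h => _ _ ->; rewrite opprB addrC subrK.
rewrite (ent_homM _ _ (homF rw) e1) (ent_homM0 _ _ (homE rw)); last first.
  move=> m; apply/eqP => em; have [_] := pair_wform (pair_of_root rw em).
  by rewrite hb nb.
rewrite hb nb mulr0 subr0 => ->.
by rewrite -invr_expz expr1z divfK ?z_neq0.
Qed.

Lemma wpar_short w b : pair_of w mid b -> wpar w.
Proof.
move=> h; have rw := pair_root h; rewrite wpar_root // (pair_norm h) !wt_norm eqxx.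
by rewrite (pair_neq h).
Qed.

(** At [v_0] the Cartan part vanishes, and the two terms of the anticommutator of the odd vectors
    [E w] and [Fv w] are opposite. *)
Lemma sc_mul_mid w b : pair_of w mid b ->
  cE w (dual b) mid * dF w (dual b) mid = - sc w.
Proof.
move=> h; have rw := pair_root h; have := bracket_ent mid rw.
have nb := pair_neq h.
have ew : w = wt b by case: h => _ _ ->; rewrite wt_mid subr0.
have e1 : wt (dual b) = wt mid + - w by rewrite wt_mid add0r ew wt_dual.
have e2 : wt b = wt mid + w by rewrite wt_mid add0r ew.
rewrite (ent_homM _ _ (homF rw) e1) (ent_homM _ _ (homE rw) e2).
rewrite wt_mid wformC wform0l oppr0 subrr mulr0 (wpar_short h) expr1 mulN1r opprK.
by rewrite [X in _ + X]mulrC -/(cE w mid b) -/(dF w mid b) (sc_mul h nb) => /eqP; rewrite addr_eq0 => /eqP.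
Qed.

Definition XR w : op F VV :=
  ((-1) ^+ (wpar w) * (sc w)^-1 * z) *: tens (pi (E w)) (pi (Fv w)).

Lemma ent_XR w (y x : VV) : ent (XR w) y x =
  (-1) ^+ (wpar w) * (sc w)^-1 * z *
   ((-1) ^+ ((spar y.2 (+) spar x.2) && spar x.1) * (cE w x.1 y.1 * dF w y.2 x.2)).
Proof. by rewrite entZ ent_tens. Qed.

Lemma XR_hom w (y x : VV) : is_root w -> ent (XR w) y x != 0 ->
  wt y.1 = wt x.1 + w /\ wt y.2 = wt x.2 - w.
Proof.
move=> rw; rewrite ent_XR.
have [->|n1] := eqVneq (wt y.1) (wt x.1 + w); last first.
  by rewrite /cE (homE rw) // mul0r !mulr0 eqxx.
have [->//|n2] := eqVneq (wt y.2) (wt x.2 - w).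
by rewrite /dF (homF rw) // !mulr0 eqxx.
Qed.

Lemma sc_neq0 w : is_root w -> sc w != 0.
Proof. by case/sc_root. Qed.

(** The [F] entry belongs to the dual pair. The ratio [rho] moves the [E] entry to the same pair,
    and then the product of the two is fixed by the scalar, whatever the normalisation of the root
    vectors. *)
Lemma XR_zero w a b : pair_of w a b ->
  ent (XR w) (b, dual b) (a, dual a) = z * rho a b.
Proof.
move=> h; have rw := pair_root h; have s0 := sc_neq0 rw.
rewrite ent_XR /= (cE_rho h) !label_eq0 !dual_neq_mid.
have [ea|na] := eqVneq a mid.
  rewrite ea in h *; rewrite !andbF expr0 (wpar_short h) dual_mid.
  transitivity (z * rho mid b * (- (sc w)^-1 *
      (cE w (dual b) mid * dF w (dual b) mid))); first by rewrite /=; ring.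
  by rewrite (sc_mul_mid h); field; rewrite ?s0 ?q_neq0.
have nda : dual a != mid by rewrite dual_neq_mid.
have hm := sc_mul (pair_dual h) nda; rewrite -hm in s0 *.
have [eb|nb] := eqVneq b mid.
  have hw : wpar w by have := pair_dual h; rewrite eb dual_mid => /wpar_short.
  rewrite hw /= expr1; move: s0; set c := cE _ _ _; set d := dF _ _ _ => s0.
  have [c0 d0] : c != 0 /\ d != 0 by move: s0; rewrite mulf_eq0 negb_or => /andP.
  by field; rewrite ?c0 ?d0 ?q_neq0.
have hw : wpar w = false.
  by rewrite wpar_root // (pair_norm h) !wt_norm na nb.
rewrite hw /= expr0; move: s0; set c := cE _ _ _; set d := dF _ _ _ => s0.
have [c0 d0] : c != 0 /\ d != 0 by move: s0; rewrite mulf_eq0 negb_or => /andP.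
by field; rewrite ?c0 ?d0 ?q_neq0.
Qed.

Lemma XR_swap w a b : pair_of w a b ->
  ent (XR w) (b, a) (a, b) = z * eta a b.
Proof.
move=> h; have rw := pair_root h; have s0 := sc_neq0 rw.
rewrite ent_XR /= !label_eq0 /eta.
have [eb|nb] := eqVneq b mid.
  have na : a != mid by rewrite -eb eq_sym (pair_neq h).
  have h' := pair_dual h; rewrite eb dual_mid in h'.
  have hm := sc_mul_mid h'; rewrite dualK in hm.
  rewrite (wpar_short h') na orbT /= eb.
  transitivity ((sc w)^-1 * z * (cE w a mid * dF w a mid)); first by ring.
  by rewrite hm; field; rewrite ?s0 ?q_neq0.
have hm := sc_mul h nb.
have [ea|na] := eqVneq a mid.
  rewrite ea in h hm *; rewrite (wpar_short h) /= hm; by field; rewrite ?s0 ?q_neq0.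
have hw : wpar w = false.
  by rewrite wpar_root // (pair_norm h) !wt_norm na nb.
by rewrite hw /= hm; field; rewrite ?s0 ?q_neq0.
Qed.

Lemma rho_mid a b w : pair_of w a mid -> b = dual a -> rho mid b * rho a mid = 1.
Proof.
move=> h ->; have h' := pair_dual h; rewrite dual_mid in h'.
have e1 := cE_rho h; have e2 := cE_rho h'.
rewrite dualK dual_mid in e2; rewrite dual_mid in e1.
have nda := pair_neq h'.
have c0 : cE w mid (dual a) != 0.
  have := sc_neq0 (pair_root h'); rewrite -(sc_mul h' nda) mulf_eq0 negb_or.
  by case/andP.
apply: (mulIf c0); rewrite mul1r -mulrA -e1.
by rewrite -e2.
Qed.

Lemma XR2_hom w (y x : VV) : is_root w -> ent (XR w * XR w) y x != 0 ->
  wt y.1 = wt x.1 + (w + w) /\ wt y.2 = wt x.2 - (w + w).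
Proof.
move=> rw; rewrite entM => h.
have [/existsP [m hm]|] := boolP [exists m : VV, ent (XR w) y m * ent (XR w) m x != 0].
  move: hm; rewrite mulf_eq0 negb_or => /andP [/(XR_hom rw) [-> ->] /(XR_hom rw) [-> ->]].
  by rewrite addrA opprD addrA.
rewrite negb_exists => /forallP h0; case/eqP: h; apply: big1 => m _.
by apply/eqP; have := h0 m; rewrite negbK.
Qed.

Lemma XR3 w : is_root w -> XR w ^+ 3 = 0.
Proof.
move=> rw; apply: opP => y x; rewrite ent0 exprS expr2 entM big1 // => m _.
have [->|/(XR_hom rw) [h1 _]] := eqVneq (ent (XR w) y m) 0; first by rewrite mul0r.
have [->|/(XR2_hom rw) [h2 _]] := eqVneq (ent (XR w * XR w) m x) 0; first by rewrite mulr0.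
by have /eqP [] := triple_root x.1 y.1 rw; rewrite h1 h2 -!addrA.
Qed.

(** The base is [- q^-1] for a short root, so [[2]!] is [1 - q^-1]. The value of [c] matters only
    there: by [double_root] the square of the exponent acts only for short roots, from
    [v_a (x) v_(a dual)] to its mirror image. *)
Lemma RrootE w : is_root w -> exists c : F,
  Rroot E Fv sc pi w = 1 + XR w + c *: (XR w * XR w) /\
  (wform w w = 1 -> c = (1 - q^-1)^-1).
Proof.
move=> rw; rewrite /Rroot -/(XR w) (qexp3 _ (XR3 rw)); eexists; split.
  congr (_ + _ + _).
  rewrite /qfact big_nat1 expr1 divff ?invr1 ?scale1r //.
  rewrite subr_eq0 eq_sym wpar_root // /qwt.
  have [->|->] := root_norm rw.
    rewrite eqxx !expr1 expr1z mulN1r; apply/eqP => e.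
    by move/eqP: qp1_neq0; apply; rewrite -[q]invrK -[q^-1]opprK e invrN1 addNr.
  rewrite mul1r; apply: contra q2_neq1 => /eqP e.
  by rewrite -[q ^+ 2]invrK -[(q ^+ 2)^-1]/((q ^ 2)^-1) e invr1.
move=> nw; congr (_^-1); rewrite /qfact big_nat_recr //= big_nat1 !expr1 wpar_root //.
rewrite /qwt nw eqxx expr1z expr1 mulN1r.
have h : 1 - - q^-1 != 0.
  rewrite opprK; have -> : 1 + q^-1 = (q + 1) / q by field.
  by rewrite mulf_neq0 ?invr_eq0 ?qp1_neq0.
rewrite divff // mul1r sqrrN; rewrite opprK in h *.
have -> : 1 - q^-1 ^+ 2 = (1 - q^-1) * (1 + q^-1) by ring.
by rewrite mulfK.
Qed.

Lemma Rroot_zero w (y : VV) a : is_root w ->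
  ent (Rroot E Fv sc pi w) y (a, dual a) = (y.2 == dual y.1)%:R * ZZ q s w y.1 a.
Proof.
move=> rw; have [c [-> hc]] := RrootE rw; rewrite !entD (entZ c) ent1.
case: y => b d /=; rewrite xpair_eqE.
have [->|nd] := eqVneq d (dual b); last first.
  rewrite mul0r.
  have -> : (b == a) && (d == dual a) = false.
    by apply/negP => /andP [/eqP e /eqP]; rewrite -e; apply/eqP.
  have [->|/(XR_hom rw) /= [e1 e2]] := eqVneq (ent (XR w) (b, d) (a, dual a)) 0; last first.
    by case/eqP: nd; apply: wt_inj; rewrite e2 !wt_dual e1 [RHS]opprD.
  have [->|/(XR2_hom rw) /= [e1 e2]] := eqVneq (ent (XR w * XR w) (b, d) (a, dual a)) 0.
    by rewrite mulr0 !addr0.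
  by case/eqP: nd; apply: wt_inj; rewrite e2 !wt_dual e1 [RHS]opprD.
rewrite mul1r /ZZ dual_eq andbb; congr (_ + _ + _).
  have [e|ne] := eqVneq (wt b) (wt a + w).
    by rewrite mul1r; apply: XR_zero; apply: pair_of_root.
  rewrite mul0r; apply/eqP; apply: contraNT ne => /(XR_hom rw) /= [-> _]; exact: eqxx.
have [/andP [/eqP eb /eqP ew]|ne] := boolP ((b == dual a) && (wt b == w)); last first.
  rewrite mul0r; apply/eqP; rewrite mulf_eq0 orbC.
  apply: contraNT ne; rewrite negb_or => /andP [/(XR2_hom rw) /= [e _] _].
  by have [-> ->] := double_root rw e; rewrite !eqxx.
rewrite mul1r eb.
have h : pair_of w a mid.
  by apply: pair_of_root => //; rewrite wt_mid -ew eb wt_dual subrr.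
have h' := pair_dual h; rewrite dual_mid in h'.
have nw : wform w w = 1.
  by rewrite (pair_norm h) !wt_norm eqxx eq_sym (pair_neq h).
rewrite (hc nw) entM (bigD1 (mid, mid)) //= big1 ?addr0; last first.
  move=> m nm; have [->|] := eqVneq (ent (XR w) m (a, dual a)) 0; first by rewrite mulr0.
  move/(XR_hom rw) => /= [e1 e2]; case/eqP: nm; case: m e1 e2 => m1 m2 /= e1 e2.
  congr pair; apply: wt_inj.
    by rewrite e1 wt_mid -ew eb wt_dual subrr.
  by rewrite e2 wt_mid -ew eb subrr.
have := XR_zero h; have := XR_zero h'; rewrite dualK dual_mid => -> ->.
(* The only path of the square goes through [v_0 (x) v_0]; its coefficient is
   [z^2 / (1 - q^-1) = z (q + 1)]. *)
transitivity ((1 - q^-1)^-1 * z ^+ 2 * (rho mid (dual a) * rho a mid)); first by ring.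
rewrite (rho_mid h) // mulr1.
have q1 := qm1_neq0.
have -> : 1 - q^-1 = (q - 1) / q by field.
by field; rewrite ?q1 ?q_neq0.
Qed.

(** Off the zero weight space the total weight determines the two labels up to order, by
    [wt_pair_eq], so a root factor can only keep or exchange them. *)
Lemma Rroot_nonzero w (y x : VV) : is_root w -> x.2 != dual x.1 ->
  ent (Rroot E Fv sc pi w) y x = (y == x)%:R +
    ((y == (x.2, x.1)) && (wt x.2 == wt x.1 + w))%:R * (z * eta x.1 x.2).
Proof.
move=> rw nx; have [c [-> _]] := RrootE rw; rewrite !entD (entZ c) ent1.
have -> : ent (XR w * XR w) y x = 0.
  apply/eqP; apply: contraNT nx => /(XR2_hom rw) [e1 e2].
  have [h1 h2] := double_root rw e1.
  have e3 : wt x.2 = wt y.2 + (w + w) by rewrite e2 subrK.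
  have [_ h4] := double_root rw e3.
  by rewrite -h1 -(inj_eq (@wt_inj n)) h2 h4.
rewrite mulr0 addr0; congr (_ + _).
case: x nx => a b /= nx; case: y => y1 y2.
have [/andP [/eqP [-> ->] /eqP e]|ne] := boolP (_ && _).
  by rewrite mul1r; apply: XR_swap; apply: pair_of_root.
rewrite mul0r; apply/eqP; apply: contraNT ne => /(XR_hom rw) /= [e1 e2].
have es : wt y1 + wt y2 = wt a + wt b.
  by rewrite e1 e2 addrACA subrr addr0.
case/orP: (wt_pair_eq nx es) => /andP [/eqP h1 /eqP h2].
  have w0 : w = 0.
    by apply: (@addrI _ (wt a)); rewrite -e1 h1 addr0.
  by have := root_norm rw; rewrite w0 wform0l; lia.
by rewrite h1 h2 eqxx /= -e1 h1.
Qed.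

End RootMatrix.

(** * The closed form of the braiding *)

Section Braiding.
Variables (F : fieldType) (n : nat) (q : F).
Hypothesis q_neq0 : q != 0.
Implicit Types (a b c d m : V n).
Local Notation z := (q - q^-1).
Local Notation mid := (mid n).
Local Notation VV := (tens_space (V n) (V n)).
Local Notation t := (- q^-1).

(** The coefficients of the invariant vector [sum_c lw c v_(c dual) (x) v_c]. Each step up
    multiplies by [- q^-1], except for the steps into and out of [mid], whose factors are -1 and
    [q^-1]. *)
Definition lw (b : V n) : F :=
  if (pos b < n)%N then t ^+ pos b
  else if b == mid then - t ^+ n.-1 else t ^+ (pos b).-1.

(** Minus the braiding in closed form; neither the normal ordering nor the root vectors occur in it,
    see [RcheckE]. *)
Definition gent (y x : VV) : F :=
  - (-1) ^+ (spar x.1 && spar x.2) * q ^ wform (wt x.1) (wt x.2)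
      * (y == (x.2, x.1))%:R
  + z * (pos x.1 < pos x.2)%N%:R * (y == x)%:R
  - z * (lw y.2 / lw x.1) * (pos x.1 < pos y.2)%N%:R
      * ((x.2 == dual x.1) && (y.1 == dual y.2))%:R.

Definition gop : op F VV := @mkop F VV gent.

Lemma t_neq0 : t != 0.
Proof. by rewrite oppr_eq0 invr_eq0. Qed.

Lemma lw_neq0 b : lw b != 0.
Proof.
rewrite /lw; case: ifP => _; first exact: expf_neq0 t_neq0.
by case: ifP => _; rewrite ?oppr_eq0 expf_neq0 ?t_neq0.
Qed.

Lemma ent_swapE (A : op F VV) (y x : VV) :
  ent (swap F n * Ecal n q * A) y x =
  (-1) ^+ (spar y.1 && spar y.2) * q ^ wform (wt y.2) (wt y.1) * ent A (y.2, y.1) x.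
Proof.
rewrite -mulrA entM (bigD1 (y.2, y.1)) //= big1 ?addr0; last first.
  move=> m nm; rewrite /swap ent_mkop.
  have -> : (y.1 == m.2) && (y.2 == m.1) = false.
    by apply: contraNF nm => /andP [/eqP -> /eqP ->]; case: m.
  by rewrite !mul0r.
rewrite /swap ent_mkop /= !eqxx mul1r entM (bigD1 (y.2, y.1)) //= big1 ?addr0.
  by rewrite /Ecal ent_mkop eqxx mul1r mulrA /qwt andbC.
by move=> m nm; rewrite /Ecal ent_mkop eq_sym (negbTE nm) !mul0r.
Qed.

Section Product.
Variable s : seq (weight n).
Hypothesis q2_neq1 : q ^+ 2 != 1.
Hypothesis s_normal : normal_ordering s.
Variables (E Fv : weight n -> Uq n q).
Hypothesis EF_root : root_vectors s E Fv.
Variable sc : weight n -> F.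
Hypothesis sc_root : root_scalars E Fv sc.
Variable pi : {linear Uq n q -> op F (V n)}.
Hypothesis pi_V : affords_V pi.

Local Notation Rroot := (Rroot E Fv sc pi).
Local Notation idx := (idx s).

Lemma nth_root k : (k < size s)%N -> is_root (nth 0 s k) /\ idx (nth 0 s k) = k.
Proof.
move=> hk; case: s_normal => us hs _.
by rewrite -hs mem_nth //; split=> //; apply: index_uniq.
Qed.

Lemma prod_rootS k : (k < size s)%N ->
  \prod_(w <- take k.+1 s) Rroot w = (\prod_(w <- take k s) Rroot w) * Rroot (nth 0 s k).
Proof.
by move=> hk; rewrite (take_nth 0 hk) -cats1 big_cat big_seq1.
Qed.

Lemma prod_root_zero k (y : VV) a : (k <= size s)%N ->
  ent (\prod_(w <- take k s) Rroot w) y (a, dual a) =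
  (y.2 == dual y.1)%:R * MM q s k y.1 a.
Proof.
elim: k y a => [|k IH] y a hk.
  rewrite take0 big_nil ent1 /MM andbF; case: y => c d /=; rewrite xpair_eqE.
  have [->|] := eqVneq c a; first by rewrite mulr1.
  by rewrite mulr0.
have [rw iw] := nth_root hk.
rewrite prod_rootS // entM (MM_step q_neq0 s_normal rw iw) mulr_sumr.
have hR (m : VV) := Rroot_zero q_neq0 q2_neq1 s_normal EF_root sc_root pi_V m a rw.
pose f b d : F := ent (\prod_(w <- take k s) Rroot w) y (b, d) *
   ((d == dual b)%:R * ZZ q s (nth 0 s k) b a).
transitivity (\sum_(m : VV) f m.1 m.2).
  by apply: eq_bigr => -[b d] _; congr (_ * _); apply: hR.
rewrite -(pair_bigA _ f) /=; apply: eq_bigr => b _.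
rewrite (sum_delta (fun d => ent (\prod_(w <- take k s) Rroot w) y (b, d))
  (fun=> ZZ q s (nth 0 s k) b a) (b := dual b)) //.
by rewrite IH 1?ltnW // mulrA.
Qed.

Lemma prod_root_nonzero k (y x : VV) : (k <= size s)%N -> x.2 != dual x.1 ->
  ent (\prod_(w <- take k s) Rroot w) y x = (y == x)%:R +
  [&& y == (x.2, x.1), (pos x.1 < pos x.2)%N & (idx (gam x.1 x.2) < k)%N]%:R
    * (z * eta F x.1 x.2).
Proof.
elim: k y x => [|k IH] y x hk nx.
  by rewrite take0 big_nil ent1 !andbF mul0r addr0.
have [rw iw] := nth_root hk.
rewrite prod_rootS // entM; set w := nth 0 s k in rw iw *.
pose T := \prod_(u <- take k s) Rroot u.
transitivity (\sum_(u : VV) (ent T y u * (u == x)%:R + ent T y u *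
   (((u == (x.2, x.1)) && (wt x.2 == wt x.1 + w))%:R * (z * eta F x.1 x.2)))).
  apply: eq_bigr => u _; rewrite -mulrDr; congr (_ * _).
  exact: (Rroot_nonzero q_neq0 q2_neq1 s_normal EF_root sc_root pi_V).
rewrite big_split /= (bigD1 x) //= eqxx mulr1 big1 ?addr0; last first.
  by move=> u nu; rewrite (negbTE nu) mulr0.
rewrite (bigD1 (x.2, x.1)) //= eqxx /= big1 ?addr0; last first.
  by move=> u nu; rewrite (negbTE nu) mul0r mulr0.
have hk' := ltnW hk; have nx' : x.1 != dual x.2 by rewrite eq_dual.
rewrite /T !IH //=.
have [e|ne] := eqVneq (wt x.2) (wt x.1 + w).
  have h := pair_of_root rw e; have [lt _ _] := h.
  rewrite (pair_gam h) iw ltnn ltnSn !andbF !andbT lt (ltnNge (pos x.2)) ltnW //=.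
  by rewrite /= ?andbF andbT /=; ring.
rewrite mul0r mulr0 addr0; congr (_ + _%:R * _); congr (_ && _).
have [lt|//] := ltnP (pos x.1) (pos x.2) => /=.
have nk : idx (gam x.1 x.2) <> k.
  move=> e2; case/eqP: ne.
  have := idx_gam s_normal iw lt e2; rewrite gamE // => <-.
  by rewrite addrC subrK.
by move: nk; move: (idx (gam x.1 x.2)) => i; clear; lia.
Qed.

Lemma idx_size a c : (pos a < pos c)%N -> (idx (gam a c) < size s)%N.
Proof.
move=> h; rewrite index_mem; case: s_normal => _ -> _; exact: gam_root.
Qed.

(** Every root has been passed, so each label strictly between, except [mid], contributes
    [- q^-1]. *)
Lemma PI_all a c : (pos a < pos c)%N ->
  PI q s (size s) a c = t ^+ (pos c - pos a - 1 - (pos a < n < pos c)).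
Proof.
have [k] := ubnP (pos c); elim: k c => // k IH c hk ac.
have [e|ne] := eqVneq (pos c) (pos a).+1.
  rewrite PI_adj ?e // subSn // subnn.
  by rewrite subnn sub0n expr0.
have lc := pos_le c; have lb : ((pos c).-1 <= 2 * n)%N by lia.
pose b := vx n (pos c).-1; have pb : pos b = (pos c).-1 by rewrite vxK.
have ab : (pos a < pos b)%N by lia.
have bc : (pos b < pos c)%N by lia.
rewrite /PI (prod_between _ ab bc) -/(PI q s (size s) a b) IH //; last by lia.
rewrite [X in _ * X]big_pred0 ?mulr1; last by move=> m; lia.
rewrite /theta idx_size //; have [eb|nb] := eqVneq b mid.
  have pn : pos b = n by rewrite eb pos_mid.
  by rewrite mulr1; congr (_ ^+ _); lia.
have pn : pos b != n by move: nb; rewrite -pos_eq pos_mid.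
by rewrite -exprSr; congr (_ ^+ _); lia.
Qed.

Lemma eta_PI_all a c : (pos a < pos c)%N ->
  eta F a c * PI q s (size s) a c * t * lw a = (if c == mid then t else 1) * lw c.
Proof.
move=> ac; rewrite PI_all //.
have ltE b : (b == mid) = (pos b == n) by rewrite -pos_eq pos_mid.
rewrite /eta /lw !ltE; move: (- q^-1) => u.
have [ha|ha|ha] := ltngtP (pos a) n; have [hc|hc|hc] := ltngtP (pos c) n;
  rewrite /= ?mul1r ?mulN1r ?mulNr ?mulrN ?opprK; try (exfalso; lia).
- by rewrite -exprSr -exprD; congr (_ ^+ _); lia.
- by rewrite -exprSr -exprD; congr (_ ^+ _); lia.
- by rewrite -exprSr -exprD -exprS; congr (- _ ^+ _); lia.
- by rewrite -exprSr -exprD; congr (_ ^+ _); lia.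
- by have lc := pos_le c; rewrite -exprSr -exprD; congr (_ ^+ _); lia.
Qed.

(** The term [extra] is gone, since it requires a root that has not been passed. *)
Lemma MM_all c a :
  MM q s (size s) c a = (c == a)%:R + (pos a < pos c)%N%:R *
   (z * ((if c == mid then 1 else t^-1) * (lw c / lw a)) + (c == dual a)%:R * (z * q)).
Proof.
have t0 := t_neq0.
have [->|ca] := eqVneq c a; first by rewrite MM_diag ltnn mul0r addr0.
have [ac|ac] := ltnP (pos a) (pos c); last first.
  by rewrite MM_low ?mul0r ?addr0 // negb_and -leqNgt ac.
rewrite MM_high ?idx_size // add0r mul1r /extra.
have -> : [&& (pos a < pos (dual c))%N, (pos (dual c) < pos mid)%N,
    (size s <= idx (gam a (dual c)))%N, (idx (gam a (dual a)) < size s)%N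
    & (idx (gam (dual c) c) < size s)%N] = false.
  apply/negP => /and5P [h _ h' _ _]; have := idx_size h.
  by rewrite ltnNge h'.
rewrite addr0; congr (_ * _ + _).
apply: (mulIf (lw_neq0 a)); apply: (mulIf t0).
rewrite mulrAC eta_PI_all //; have l0 := lw_neq0 a.
move: t0; move: (- q^-1) => u u0.
by case: (c == mid); field; rewrite ?l0 ?u0.
Qed.

Lemma q_wt_norm b : q ^ wform (wt b) (wt b) = if b == mid then 1 else q.
Proof. by rewrite wt_norm; case: eqP => _; rewrite ?expr0z ?expr1z. Qed.

Lemma RcheckE : - Rcheck s E Fv sc pi = gop.
Proof.
apply: opP => y x; rewrite entN ent_mkop /Rcheck ent_swapE /Rtilde.
have := @prod_root_zero (size s) (y.2, y.1); have := @prod_root_nonzero (size s) (y.2, y.1) x.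
rewrite take_size /= => hN hZ; rewrite /gent !spar_mid.
case: x hN => a d /= hN; case: y hZ hN => b c /= hZ hN.
have [ed|nd] := eqVneq d (dual a); last first.
  rewrite hN ?leqnn //= mulr0 subr0 !label_eq0.
  have hlt : (pos a < pos d)%N && (idx (gam a d) < size s)%N = (pos a < pos d)%N.
    by have [h|//] := ltnP (pos a) (pos d); rewrite idx_size.
  rewrite hlt.
  have -> : ((c, b) == (a, d) :> VV) = ((b, c) == (d, a) :> VV).
    by rewrite !xpair_eqE andbC.
  have -> : ((c, b) == (d, a) :> VV) = ((b, c) == (a, d) :> VV).
    by rewrite !xpair_eqE andbC.
  have [ebc|n1] := eqVneq ((b, c) : VV) (d, a); have [ebc'|n2] := eqVneq ((b, c) : VV) (a, d).
  - case: ebc ebc' => -> -> [ead _]; rewrite ead ltnn /= !(mulr0, mul0r, addr0, add0r).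
    by rewrite !mulNr.
  - by case: ebc => -> ->; rewrite andbC wformC /= !(mulr0, mul0r, addr0, mulr1, mulNr).
  - case: ebc' => -> ->; rewrite add0r mulr0 add0r !mulr1 /=.
    have [lt|_] := ltnP (pos a) (pos d); last by rewrite /= !(mulr0, mul0r, oppr0).
    rewrite wform_wt [d == dual a](negbTE nd).
    have -> : (d == a) = false by apply/eqP => e; rewrite e ltnn in lt.
    rewrite subrr expr0z /eta.
    have [ea|na] := eqVneq a mid; have [edm|ndm] := eqVneq d mid => /=; try ring.
  - by rewrite /=; rewrite !(mulr0, mul0r, addr0, add0r, oppr0).
rewrite ed hZ ?leqnn // MM_all /= !label_eq0.
have [eb|nb] := eqVneq b (dual c); last first.
  have [[e1 e2]|_] := eqVneq ((b, c) : VV) (dual a, a).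
    by rewrite e1 e2 eqxx in nb.
  have [[e1 e2]|_] := eqVneq ((b, c) : VV) (a, dual a).
    by rewrite e1 e2 dualK eqxx in nb.
  by rewrite /=; rewrite !(mulr0, mul0r, addr0, add0r, oppr0).
rewrite eb !wt_dual !wformNr -!invr_expz !q_wt_norm !dual_neq_mid !andbb.
have -> : ((dual c, c) == (dual a, a) :> VV) = (c == a).
  by rewrite xpair_eqE dual_eq andbb.
have -> : ((dual c, c) == (a, dual a) :> VV) = (c == dual a).
  by rewrite xpair_eqE -(dual_eq (dual c)) dualK andbb.
have -> : z * (pos a < pos (dual a))%:R * (c == dual a)%:R =
    z * ((pos a < pos c)%N%:R * (c == dual a)%:R) :> F.
  by case: (eqVneq c (dual a)) => [->|_]; rewrite ?mulr0 // !mulr1.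
have hca : - (-1) ^+ (a != mid) * (if a == mid then 1 else q)^-1 * (c == a)%:R =
    - (-1) ^+ (c != mid) * (if c == mid then 1 else q)^-1 * (c == a)%:R :> F.
  by case: (eqVneq c a) => [->|_]; rewrite ?mulr0.
rewrite hca; have l0 := lw_neq0 a; have [ecm|ncm] := eqVneq c mid => /=.
  have -> : (pos a < pos c)%N%:R * (z * (1 * (lw c / lw a)) + (c == dual a)%:R * (z * q))
     = (pos a < pos c)%N%:R * z * (lw c / lw a) +
       (pos a < pos c)%N%:R * (c == dual a)%:R * (z * q) :> F by ring.
  have -> : (pos a < pos c)%N%:R * (c == dual a)%:R = 0 :> F.
    case: (eqVneq c (dual a)) => [e|_]; last by rewrite mulr0.
    have -> : a = c by rewrite -[a]dualK -e ecm dual_mid.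
    by rewrite ltnn mul0r.
  by rewrite invr1; ring.
move: (lw c / lw a) => l; rewrite invrN invrK.
by rewrite mul1r mulr1 expr1; field.
Qed.

End Product.
End Braiding.

(** * The braiding commutes with the quantum group *)

Section Columns.
Variable F : fieldType.

Definition bv (B : superspace) (x : B) : 'cV[F]_#|B| := delta_mx (enum_rank x) 0.

Lemma bvE (B : superspace) (x y : B) : bv x (enum_rank y) 0 = (y == x)%:R.
Proof. by rewrite mxE eqxx andbT (inj_eq enum_rank_inj). Qed.

Lemma op_bv (B : superspace) (A : op F B) x y :
  (A *m bv x) (enum_rank y) 0 = ent A y x.
Proof.
rewrite mxE (bigD1 (enum_rank x)) //= mxE !eqxx mulr1 big1 ?addr0 // => j nj.
by rewrite mxE (negbTE nj) mulr0.
Qed.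

Lemma cV_eq (B : superspace) (u v : 'cV[F]_#|B|) :
  (forall y : B, u (enum_rank y) 0 = v (enum_rank y) 0) -> u = v.
Proof. by move=> h; apply/colP => j; have := h (enum_val j); rewrite enum_valK. Qed.

Lemma op_bv_eq (B : superspace) (A A' : op F B) :
  (forall x, A *m bv x = A' *m bv x) -> A = A'.
Proof. by move=> h; apply: opP => y x; rewrite -!op_bv h. Qed.

Lemma cvZ m (k : F) (v : 'cV[F]_m) j : (k *: v) j 0 = k * v j 0.
Proof. by rewrite mxE. Qed.

Lemma tens_bv (B C : superspace) (A : op F B) (A' : op F C) (a a' : B) (d d' : C)
    (k l : F) :
  A *m bv a = k *: bv a' -> A' *m bv d = l *: bv d' ->
  tens A A' *m bv ((a, d) : tens_space B C) =
  ((-1) ^+ ((spar d' (+) spar d) && spar a) * k * l)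
    *: bv ((a', d') : tens_space B C).
Proof.
move=> hA hA'; apply: cV_eq => -[y1 y2]; rewrite op_bv ent_tens cvZ bvE /=.
rewrite -op_bv hA -op_bv hA' !cvZ !bvE xpair_eqE.
case: (eqVneq y1 a') => [_|_]; last by rewrite /= mulr0 mul0r !mulr0.
case: (eqVneq y2 d') => [->|_]; last by rewrite /= !mulr0.
by rewrite /= !mulr1 mulrA.
Qed.

End Columns.

(** * The generators acting on two tensor factors *)

Section Generators.
Variables (F : fieldType) (n : nat) (q : F) (i : 'I_n).
Implicit Types (a b c d m : V n).
Local Notation z := (q - q^-1).
Local Notation t := (- q^-1).
Local Notation mid := (mid n).
Local Notation V := (V n).
Local Notation VV := (tens_space V V).
Local Notation bv2 a d := (@bv F VV (a, d)).
Local Notation gop := (@gop F n q).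
Local Notation lw := (@lw F n q).

(** The tail of the invariant vector beyond [a]; it carries the third summand of the braiding on
    [v_a (x) v_(a dual)]. *)
Definition Om a : 'cV[F]_#|VV| :=
  \sum_(c : V) (pos a < pos c)%N%:R *: (lw c *: bv2 (dual c) c).

Definition sg a d : F := - (-1) ^+ ((a != mid) && (d != mid)) * q ^ wform (wt a) (wt d).

Lemma gop_bv a d : gop *m bv2 a d =
  sg a d *: bv2 d a + (z * (pos a < pos d)%N%:R) *: bv2 a d
  - (z / lw a * (d == dual a)%:R) *: Om a.
Proof.
apply: cV_eq => -[y1 y2]; rewrite op_bv ent_mkop /gent /sg !spar_mid /=.
rewrite !mxE !eqxx !andbT !(inj_eq enum_rank_inj); congr (_ + _ - _).
rewrite summxE /=.
have -> : \sum_(c : V) ((pos a < pos c)%N%:R *: (lw c *: bv2 (dual c) c))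
    (enum_rank ((y1, y2) : VV)) 0 =
    \sum_(c : V) ((y1 == dual y2)%:R * (pos a < pos c)%N%:R * lw c) * (c == y2)%:R.
  apply: eq_bigr => c _; rewrite !mxE eqxx andbT (inj_eq enum_rank_inj) xpair_eqE.
  rewrite [y2 == c]eq_sym; case: (eqVneq c y2) => [->|_]; rewrite ?andbT ?andbF ?mulr0 //.
  by rewrite !mulr1; ring.
rewrite (sum_delta1 (fun c => (y1 == dual y2)%:R * (pos a < pos c)%N%:R * lw c)).
case: (d == dual a) => /=; first by rewrite mulr1; ring.
by rewrite !mulr0 mul0r.
Qed.

Let p := lowpos i.
(** The generator of index [i] moves vectors of only four labels: raising takes [lP1] to [lP2] and,
    on the dual side, [N1] to [N2]. For the odd generator [lP1] and [N2] are both [mid]. *)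
Definition lP1 : V := vx n (lowpos i).
Definition lP2 : V := vx n (lowpos i).+1.
Local Notation P1 := lP1.
Local Notation P2 := lP2.
Local Notation N1 := (dual lP2).
Local Notation N2 := (dual lP1).
Local Notation e := (V_action q (GE, i)).
Local Notation f := (V_action q (GF, i)).
Local Notation K := (V_action q (GK, i)).
Local Notation KV := (V_action q (GKV, i)).
Local Notation eps := (esign F i).

Lemma pos_P : pos P1 = p /\ pos P2 = p.+1.
Proof. by have h := lowposE i; rewrite !vxK; [|lia|lia]. Qed.

Lemma pos_N : pos N1 = (2 * n - p.+1)%N /\ pos N2 = (2 * n - p)%N.
Proof. by rewrite !pos_dual; have [-> ->] := pos_P. Qed.

Definition up a : V := vx n (pos a).+1.
Definition dn a : V := vx n (pos a).-1.
Definition eE a : F := (a == P1)%:R + eps * (a == N1)%:R.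
Definition fE a : F := (a == P2)%:R + (a == N2)%:R.
Definition kap a : F := q ^ ((a == P2)%:R - (a == N1)%:R - (a == P1)%:R + (a == N2)%:R : int).

Lemma e_bv a : e *m bv F a = eE a *: bv F (up a).
Proof.
have hl := lowposE i; have [p1 p2] := pos_P; have [p3 p4] := pos_N.
apply: cV_eq => y; rewrite op_bv ent_VE cvZ bvE /eE -!pos_eq p1 p3 /up.
have [e1|n1] := eqVneq (pos a) p; have [e2|n2] := eqVneq (pos a) (2 * n - p.+1)%N.
- by exfalso; move: e1 e2 hl; rewrite -/p; lia.
- by rewrite e1 vxK ?eqxx -/p /= ?mulr0 ?addr0 ?mul1r //; lia.
- have hp : (2 * n - p = (2 * n - p.+1).+1)%N by rewrite /p; lia.
  by rewrite e2 vxK -?hp -/p /=; [ring|rewrite /p; lia].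
- by rewrite /=; ring.
Qed.

Lemma f_bv a : f *m bv F a = fE a *: bv F (dn a).
Proof.
have hl := lowposE i; have [p1 p2] := pos_P; have [p3 p4] := pos_N.
apply: cV_eq => y; rewrite op_bv ent_VF cvZ bvE /fE -!pos_eq p2 p4 /dn.
have [e1|n1] := eqVneq (pos a) p.+1; have [e2|n2] := eqVneq (pos a) (2 * n - p)%N.
- by exfalso; move: e1 e2 hl; rewrite -/p; lia.
- by rewrite e1 vxK -/p /= ?addr0 ?mul1r //; rewrite /p; lia.
- have hp : (2 * n - p.+1 = (2 * n - p).-1)%N by rewrite /p; lia.
  by rewrite e2 vxK -?hp -/p /=; [ring|rewrite /p; lia].
- by rewrite /=; ring.
Qed.

Lemma kapE a : kap a = q ^ wform (alpha i) (wt a).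
Proof.
rewrite /kap alphaE -/P1 -/P2 !wformE !wform_wt; congr (q ^ _).
by rewrite (eq_dual P1) (eq_dual P2) (eq_sym P1) (eq_sym P2); ring.
Qed.

Lemma K_bv a : K *m bv F a = kap a *: bv F a.
Proof.
apply: cV_eq => y; rewrite op_bv ent_mkop cvZ bvE kapE /qwt mulrC.
by [].
Qed.

Lemma KV_bv a : KV *m bv F a = (kap a)^-1 *: bv F a.
Proof.
by apply: cV_eq => y; rewrite op_bv ent_mkop cvZ bvE kapE /qwt mulrC.
Qed.

(** The sign of moving the generator past [v_a]: it is -1 only for the odd generator and an odd
    vector. *)
Definition gsg a : F := if (i.+1 < n)%N then 1 else if a == mid then 1 else -1.

Lemma spar_e a d : eE d != 0 -> (-1) ^+ ((spar (up d) (+) spar d) && spar a) = gsg a.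
Proof.
have hl := lowposE i; have [p1 p2] := pos_P; have [p3 p4] := pos_N.
have hm b : (b != mid) = (pos b != n) by rewrite -pos_eq pos_mid.
rewrite !spar_mid (hm (up d)) (hm d) /gsg /up => h.
have hd : pos d = p \/ pos d = (2 * n - p.+1)%N.
  move: h; rewrite /eE -!pos_eq p1 p3.
  have [h1|_] := eqVneq (pos d) p; first by left.
  by have [h2|_] := eqVneq (pos d) (2 * n - p.+1)%N; [right | rewrite mulr0 addr0 eqxx].
have hp : p = (2 * n - i.+1)%N by []; have hi := ltn_ord i.
rewrite vxK; last by case: hd => ->; rewrite /p; lia.
case: ifP => hin.
  have -> : ((pos d).+1 != n) (+) (pos d != n) = false by case: hd => ->; lia.
  by [].
have -> : ((pos d).+1 != n) (+) (pos d != n) = true by case: hd => ->; lia.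
by case: (a == mid).
Qed.

Lemma spar_f a d : fE d != 0 -> (-1) ^+ ((spar (dn d) (+) spar d) && spar a) = gsg a.
Proof.
have hl := lowposE i; have [p1 p2] := pos_P; have [p3 p4] := pos_N.
have hm b : (b != mid) = (pos b != n) by rewrite -pos_eq pos_mid.
rewrite !spar_mid (hm (dn d)) (hm d) /gsg /dn => h.
have hd : pos d = p.+1 \/ pos d = (2 * n - p)%N.
  move: h; rewrite /fE -!pos_eq p2 p4.
  have [h1|_] := eqVneq (pos d) p.+1; first by left.
  by have [h2|_] := eqVneq (pos d) (2 * n - p)%N; [right | rewrite addr0 eqxx].
have hp : p = (2 * n - i.+1)%N by []; have hi := ltn_ord i.
rewrite vxK; last by case: hd => ->; rewrite /p; lia.
case: ifP => hin.
  have -> : ((pos d).-1 != n) (+) (pos d != n) = false by case: hd => ->; lia.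
  by [].
have -> : ((pos d).-1 != n) (+) (pos d != n) = true by case: hd => ->; lia.
by case: (a == mid).
Qed.

Local Notation act := (coprod_action (V_action q) (V_action q)).
Local Notation De := (act (GE, i)).
Local Notation Df := (act (GF, i)).

Lemma one_bv (B : superspace) (x : B) : (1 : op F B) *m bv F x = 1 *: bv F x.
Proof. by rewrite scale1r; apply: mul1mx. Qed.

Lemma De_bv a d : De *m bv2 a d =
  (kap d * eE a) *: bv2 (up a) d + (gsg a * eE d) *: bv2 a (up d).
Proof.
rewrite /= mulmxDl (tens_bv (e_bv a) (K_bv d)) (tens_bv (one_bv a) (e_bv d)).
rewrite addbb expr0 mul1r [eE a * _]mulrC mulr1; congr (_ + _ *: _).
have [->|/spar_e ->//] := eqVneq (eE d) 0; by rewrite !mulr0.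
Qed.

Lemma Df_bv a d : Df *m bv2 a d =
  fE a *: bv2 (dn a) d + ((kap a)^-1 * gsg a * fE d) *: bv2 a (dn d).
Proof.
rewrite /= mulmxDl (tens_bv (f_bv a) (one_bv d)) (tens_bv (KV_bv a) (f_bv d)).
rewrite addbb expr0 mul1r mulr1; congr (_ + _ *: _).
have [->|/spar_f ->] := eqVneq (fE d) 0; first by rewrite !mulr0.
by rewrite [gsg a * _]mulrC.
Qed.

Lemma up_lP1 : up P1 = P2. Proof. by rewrite /up; have [-> _] := pos_P. Qed.

Lemma up_N1 : up N1 = N2.
Proof.
have hl := lowposE i; apply: pos_inj; have [p3 p4] := pos_N; rewrite /up p3 p4 vxK.
  by rewrite /p; lia.
by rewrite /p; lia.
Qed.

Lemma dn_lP2 : dn P2 = P1. Proof. by rewrite /dn; have [_ ->] := pos_P. Qed.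

Lemma dn_N2 : dn N2 = N1.
Proof.
have hl := lowposE i; apply: pos_inj; have [p3 p4] := pos_N; rewrite /dn p3 p4 vxK.
  by rewrite /p; lia.
by rewrite /p; lia.
Qed.

Lemma mulmx_Om (A : op F VV) a : A *m Om a =
  \sum_(c : V) (pos a < pos c)%N%:R *: (lw c *: (A *m bv2 (dual c) c)).
Proof.
by rewrite mulmx_sumr; apply: eq_bigr => c _; rewrite -!scalemxAr.
Qed.

Lemma sum_bv_delta (g : V -> F) (h : V -> V * V) b :
  \sum_(c : V) (g c * (c == b)%:R) *: @bv F VV (h c) = g b *: @bv F VV (h b).
Proof.
rewrite (bigD1 b) //= eqxx mulr1 big1 ?addr0 // => c nc.
by rewrite (negbTE nc) mulr0 scale0r.
Qed.

(** Only the four labels moved by the generator contribute to the sum. *)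
Lemma De_Om a : De *m Om a =
  ((pos a < pos N2)%N%:R * lw N2 * kap N2 + (pos a < pos N1)%N%:R * lw N1 * gsg P2 * eps)
     *: bv2 P2 N2
  + ((pos a < pos P2)%N%:R * lw P2 * kap P2 * eps + (pos a < pos P1)%N%:R * lw P1 * gsg N2)
     *: bv2 N2 P2.
Proof.
pose g c : F := (pos a < pos c)%N%:R * lw c.
rewrite mulmx_Om; transitivity
  (\sum_(c : V) (g c * kap c * (c == N2)%:R) *: bv2 P2 c
   + \sum_(c : V) (g c * kap c * eps * (c == P2)%:R) *: bv2 N2 c
   + \sum_(c : V) (g c * gsg (dual c) * (c == P1)%:R) *: bv2 (dual c) P2
   + \sum_(c : V) (g c * gsg (dual c) * eps * (c == N1)%:R) *: bv2 (dual c) N2).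
  rewrite -!big_split /=; apply: eq_bigr => c _.
  rewrite De_bv !scalerDr !scalerA -!addrA /g /eE !mulrDr.
  have -> : (dual c == P1) = (c == N2) by rewrite eq_sym eq_dual.
  have -> : (dual c == N1) = (c == P2) by rewrite dual_eq.
  rewrite !scalerDl -!addrA.
  have tr (x y : V) k l (u v : 'cV[F]_#|VV|) :
      k = l -> (x == y -> u = v) -> (k * (x == y)%:R) *: u = (l * (x == y)%:R) *: v.
    by move=> ->; case: (x == y) => h; [rewrite h | rewrite !mulr0 !scale0r].
  congr (_ + (_ + (_ + _))); rewrite ?mulrA; apply: tr => //; try ring.
  - by move=> /eqP ->; rewrite dualK up_lP1.
  - by move=> /eqP ->; rewrite up_N1.
  - by move=> /eqP ->; rewrite up_lP1.
  - by move=> /eqP ->; rewrite up_N1.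
rewrite (sum_bv_delta _ (fun c => (P2, c))) (sum_bv_delta _ (fun c => (N2, c))).
rewrite (sum_bv_delta _ (fun c => (dual c, P2))) (sum_bv_delta _ (fun c => (dual c, N2))).
rewrite !dualK /g !scalerDl.
by rewrite -!addrA; congr (_ + _); rewrite addrA addrC.
Qed.

Lemma Df_Om a : Df *m Om a =
  ((pos a < pos N1)%N%:R * lw N1 + (pos a < pos N2)%N%:R * lw N2 * (kap P1)^-1 * gsg P1)
     *: bv2 P1 N1
  + ((pos a < pos P1)%N%:R * lw P1 + (pos a < pos P2)%N%:R * lw P2 * (kap N1)^-1 * gsg N1)
     *: bv2 N1 P1.
Proof.
pose g c : F := (pos a < pos c)%N%:R * lw c.
rewrite mulmx_Om; transitivity
  (\sum_(c : V) (g c * (c == N1)%:R) *: bv2 P1 c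
   + \sum_(c : V) (g c * (c == P1)%:R) *: bv2 N1 c
   + \sum_(c : V) (g c * (kap (dual c))^-1 * gsg (dual c) * (c == P2)%:R) *: bv2 (dual c) P1
   + \sum_(c : V) (g c * (kap (dual c))^-1 * gsg (dual c) * (c == N2)%:R) *: bv2 (dual c) N1).
  rewrite -!big_split /=; apply: eq_bigr => c _.
  rewrite Df_bv !scalerDr !scalerA -!addrA /g /fE !mulrDr.
  have -> : (dual c == P2) = (c == N1) by rewrite eq_sym eq_dual.
  have -> : (dual c == N2) = (c == P1) by rewrite dual_eq.
  rewrite !scalerDl -!addrA.
  have tr (x y : V) k l (u v : 'cV[F]_#|VV|) :
      k = l -> (x == y -> u = v) -> (k * (x == y)%:R) *: u = (l * (x == y)%:R) *: v.
    by move=> ->; case: (x == y) => h; [rewrite h | rewrite !mulr0 !scale0r].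
  congr (_ + (_ + (_ + _))); rewrite ?mulrA; apply: tr => //; try ring.
  - by move=> /eqP ->; rewrite dualK dn_lP2.
  - by move=> /eqP ->; rewrite dn_N2.
  - by move=> /eqP ->; rewrite dn_lP2.
  - by move=> /eqP ->; rewrite dn_N2.
rewrite (sum_bv_delta _ (fun c => (P1, c))) (sum_bv_delta _ (fun c => (N1, c))).
rewrite (sum_bv_delta _ (fun c => (dual c, P1))) (sum_bv_delta _ (fun c => (dual c, N1))).
rewrite !dualK /g !scalerDl.
by rewrite -!addrA; congr (_ + _); rewrite addrA addrC.
Qed.

End Generators.

(** * The closed form commutes with each generator *)

Section Intertwine.
Variables (F : fieldType) (n : nat) (q : F) (i : 'I_n).
Hypothesis q_neq0 : q != 0.
Implicit Types (a b c d m o : V n).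
Local Notation z := (q - q^-1).
Local Notation t := (- q^-1).
Local Notation mid := (mid n).
Local Notation V := (V n).
Local Notation VV := (tens_space V V).
Local Notation bv2 a d := (@bv F VV (a, d)).
Local Notation gop := (@gop F n q).
Local Notation lw := (@lw F n q).
Local Notation P1 := (lP1 i).
Local Notation P2 := (lP2 i).
Local Notation N1 := (dual (lP2 i)).
Local Notation N2 := (dual (lP1 i)).
Local Notation act := (coprod_action (V_action q) (V_action q)).
Local Notation De := (act (GE, i)).
Local Notation Df := (act (GF, i)).
Local Notation eE := (@eE F n i).
Local Notation fE := (@fE F n i).
Local Notation kap := (@kap F n q i).
Local Notation gsg := (@gsg F n i).
Local Notation sg := (@sg F n q).
Local Notation Om := (@Om F n q).
Local Notation ltb a d := ((pos a < pos d)%N).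

Lemma Om_succ a b : pos b = (pos a).+1 -> Om a = lw b *: bv2 (dual b) b + Om b.
Proof.
move=> h; rewrite /Om (bigD1 b) //= [in RHS](bigD1 b) //= ltnn scale0r add0r.
rewrite h ltnSn scale1r; congr (_ + _).
apply: eq_bigr => c; rewrite -pos_eq h => nc.
by congr (_%:R *: _); rewrite [in RHS]ltn_neqAle eq_sym nc.
Qed.

Lemma sg_out a d : a != mid -> d != mid ->
  sg a d = q ^ ((a == d)%:R - (a == dual d)%:R : int).
Proof. by rewrite /sg wform_wt => -> ->; rewrite /= expr1 opprK mul1r. Qed.

Lemma sg_mid d : sg mid d = -1 /\ sg d mid = -1.
Proof.
by rewrite /sg wt_mid [wform _ 0]wformC !wform0l eqxx andbF expr0 mulr1.
Qed.

Lemma cvD (k : nat) (u v : 'cV[F]_k) j : (u + v) j 0 = u j 0 + v j 0.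
Proof. by rewrite mxE. Qed.

Lemma cvN (k : nat) (u : 'cV[F]_k) j : (- u) j 0 = - u j 0.
Proof. by rewrite mxE. Qed.

Lemma cv0 (k : nat) (j : 'I_k) : (0 : 'cV[F]_k) j 0 = 0.
Proof. by rewrite mxE. Qed.

Definition cvE := (cvD, cvN, @cvZ F, cv0).

Let pP := pos_P i.
Let pN := pos_N i.

(** The positions of [P1] and [P2] are adjacent, and so are those of [N1] and [N2]; no further label
    separates either pair. *)
Lemma other_lt o : o != P1 -> o != P2 -> o != N1 -> o != N2 ->
  [/\ ltb o P1 = ltb o P2, ltb P1 o = ltb P2 o, ltb o N1 = ltb o N2
    & ltb N1 o = ltb N2 o].
Proof.
have hl := lowposE i; have [p1 p2] := pP; have [p3 p4] := pN.
by rewrite -!pos_eq p1 p2 p3 p4; clear; move: (lowpos i) => k; split; lia.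
Qed.

Lemma five_cases a : a = P1 \/ a = P2 \/ a = N1 \/ a = N2 \/
  [/\ a != P1, a != P2, a != N1 & a != N2].
Proof.
have [->|h1] := eqVneq a P1; first by left.
have [->|h2] := eqVneq a P2; first by right; left.
have [->|h3] := eqVneq a N1; first by do 2 right; left.
have [->|h4] := eqVneq a N2; first by do 3 right; left.
by do 4 right.
Qed.

Lemma other_coef o : o != P1 -> o != P2 -> o != N1 -> o != N2 ->
  [/\ eE o = 0, fE o = 0, kap o = 1 & kap (dual o) = 1].
Proof.
move=> h1 h2 h3 h4; rewrite /eE /fE /kap !dual_eq.
rewrite ![dual o == lP1 i]eq_sym ![dual o == lP2 i]eq_sym !(eq_dual _ o).
rewrite (negbTE h1) (negbTE h2) (negbTE h3) (negbTE h4) /= mulr0 addr0 !subrr.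
by rewrite ?addr0 !expr0z.
Qed.

(** * Even generators: four distinct labels *)

Section Far.
Hypothesis far : (i.+1 < n)%N.

Lemma far_pos : [/\ pos N1 < pos N2, pos N2 < n, n < pos P1 & pos P1 < pos P2]%N.
Proof.
have hl := lowposE i; have [p1 p2] := pP; have [p3 p4] := pN.
by rewrite p1 p2 p3 p4 /lowpos; split; lia.
Qed.

Lemma far_lt :
  ((((ltb P1 P1 = false) * (ltb P1 P2 = true) * (ltb P1 N1 = false) * (ltb P1 N2 = false)) *
  ((ltb P2 P1 = false) * (ltb P2 P2 = false) * (ltb P2 N1 = false) * (ltb P2 N2 = false))) *
  (((ltb N1 P1 = true) * (ltb N1 P2 = true) * (ltb N1 N1 = false) * (ltb N1 N2 = true)) *
  ((ltb N2 P1 = true) * (ltb N2 P2 = true) * (ltb N2 N1 = false) * (ltb N2 N2 = false))))%type.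
Proof. by have [h1 h2 h3 h4] := far_pos; do !split; lia. Qed.

Lemma far_eq :
  ((((P1 == P2) = false) * ((P1 == N1) = false) * ((P1 == N2) = false) *
  ((P2 == P1) = false) * ((P2 == N1) = false) * ((P2 == N2) = false)) *
  (((N1 == P1) = false) * ((N1 == P2) = false) * ((N1 == N2) = false) *
  ((N2 == P1) = false) * ((N2 == P2) = false) * ((N2 == N1) = false)))%type.
Proof. by have [h1 h2 h3 h4] := far_pos; rewrite -!pos_eq; do !split; lia. Qed.

Lemma far_mid : [/\ P1 != mid, P2 != mid, N1 != mid & N2 != mid].
Proof. by have [h1 h2 h3 h4] := far_pos; rewrite -!pos_eq pos_mid; split; lia. Qed.

Lemma far_sg :
  ((((sg P1 P1 = q) * (sg P1 P2 = 1) * (sg P1 N1 = 1) * (sg P1 N2 = q^-1)) *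
  ((sg P2 P1 = 1) * (sg P2 P2 = q) * (sg P2 N1 = q^-1) * (sg P2 N2 = 1))) *
  (((sg N1 P1 = 1) * (sg N1 P2 = q^-1) * (sg N1 N1 = q) * (sg N1 N2 = 1)) *
  ((sg N2 P1 = q^-1) * (sg N2 P2 = 1) * (sg N2 N1 = 1) * (sg N2 N2 = q))))%type.
Proof.
have [h1 h2 h3 h4] := far_mid.
by do !split; rewrite sg_out // ?dualK ?eqxx ?far_eq.
Qed.

Lemma far_gsg a : gsg a = 1. Proof. by rewrite /gsg far. Qed.

Lemma far_eps : esign F i = 1. Proof. by rewrite /esign far. Qed.

Lemma far_coef :
  ((((eE P1 = 1) * (eE P2 = 0) * (eE N1 = 1) * (eE N2 = 0)) *
  ((fE P1 = 0) * (fE P2 = 1) * (fE N1 = 0) * (fE N2 = 1))) *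
  ((kap P1 = q^-1) * (kap P2 = q) * (kap N1 = q^-1) * (kap N2 = q)))%type.
Proof.
do !split; rewrite /eE /fE /kap ?far_eps ?eqxx ?far_eq /= ?mulr0 ?mulr1 ?addr0 ?add0r //.
Qed.

Lemma far_lw : (lw P2 = t * lw P1) * (lw N2 = t * lw N1).
Proof.
have [h1 h2 h3 h4] := far_pos; have [p1 p2] := pP; have [p3 p4] := pN.
have [m1 m2 m3 m4] := far_mid; have hl := lowposE i.
split; rewrite /lw ?(negbTE m1) ?(negbTE m2) ?(negbTE m3) ?(negbTE m4).
  have -> : (pos P2 < n)%N = false by lia.
  have -> : (pos P1 < n)%N = false by lia.
  by rewrite -exprS; congr (_ ^+ _); lia.
have -> : (pos N2 < n)%N by [].
have -> : (pos N1 < n)%N by lia.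
by rewrite -exprS; congr (_ ^+ _); lia.
Qed.

Lemma far_Om : (Om P1 = lw P2 *: bv2 N1 P2 + Om P2) *
  (Om N1 = lw N2 *: bv2 P1 N2 + Om N2).
Proof.
have [p1 p2] := pP; have [p3 p4] := pN; have hl := lowposE i.
split; first by rewrite (@Om_succ P1 P2) ?p1 ?p2.
by rewrite (@Om_succ N1 N2) ?dualK // p3 p4; lia.
Qed.

Definition far_tab := (far_coef, up_lP1, up_N1, dn_lP2, dn_N2, far_gsg, far_eps).
Definition far_tab2 := (far_lt, far_sg, dualK, far_eq, eqxx, far_lw).

(** A finite table of cases. By [far_Om] the tails beyond [P1] and [N1] are expressed through those
    beyond [P2] and [N2], after which both sides are combinations of the same vectors. *)
Lemma far_e4 a d :
  a = P1 \/ a = P2 \/ a = N1 \/ a = N2 -> d = P1 \/ d = P2 \/ d = N1 \/ d = N2 ->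
  De *m (gop *m bv2 a d) = gop *m (De *m bv2 a d).
Proof.
have l1 := lw_neq0 q_neq0 P1; have l2 := lw_neq0 q_neq0 N1.
move=> ha hd.
rewrite De_bv gop_bv mulmxBr !mulmxDr -!scalemxAr !De_bv De_Om !gop_bv.
case: ha => [|[|[]]] ->; case: hd => [|[|[]]] ->.
all: rewrite ?far_coef ?(mulr0, mul0r, scale0r, addr0, add0r, mulr1, mul1r, scaler0).
all: rewrite ?(up_lP1, up_N1, dn_lP2, dn_N2, far_gsg, far_eps, dualK).
all: rewrite ?(far_lt, far_sg) ?far_eq ?eqxx ?far_lw.
all: rewrite ?(mulr0, mul0r, scale0r, addr0, add0r, subr0, mulr1, mul1r, scaler0).
all: rewrite ?far_Om ?far_lw.
all: apply: cV_eq => y; rewrite ?cvE.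
all: field.
all: by rewrite ?oppr_eq0 ?oner_neq0 ?q_neq0 ?l1 ?l2.
Qed.

Lemma far_f4 a d :
  a = P1 \/ a = P2 \/ a = N1 \/ a = N2 -> d = P1 \/ d = P2 \/ d = N1 \/ d = N2 ->
  Df *m (gop *m bv2 a d) = gop *m (Df *m bv2 a d).
Proof.
have l1 := lw_neq0 q_neq0 P1; have l2 := lw_neq0 q_neq0 N1.
move=> ha hd.
rewrite Df_bv gop_bv mulmxBr !mulmxDr -!scalemxAr !Df_bv Df_Om !gop_bv.
case: ha => [|[|[]]] ->; case: hd => [|[|[]]] ->.
all: rewrite ?far_coef ?(mulr0, mul0r, scale0r, addr0, add0r, mulr1, mul1r, scaler0).
all: rewrite ?(up_lP1, up_N1, dn_lP2, dn_N2, far_gsg, far_eps, dualK).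
all: rewrite ?(far_lt, far_sg) ?far_eq ?eqxx ?far_lw.
all: rewrite ?(mulr0, mul0r, scale0r, addr0, add0r, subr0, mulr1, mul1r, scaler0).
all: rewrite ?far_Om ?far_lw.
all: apply: cV_eq => y; rewrite ?cvE.
all: field.
all: by rewrite ?oppr_eq0 ?oner_neq0 ?q_neq0 ?l1 ?l2.
Qed.

End Far.

(** * The odd generator: two of the four labels merge at [mid] *)

Section Near.
Hypothesis near : i.+1 = n.

Lemma near_lowpos : lowpos i = n.
Proof. by rewrite /lowpos near; lia. Qed.

Lemma near_P1 : P1 = mid.
Proof. by apply: pos_inj; have [-> _] := pP; rewrite near_lowpos pos_mid. Qed.

Lemma near_N2 : N2 = mid. Proof. by rewrite near_P1 dual_mid. Qed.

Lemma near_pos : pos P2 = n.+1 /\ pos N1 = n.-1.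
Proof.
have hl := lowposE i; have [_ ->] := pP; have [-> _] := pN.
by rewrite near_lowpos; split; first by []; lia.
Qed.

Lemma near_lt :
  (((ltb mid mid = false) * (ltb mid P2 = true) * (ltb mid N1 = false)) *
  (((ltb P2 mid = false) * (ltb P2 P2 = false) * (ltb P2 N1 = false)) *
  ((ltb N1 mid = true) * (ltb N1 P2 = true) * (ltb N1 N1 = false))))%type.
Proof.
by have [h1 h2] := near_pos; rewrite pos_mid h1 h2; have := near; do !split; lia.
Qed.

Lemma near_eq :
  (((mid == P2) = false) * ((mid == N1) = false) * ((P2 == mid) = false) *
   ((P2 == N1) = false) * ((N1 == mid) = false) * ((N1 == P2) = false))%type.
Proof.
have [h1 h2] := near_pos; rewrite -!pos_eq pos_mid h1 h2.
by have := near; do !split; lia.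
Qed.

Lemma near_sg :
  (((sg mid mid = -1) * (sg mid P2 = -1) * (sg mid N1 = -1)) *
  (((sg P2 mid = -1) * (sg P2 P2 = q) * (sg P2 N1 = q^-1)) *
  ((sg N1 mid = -1) * (sg N1 P2 = q^-1) * (sg N1 N1 = q))))%type.
Proof.
do !split; try by case: (sg_mid mid); try by case: (sg_mid P2);
  try by case: (sg_mid N1).
all: by rewrite sg_out ?dualK ?eqxx ?near_eq.
Qed.

Lemma near_gsg : (gsg mid = 1) * (gsg P2 = -1) * (gsg N1 = -1).
Proof. by do !split; rewrite /gsg near ltnn ?eqxx ?near_eq. Qed.

Lemma near_eps : esign F i = -1. Proof. by rewrite /esign near ltnn. Qed.

Lemma near_coef :
  ((((eE mid = 1) * (eE P2 = 0) * (eE N1 = -1)) *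
  ((fE mid = 1) * (fE P2 = 1) * (fE N1 = 0))) *
  ((kap mid = 1) * (kap P2 = q) * (kap N1 = q^-1)))%type.
Proof.
do !split; rewrite /eE /fE /kap ?near_eps ?near_N2 ?near_P1 ?eqxx ?near_eq /=
  ?mulr0 ?mulr1 ?addr0 ?add0r //.
Qed.

Lemma near_lw : (lw mid = - lw N1) * (lw P2 = t * lw N1).
Proof.
have [h1 h2] := near_pos.
rewrite /lw pos_mid ltnn eqxx !near_eq h1 h2 /= -near ltnSn /=.
by rewrite [(_ < _)%N]ltnNge leqnSn /= -exprS.
Qed.

Lemma near_Om : (Om mid = lw P2 *: bv2 N1 P2 + Om P2) *
  (Om N1 = lw mid *: bv2 mid mid + Om mid).
Proof.
have [p1 p2] := near_pos.
split; first by rewrite (@Om_succ mid P2) ?p1 ?pos_mid.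
by rewrite (@Om_succ N1 mid) ?dual_mid // p2 pos_mid -near.
Qed.

Lemma near_up : (up mid = P2) * (up N1 = mid).
Proof. by rewrite -{1}near_P1 up_lP1 up_N1 near_N2. Qed.

Lemma near_dn : (dn P2 = mid) * (dn mid = N1).
Proof. by rewrite dn_lP2 near_P1 -near_N2 dn_N2. Qed.

Definition near_tab := (near_P1, near_coef, near_up, near_dn, near_gsg, near_eps).
Definition near_tab2 := (dual_mid, near_lt, near_sg, dualK, near_eq, eqxx).

Lemma near_e3 a d : a = mid \/ a = P2 \/ a = N1 -> d = mid \/ d = P2 \/ d = N1 ->
  De *m (gop *m bv2 a d) = gop *m (De *m bv2 a d).
Proof.
have l2 := lw_neq0 q_neq0 N1.
move=> ha hd.
rewrite De_bv gop_bv mulmxBr !mulmxDr -!scalemxAr !De_bv De_Om !gop_bv.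
case: ha => [|[]] ->; case: hd => [|[]] ->.
all: rewrite ?near_P1 ?dual_mid ?near_coef ?(mulr0, mul0r, scale0r, addr0, add0r, mulr1, mul1r, scaler0) //.
all: rewrite ?(near_up, near_dn, near_gsg, near_eps, dualK, dual_mid) //.
all: rewrite ?(near_lt, near_sg) ?near_eq ?eqxx //.
all: rewrite ?(mulr0, mul0r, scale0r, addr0, add0r, subr0, mulr1, mul1r, scaler0).
all: rewrite ?near_Om ?near_lw.
all: apply: cV_eq => y; rewrite ?cvE.
all: field.
all: by rewrite ?oppr_eq0 ?oner_neq0 ?q_neq0 ?l2.
Qed.

Lemma near_f3 a d : a = mid \/ a = P2 \/ a = N1 -> d = mid \/ d = P2 \/ d = N1 ->
  Df *m (gop *m bv2 a d) = gop *m (Df *m bv2 a d).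
Proof.
have l2 := lw_neq0 q_neq0 N1.
move=> ha hd.
rewrite Df_bv gop_bv mulmxBr !mulmxDr -!scalemxAr !Df_bv Df_Om !gop_bv.
case: ha => [|[]] ->; case: hd => [|[]] ->.
all: rewrite ?near_P1 ?dual_mid ?near_coef ?(mulr0, mul0r, scale0r, addr0, add0r, mulr1, mul1r, scaler0) //.
all: rewrite ?(near_up, near_dn, near_gsg, near_eps, dualK, dual_mid) //.
all: rewrite ?(near_lt, near_sg) ?near_eq ?eqxx //.
all: rewrite ?(mulr0, mul0r, scale0r, addr0, add0r, subr0, mulr1, mul1r, scaler0).
all: rewrite ?near_Om ?near_lw.
all: apply: cV_eq => y; rewrite ?cvE.
all: field.
all: by rewrite ?oppr_eq0 ?oner_neq0 ?q_neq0 ?l2.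
Qed.

End Near.

Lemma far_or_near : (i.+1 < n)%N \/ i.+1 = n.
Proof. by have := ltn_ord i; rewrite leq_eqVlt => /orP [/eqP|]; [right|left]. Qed.

Lemma sg_ne a o : o != a -> o != dual a ->
  sg a o = (if (a == mid) || (o == mid) then -1 else 1) /\ sg o a = sg a o.
Proof.
move=> h1 h2; rewrite /sg wformC wform_wt [o == dual a](negbTE h2) (negbTE h1).
rewrite subrr expr0z mulr1 andbC.
by split=> //; case: (a == mid); case: (o == mid); rewrite /= ?expr0 ?expr1 ?opprK ?mulr1.
Qed.

(** * Labels not moved by the generator *)

Section Other.
Variable o : V.
Hypotheses (h1 : o != P1) (h2 : o != P2) (h3 : o != N1) (h4 : o != N2).

Lemma other_dual : [/\ o != dual P1, o != dual P2, o != dual N1 & o != dual N2].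
Proof. by rewrite !dualK. Qed.

Lemma other_gg : gsg o * gsg o = 1.
Proof.
by rewrite /gsg; case: ifP => _; [|case: ifP => _]; rewrite ?mulr1 // mulrNN mulr1.
Qed.

Lemma other_sg : [/\ sg P2 o = gsg o * sg P1 o, sg N2 o = gsg o * sg N1 o,
  [/\ sg o P1 = sg P1 o, sg o P2 = sg P2 o, sg o N1 = sg N1 o & sg o N2 = sg N2 o]
  & gsg o * gsg o = 1].
Proof.
have [d1 d2 d3 d4] := other_dual.
have [s1 ->] := sg_ne h1 d1; have [s2 ->] := sg_ne h2 d2.
have [s3 ->] := sg_ne h3 d3; have [s4 ->] := sg_ne h4 d4.
have gg := other_gg; split=> //; rewrite ?s1 ?s2 ?s3 ?s4.
  case: far_or_near => [far|near].
    by have [/negbTE-> /negbTE-> _ _] := far_mid far; rewrite far_gsg // mul1r.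
  have om : o != mid by rewrite -(near_P1 near).
  rewrite near_P1 // !eqxx !near_eq // (negbTE om) /gsg near ltnn (negbTE om) /=.
  by rewrite mulrNN mulr1.
case: far_or_near => [far|near].
  by have [_ _ /negbTE-> /negbTE->] := far_mid far; rewrite far_gsg // mul1r.
have om : o != mid by rewrite -(near_P1 near).
rewrite near_N2 // !eqxx !near_eq // (negbTE om) /gsg near ltnn (negbTE om) /=.
by rewrite mulr1.
Qed.

Lemma other_up a : eE a != 0 ->
  [/\ ltb a o = ltb (up a) o, ltb o a = ltb o (up a),
      sg a o = gsg o * sg (up a) o, sg o a = gsg o * sg o (up a) & o != dual a].
Proof.
have [l1 l2 l3 l4] := other_lt h1 h2 h3 h4.
have [s1 s2 [t1 t2 t3 t4] gg] := other_sg; have [d1 d2 d3 d4] := other_dual.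
rewrite /eE; have [->|_] := eqVneq a P1.
  by rewrite up_lP1 t1 t2 s1 mulrA gg mul1r; split.
have [->|_] := eqVneq a N1; last by rewrite mulr0 addr0 eqxx.
by rewrite up_N1 t3 t4 s2 mulrA gg mul1r; split.
Qed.

Lemma other_dn a : fE a != 0 ->
  [/\ ltb a o = ltb (dn a) o, ltb o a = ltb o (dn a),
      sg a o = gsg o * sg (dn a) o, sg o a = gsg o * sg o (dn a) & o != dual a].
Proof.
have [l1 l2 l3 l4] := other_lt h1 h2 h3 h4.
have [s1 s2 [t1 t2 t3 t4] gg] := other_sg; have [d1 d2 d3 d4] := other_dual.
rewrite /fE; have [->|_] := eqVneq a P2.
  by rewrite dn_lP2 t1 t2 s1; split.
have [->|_] := eqVneq a N2; last by rewrite addr0 eqxx.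
by rewrite dn_N2 t3 t4 s2; split.
Qed.

(** The label [o] separates neither [P1] from [P2] nor [N1] from [N2], so the tail contains both or
    none of each pair, and the two contributions of a pair cancel. *)
Lemma De_Om_other : De *m Om o = 0.
Proof.
have [l1 l2 l3 l4] := other_lt h1 h2 h3 h4.
rewrite De_Om -l1 -l3; case: far_or_near => [far|near].
  rewrite !(far_tab far) ?(far_tab2 far).
  by apply: cV_eq => y; rewrite ?cvE; field; rewrite q_neq0.
rewrite (near_N2 near) !(near_tab near) ?(near_tab2 near) ?(near_lw near).
by apply: cV_eq => y; rewrite ?cvE; field; rewrite ?q_neq0 ?oner_neq0.
Qed.

Lemma Df_Om_other : Df *m Om o = 0.
Proof.
have [l1 l2 l3 l4] := other_lt h1 h2 h3 h4.
rewrite Df_Om -l1 -l3; case: far_or_near => [far|near].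
  rewrite !(far_tab far) ?(far_tab2 far).
  by apply: cV_eq => y; rewrite ?cvE; field; rewrite ?q_neq0 ?oner_neq0.
rewrite (near_N2 near) !(near_tab near) ?(near_tab2 near) ?(near_lw near).
by apply: cV_eq => y; rewrite ?cvE; field; rewrite ?q_neq0 ?oner_neq0.
Qed.
End Other.

Definition other o := [&& o != P1, o != P2, o != N1 & o != N2].

Lemma other_dualE o : other o -> other (dual o).
Proof.
by case/and4P=> h1 h2 h3 h4; apply/and4P; rewrite ![dual o == _]eq_sym !(eq_dual _ o) !dualK.
Qed.

Lemma four_other a : (a = P1 \/ a = P2 \/ a = N1 \/ a = N2) \/ other a.
Proof.
by have [|[|[|[|[*]]]]] := five_cases a; [left; auto..|right; apply/and4P].
Qed.

Lemma gsg_sign o : gsg o = 1 \/ gsg o = -1.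
Proof. by rewrite /gsg; case: ifP; [left | case: ifP; [left|right]]. Qed.

(** Moving [a] by the generator changes neither its order relative to [o] nor its not being dual to
    [o], and [sg] changes by the sign [gsg o] which the coproduct produces. If [a] is not moved
    either, only the tail at [a = dual o] is left, and it is killed. *)
Lemma e_other o a : other o ->
  De *m (gop *m bv2 a o) = gop *m (De *m bv2 a o) /\
  De *m (gop *m bv2 o a) = gop *m (De *m bv2 o a).
Proof.
move=> oo; have [h1 h2 h3 h4] := and4P oo.
have [c1 _ c3 _] := other_coef h1 h2 h3 h4.
have [za|na] := eqVneq (eE a) 0.
  rewrite !De_bv !gop_bv c1 za !mulr0 !scale0r addr0 !mulmx0.
  rewrite !mulmxBr !mulmxDr -!scalemxAr !De_bv c1 za !mulr0 !scale0r !addr0 !scaler0 !addr0.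
  have [ea|na] := eqVneq a (dual o); last first.
    by rewrite [o == _]eq_dual (negbTE na) !mulr0 !scale0r subr0.
  have [k1 k2 k3 k4] := and4P (other_dualE oo).
  by rewrite ea !De_Om_other // !scaler0 subr0.
have [l1 l2 s1 s2 oa] := other_up h1 h2 h3 h4 na.
have oa' : o != dual (up a).
  apply/negP => /eqP e; have := other_dualE oo; rewrite e dualK => /and4P [k1 k2 k3 k4].
  move: na; rewrite /eE; have [ha|_] := eqVneq a P1.
    by move: k2; rewrite ha up_lP1 eqxx.
  have [ha|_] := eqVneq a N1; last by rewrite mulr0 addr0 eqxx.
  by move: k4; rewrite ha up_N1 eqxx.
rewrite !De_bv c1 c3 !gop_bv !mulr0 !mul1r !scale0r addr0 add0r.
rewrite -!scalemxAr !gop_bv !mulmxBr !mulmxDr -!scalemxAr !De_bv c1 c3.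
rewrite ![_ == dual o]eq_dual (negbTE oa) (negbTE oa') l1 l2 s1 s2.
rewrite !mulr0 !scale0r !subr0 !mul1r !addr0 !add0r.
by split; apply: cV_eq => y; rewrite ?cvE; case: (gsg_sign o) => ->; ring.
Qed.

Lemma f_other o a : other o ->
  Df *m (gop *m bv2 a o) = gop *m (Df *m bv2 a o) /\
  Df *m (gop *m bv2 o a) = gop *m (Df *m bv2 o a).
Proof.
move=> oo; have [h1 h2 h3 h4] := and4P oo.
have [_ c1 c3 _] := other_coef h1 h2 h3 h4.
have [za|na] := eqVneq (fE a) 0.
  rewrite !Df_bv !gop_bv c1 za !mulr0 !scale0r addr0 !mulmx0.
  rewrite !mulmxBr !mulmxDr -!scalemxAr !Df_bv c1 za !mulr0 !scale0r !addr0 !scaler0 !addr0.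
  have [ea|na] := eqVneq a (dual o); last first.
    by rewrite [o == _]eq_dual (negbTE na) !mulr0 !scale0r subr0.
  have [k1 k2 k3 k4] := and4P (other_dualE oo).
  by rewrite ea !Df_Om_other // !scaler0 subr0.
have [l1 l2 s1 s2 oa] := other_dn h1 h2 h3 h4 na.
have oa' : o != dual (dn a).
  apply/negP => /eqP e; have := other_dualE oo; rewrite e dualK => /and4P [k1 k2 k3 k4].
  move: na; rewrite /fE; have [ha|_] := eqVneq a P2.
    by move: k1; rewrite ha dn_lP2 eqxx.
  have [ha|_] := eqVneq a N2; last by rewrite addr0 eqxx.
  by move: k3; rewrite ha dn_N2 eqxx.
rewrite !Df_bv c1 c3 invr1 !gop_bv !mulr0 !mul1r !scale0r addr0 add0r.
rewrite -!scalemxAr !gop_bv !mulmxBr !mulmxDr -!scalemxAr !Df_bv c1 c3 invr1.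
rewrite ![_ == dual o]eq_dual (negbTE oa) (negbTE oa') l1 l2 s1 s2.
rewrite !mulr0 !scale0r !subr0 !mul1r !addr0 !add0r.
by split; apply: cV_eq => y; rewrite ?cvE; case: (gsg_sign o) => ->; ring.
Qed.

Lemma four_near a : i.+1 = n -> a = P1 \/ a = P2 \/ a = N1 \/ a = N2 ->
  a = mid \/ a = P2 \/ a = N1.
Proof.
by move=> h; rewrite near_P1 // dual_mid; case=> [|[|[|]]] ->; auto.
Qed.

Lemma gop_e : gop * De = De * gop.
Proof.
apply: op_bv_eq => -[a d]; rewrite -[LHS]mulmxA -[RHS]mulmxA; apply/esym.
have [ha|ha] := four_other a; last by case: (e_other d ha).
have [hd|hd] := four_other d; last by case: (e_other a hd).
case: far_or_near => h; first exact: far_e4.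
by apply: near_e3 => //; apply: four_near.
Qed.

Lemma gop_f : gop * Df = Df * gop.
Proof.
apply: op_bv_eq => -[a d]; rewrite -[LHS]mulmxA -[RHS]mulmxA; apply/esym.
have [ha|ha] := four_other a; last by case: (f_other d ha).
have [hd|hd] := four_other d; last by case: (f_other a hd).
case: far_or_near => h; first exact: far_f4.
by apply: near_f3 => //; apply: four_near.
Qed.

Lemma gent_weight (y x : VV) : gent q y x != 0 ->
  wt y.1 + wt y.2 = wt x.1 + wt x.2.
Proof.
rewrite /gent; have [->|ny] := eqVneq y (x.2, x.1); first by move=> _; rewrite /= addrC.
have [->|nx] := eqVneq y x; first by [].
case: (boolP ((x.2 == dual x.1) && (y.1 == dual y.2))) => [/andP [/eqP e1 /eqP e2]|_];
  last by rewrite !mulr0 oppr0 !addr0 eqxx.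
by rewrite e1 e2 !wt_dual addNr subrr.
Qed.

Lemma gop_even : even_op gop.
Proof.
move=> x y; rewrite ent_mkop /gent.
have sp (u : VV) : spar u = (u.1 != mid) (+) (u.2 != mid) by rewrite /= !label_eq0.
rewrite !sp; have [->|ny] := eqVneq y (x.2, x.1); first by rewrite /= addbC eqxx.
have [->|nx] := eqVneq y x; first by rewrite eqxx.
case: (boolP ((x.2 == dual x.1) && (y.1 == dual y.2))) => [/andP [/eqP e1 /eqP e2]|_];
  last by rewrite !mulr0 oppr0 !addr0.
by rewrite e1 e2 !dual_neq_mid !addbb eqxx.
Qed.

Lemma gop_diag (k : weight n -> F) (D : op F VV) :
  (forall y x, ent D y x = (y == x)%:R * k (wt x.1 + wt x.2)) -> gop * D = D * gop.
Proof.
move=> hD; apply: opP => y x; rewrite !entM.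
rewrite (bigD1 x) //= [X in _ + X]big1 ?addr0; last first.
  by move=> m' nm; rewrite hD (negbTE nm) mul0r mulr0.
rewrite [RHS](bigD1 y) //= [X in _ = _ + X]big1 ?addr0; last first.
  by move=> m' nm; rewrite hD eq_sym (negbTE nm) !mul0r.
rewrite !hD !eqxx !mul1r [ent gop y x]ent_mkop mulrC.
have [->|ny] := eqVneq (gent q y x) 0; first by rewrite !mulr0.
by rewrite (gent_weight ny).
Qed.

Lemma gop_K : gop * act (GK, i) = act (GK, i) * gop.
Proof.
apply: (@gop_diag (fun w => q ^ wform (alpha i) w)) => -[y1 y2] [x1 x2].
rewrite ent_tens !ent_mkop xpair_eqE /= wformDr expfzDr // /qwt.
have [_|_] := eqVneq y1 x1; last by rewrite !mul0r mulr0.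
have [->|_] := eqVneq y2 x2; last by rewrite !mul0r !mulr0.
by rewrite addbb expr0 !mul1r.
Qed.

Lemma gop_KV : gop * act (GKV, i) = act (GKV, i) * gop.
Proof.
apply: (@gop_diag (fun w => (q ^ wform (alpha i) w)^-1)) => -[y1 y2] [x1 x2].
rewrite ent_tens !ent_mkop xpair_eqE /= wformDr expfzDr // /qwt invfM.
have [_|_] := eqVneq y1 x1; last by rewrite !mul0r mulr0.
have [->|_] := eqVneq y2 x2; last by rewrite !mul0r !mulr0.
by rewrite addbb expr0 !mul1r.
Qed.

End Intertwine.

Lemma gop_commutant (F : fieldType) (n : nat) (q : F) : q != 0 ->
  super_commutant (coprod_action (V_action q) (V_action q)) (gop n q).
Proof.
move=> q0; split=> [|[[] i]]; first exact: gop_even.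
- exact: gop_e.
- exact: gop_f.
- exact: gop_K.
- exact: gop_KV.
Qed.

(** * Cyclic vectors and the Birman-Wenzl-Murakami relations *)

Section Cyclic.
Variables (F : fieldType) (n : nat) (q : F).
Hypothesis q_neq0 : q != 0.
Implicit Types (a b c d : V n).
Local Notation V := (V n).
Local Notation VV := (tens_space V V).
Local Notation T3 := (tens_space V VV).
Local Notation bv2 a d := (@bv F VV (a, d)).
Local Notation bv3 a b d := (@bv F T3 (a, (b, d))).
Local Notation act2 := (coprod_action (V_action q) (V_action q)).
Local Notation act3 := (coprod_action (V_action q) act2).

(** The label of the lowest weight vector [v_(-1)]; its dual [top] is that of [v_1]. *)
Definition bot : V := vx n 0.
Definition top : V := dual bot.

Lemma pos_bot : pos bot = 0%N. Proof. by rewrite vxK. Qed.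
Lemma pos_top : pos top = (2 * n)%N. Proof. by rewrite pos_dual pos_bot subn0. Qed.

Lemma fE_neq0 a : (0 < pos a)%N -> exists i, fE F i a != 0 /\ pos (dn a) = (pos a).-1.
Proof.
have la := pos_le a; move=> ha.
have hd : pos (dn a) = (pos a).-1 by rewrite vxK //; lia.
have h2 (b : bool) : (1 + b%:R : F) = if b then 2 else 1 by case: b; rewrite ?addr0.
have [le|gt] := leqP (pos a) n.
  have hi : ((pos a).-1 < n)%N by lia.
  exists (Ordinal hi); split=> //; rewrite /fE.
  have hl := lowposE (Ordinal hi).
  have [_ p2] := pos_P (Ordinal hi); have [_ p4] := pos_N (Ordinal hi).
  rewrite -!pos_eq p2 p4.
  have -> : (pos a == (lowpos (Ordinal hi)).+1) = false by move: hl le; clear; lia.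
  have -> : (pos a == (2 * n - lowpos (Ordinal hi))%N).
    by rewrite /lowpos /=; move: ha le; clear; lia.
  by rewrite add0r oner_neq0.
have hi : (2 * n - pos a < n)%N by lia.
exists (Ordinal hi); split=> //; rewrite /fE.
have hl := lowposE (Ordinal hi).
have [_ p2] := pos_P (Ordinal hi); have [_ p4] := pos_N (Ordinal hi).
rewrite -!pos_eq p2 p4.
have -> : (pos a == (2 * n - lowpos (Ordinal hi))%N) = false by move: hl gt; clear; lia.
have -> : (pos a == (lowpos (Ordinal hi)).+1) by rewrite /lowpos /=; lia.
by rewrite addr0 oner_neq0.
Qed.

Lemma fE_bot i : fE F i bot = 0.
Proof.
have hl := lowposE i; have [_ p2] := pos_P i; have [_ p4] := pos_N i.
rewrite /fE -!pos_eq p2 p4 pos_bot.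
have -> : (0 == 2 * n - lowpos i)%N = false by lia.
by rewrite addr0.
Qed.

Lemma eE_neq0 a : (pos a < 2 * n)%N -> exists i, eE F i a != 0 /\ pos (up a) = (pos a).+1.
Proof.
move=> ha; have hd : pos (up a) = (pos a).+1 by rewrite vxK //; lia.
have [lt|ge] := ltnP (pos a) n.
  have hi : (pos a < n)%N by lia.
  exists (Ordinal hi); split=> //; rewrite /eE.
  have hl := lowposE (Ordinal hi).
  have [p1 _] := pos_P (Ordinal hi); have [p3 _] := pos_N (Ordinal hi).
  rewrite -!pos_eq p1 p3.
  have -> : (pos a == lowpos (Ordinal hi)) = false by move: hl lt; clear; lia.
  have -> : (pos a == (2 * n - (lowpos (Ordinal hi)).+1)%N) by rewrite /lowpos /=; lia.
  by rewrite add0r mulr1 /esign; case: ifP => _; rewrite ?oppr_eq0 oner_neq0.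
have hi : (2 * n - (pos a).+1 < n)%N by lia.
exists (Ordinal hi); split=> //; rewrite /eE.
have hl := lowposE (Ordinal hi).
have [p1 _] := pos_P (Ordinal hi); have [p3 _] := pos_N (Ordinal hi).
rewrite -!pos_eq p1 p3.
have -> : (pos a == (2 * n - (lowpos (Ordinal hi)).+1)%N) = false by move: hl ge; clear; lia.
have -> : (pos a == lowpos (Ordinal hi)) by rewrite /lowpos /=; lia.
by rewrite mulr0 addr0 oner_neq0.
Qed.

Lemma gsg_neq0 i a : gsg F i a != 0.
Proof. by rewrite /gsg; case: ifP => _; [|case: ifP => _]; rewrite ?oppr_eq0 oner_neq0. Qed.

Lemma scale0_eq m (k : F) (v : 'cV[F]_m) : k != 0 -> k *: v = 0 -> v = 0.
Proof. by move=> k0 /eqP; rewrite scaler_eq0 (negbTE k0) => /eqP. Qed.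

Section Kernel.
Variables (B : superspace) (a : action F n B) (Z : op F B).
Hypothesis cZ : super_commutant a Z.

(** Cyclicity is used in this form: the kernel of an operator commuting with the action is a
    submodule. *)
Lemma ker_act x (v : 'cV[F]_#|B|) : Z *m v = 0 -> Z *m (a x *m v) = 0.
Proof.
move=> h; case: cZ => _ c; have e : Z *m a x = a x *m Z := c x.
by rewrite mulmxA e -mulmxA h mulmx0.
Qed.

Lemma ker_scale k (v : 'cV[F]_#|B|) : k != 0 -> Z *m (k *: v) = 0 -> Z *m v = 0.
Proof. by move=> k0; rewrite -scalemxAr; apply: scale0_eq. Qed.

End Kernel.

(** Lowering generators kill [v_(-1)], so they act on the first factor alone and yield all
    [v_a (x) v_(-1)]. Raising [v_a (x) v_d] then yields [v_a] times the next vector, modulo a vector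
    with the same second factor [v_d], which the induction already covers. *)
Lemma cyclic2 (Z : op F VV) : super_commutant act2 Z ->
  Z *m bv2 top bot = 0 -> Z = 0.
Proof.
move=> cZ h0; have kact := ker_act cZ.
have hb a : Z *m bv2 a bot = 0.
  have [k] := ubnP (2 * n - pos a); elim: k a => // k IH a hk.
  have [e|ne] := eqVneq (pos a) (2 * n)%N.
    by have -> : a = top by apply: pos_inj; rewrite e pos_top.
  have la := pos_le a; have lt : (pos a < 2 * n)%N by move: ne la; clear; lia.
  have pu : pos (up a) = (pos a).+1 by rewrite vxK.
  have [i [fi _]] := @fE_neq0 (up a) (ltac:(by rewrite pu)).
  have du : dn (up a) = a by apply: pos_inj; rewrite vxK pu.
  have hk' : (2 * n - pos (up a) < k)%N by rewrite pu; lia.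
  have := kact (GF, i) _ (IH (up a) hk').
  by rewrite Df_bv fE_bot mulr0 scale0r addr0 du => /(ker_scale fi).
suff hh p a d : (pos d <= p)%N -> Z *m bv2 a d = 0.
  apply: op_bv_eq => -[a d]; rewrite mul0mx; exact: (hh (pos d)).
elim: p a d => [|p IH] a d hd.
  have -> : d = bot by apply: pos_inj; rewrite pos_bot; lia.
  exact: hb.
have [/IH //|gt] := leqP (pos d) p.
have pd : pos (dn d) = p by rewrite vxK; have := pos_le d; lia.
have lt : (pos (dn d) < 2 * n)%N by have := pos_le d; lia.
have [i [ei _]] := eE_neq0 lt.
have du : up (dn d) = d by apply: pos_inj; rewrite vxK pd; have := pos_le d; lia.
have := kact (GE, i) _ (IH a (dn d) (ltac:(by rewrite pd))).
rewrite De_bv mulmxDr -!scalemxAr (IH (up a) (dn d)) ?pd // scaler0 add0r du => /eqP.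
by rewrite scaler_eq0 mulf_eq0 (negbTE ei) (negbTE (gsg_neq0 _ _)) => /eqP.
Qed.

Lemma De3_bv i a b d : exists k1 k2 k3 : F, [/\ k3 != 0 &
  act3 (GE, i) *m bv3 a b d =
  k1 *: bv3 (up a) b d + k2 *: bv3 a (up b) d + (k3 * eE F i d) *: bv3 a b (up d)].
Proof.
have K2 := tens_bv (K_bv q i b) (K_bv q i d).
have H1 := tens_bv (e_bv q i a) K2.
have H2 := tens_bv (@one_bv F V a) (tens_bv (e_bv q i b) (K_bv q i d)).
have H3 := tens_bv (@one_bv F V a) (tens_bv (@one_bv F V b) (e_bv q i d)).
rewrite /= tensDr !mulmxDl H1 H2 H3 addrA; do 3 eexists; split; last first.
  by congr (_ + _ *: _); rewrite !mulrA.
by rewrite !mulf_neq0 ?oner_neq0 ?signr_eq0.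
Qed.

Lemma Df3_bv i a b : exists k : F,
  act3 (GF, i) *m bv3 a b bot = fE F i a *: bv3 (dn a) b bot + k *: bv3 a (dn b) bot.
Proof.
have H1 := tens_bv (f_bv q i a) (@one_bv F VV (b, bot)).
have H2 := tens_bv (KV_bv q i a) (tens_bv (f_bv q i b) (@one_bv F V bot)).
have H3 := tens_bv (KV_bv q i a) (tens_bv (KV_bv q i b) (f_bv q i bot)).
rewrite /= tensDr !mulmxDl H1 H2 H3 addbb expr0 mul1r mulr1; eexists.
by congr (_ + _); rewrite fE_bot !mulr0 scale0r addr0.
Qed.

(** The argument of [cyclic2]. Lowering the first factor also lowers the middle one, hence the
    induction runs over all middle labels at once. *)
Lemma cyclic3 (Z : op F T3) : super_commutant act3 Z ->
  (forall b, Z *m bv3 top b bot = 0) -> Z = 0.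
Proof.
move=> cZ h0; have kact := ker_act cZ.
have hb a : forall b, Z *m bv3 a b bot = 0.
  have [k] := ubnP (2 * n - pos a); elim: k a => // k IH a hk b.
  have [e|ne] := eqVneq (pos a) (2 * n)%N.
    by have -> : a = top by apply: pos_inj; rewrite e pos_top.
  have la := pos_le a; have lt : (pos a < 2 * n)%N by move: ne la; clear; lia.
  have pu : pos (up a) = (pos a).+1 by rewrite vxK.
  have [i [fi _]] := @fE_neq0 (up a) (ltac:(by rewrite pu)).
  have du : dn (up a) = a by apply: pos_inj; rewrite vxK pu.
  have hk' : (2 * n - pos (up a) < k)%N by rewrite pu; lia.
  have := kact (GF, i) _ (IH (up a) hk' b).
  have [l ->] := Df3_bv i (up a) b.
  rewrite mulmxDr -[X in _ + X]scalemxAr (IH (up a) hk') scaler0 addr0 du.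
  exact: ker_scale.
suff hh p a b d : (pos d <= p)%N -> Z *m bv3 a b d = 0.
  apply: op_bv_eq => -[a [b d]]; rewrite mul0mx; exact: (hh (pos d)).
elim: p a b d => [|p IH] a b d hd.
  have -> : d = bot by apply: pos_inj; rewrite pos_bot; lia.
  exact: hb.
have [/IH //|gt] := leqP (pos d) p.
have pd : pos (dn d) = p by rewrite vxK; have := pos_le d; lia.
have lt : (pos (dn d) < 2 * n)%N by have := pos_le d; lia.
have [i [ei _]] := eE_neq0 lt.
have du : up (dn d) = d by apply: pos_inj; rewrite vxK pd; have := pos_le d; lia.
have := kact (GE, i) _ (IH a b (dn d) (ltac:(by rewrite pd))).
have [k1 [k2 [k3 [k30 ->]]]] := De3_bv i a b (dn d).
rewrite !mulmxDr -!scalemxAr (IH (up a) b (dn d)) ?pd // (IH a (up b) (dn d)) ?pd //.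
rewrite !scaler0 !add0r du => /eqP.
by rewrite scaler_eq0 mulf_eq0 (negbTE ei) (negbTE k30) => /eqP.
Qed.

End Cyclic.

(** * The element [e] on two tensor factors *)

Section BMWTwo.
Variables (F : fieldType) (n : nat) (q : F).
Hypothesis q_neq0 : q != 0.
Hypothesis q2_neq1 : q ^+ 2 != 1.
Hypothesis n_gt0 : (0 < n)%N.
Implicit Types (a b c d : V n).
Local Notation z := (q - q^-1).
Local Notation t := (- q^-1).
Local Notation r := (- q ^+ (2 * n)).
Local Notation mid := (mid n).
Local Notation V := (V n).
Local Notation VV := (tens_space V V).
Local Notation bv2 a d := (@bv F VV (a, d)).
Local Notation gop := (@gop F n q).
Local Notation lw := (@lw F n q).
Local Notation sg := (@sg F n q).
Local Notation Om := (@Om F n q).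
Local Notation bot := (bot n).
Local Notation top := (top n).
Local Notation act2 := (coprod_action (V_action q) (V_action q)).

(* Spans the invariants of V (x) V. *)
Definition Omt : 'cV[F]_#|VV| := \sum_(c : V) lw c *: bv2 (dual c) c.

Lemma r_neq0 : r != 0. Proof. by rewrite oppr_eq0 expf_neq0. Qed.

Lemma lw_bot : lw bot = 1.
Proof. by rewrite /lw pos_bot n_gt0. Qed.

Lemma lw_top : lw top = q / r.
Proof.
rewrite /lw -pos_eq pos_top pos_mid.
have -> : (2 * n < n)%N = false by lia.
have -> : (2 * n == n)%N = false by lia.
apply: (mulfI (t_neq0 q_neq0)); rewrite -exprS prednK; last by lia.
rewrite [in LHS]exprM sqrrN -exprM exprVn.
by field; rewrite r_neq0 q_neq0 expf_neq0.
Qed.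

Lemma Om_top : Om top = 0.
Proof.
rewrite /Om big1 // => c _; rewrite pos_top ltnNge pos_le.
by rewrite scale0r.
Qed.

Lemma Omt_bot : Omt = bv2 top bot + Om bot.
Proof.
rewrite /Omt (bigD1 bot isT) lw_bot scale1r; congr (_ + _).
rewrite /Om [RHS](bigD1 bot isT) ltnn scale0r [RHS]add0r.
apply: eq_bigr => c /=; rewrite -pos_eq pos_bot => nc.
by rewrite lt0n nc scale1r.
Qed.

Lemma top_neq : [/\ top != mid, bot != mid & (top == bot) = false].
Proof. by rewrite -!pos_eq pos_top pos_bot pos_mid; split; lia. Qed.

Lemma sg_topbot : (sg top bot = q^-1) * (sg bot top = q^-1) * (sg top top = q).
Proof.
have [h1 h2 h3] := top_neq.
by do !split; rewrite sg_out // ?dualK ?h3 1?[bot == _]eq_sym ?h3 ?eqxx.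
Qed.

Lemma gop_top b : gop *m bv2 top b = sg top b *: bv2 b top.
Proof.
rewrite gop_bv Om_top scaler0 subr0 pos_top ltnNge pos_le mulr0 scale0r.
by rewrite addr0.
Qed.

Lemma gop_bot b : gop *m bv2 b bot = sg b bot *: bv2 bot b.
Proof.
rewrite gop_bv pos_bot ltn0 mulr0 scale0r addr0 eq_dual.
have [->|_] := eqVneq b top; first by rewrite Om_top scaler0 subr0.
by rewrite mulr0 scale0r subr0.
Qed.

Lemma lw_step d d' : pos d' = (pos d).+1 -> d != mid -> d' != mid -> lw d' = t * lw d.
Proof.
move=> h nd nd'; rewrite /lw (negbTE nd) (negbTE nd') h.
move: nd nd'; rewrite -!pos_eq pos_mid h => nd nd'.
have [lt|ge] := ltnP (pos d) n.
  have -> : ((pos d).+1 < n)%N by lia.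
  by rewrite -exprS.
have -> : ((pos d).+1 < n)%N = false by lia.
by rewrite -exprS; congr (_ ^+ _); rewrite /=; lia.
Qed.

Lemma eq_dual_self d : (d == dual d) = (d == mid).
Proof. by rewrite -!pos_eq pos_dual pos_mid; have := pos_le d; move: (pos d) => k; lia. Qed.

Lemma lw_dual b : (pos b).+1 = n -> lw (dual b) = t * lw b.
Proof.
move=> h; have hb : (pos b < n)%N by lia.
have hd : pos (dual b) = n.+1 by rewrite pos_dual; lia.
rewrite /lw -!pos_eq hd pos_mid hb /= -exprS h.
have -> : (n.+1 < n)%N = false by lia.
by have -> : (n.+1 == n)%N = false by lia.
Qed.

Let L b : F := lw (dual b) / lw b.

(** This is the comparison of coefficients behind [gop_Omt]. Away from [mid] one step up multiplies
    [L] by [q^2], so the sum is geometric; the last term jumps as [d] passes [mid]. *)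
Lemma geom_sum d : z * \sum_(b : V | (pos b < pos d)%N) L b =
  L d * sg d (dual d) - r^-1 + z * (pos (dual d) < pos d)%N%:R.
Proof.
have l0 := lw_neq0 q_neq0.
have sgd c : c != mid -> sg c (dual c) = q^-1.
  by move=> nc; rewrite sg_out ?dual_neq_mid // dualK eqxx eq_dual_self (negbTE nc).
have [k] := ubnP (pos d); elim: k d => // k IH d' hk.
have [e|ne] := eqVneq (pos d') 0%N.
  have -> : d' = bot by apply: pos_inj; rewrite e pos_bot.
  rewrite big_pred0; last by move=> b; rewrite pos_bot.
  rewrite mulr0 pos_bot ltn0 /L lw_bot lw_top sg_topbot invr1 !mulr1 mulr0 addr0.
  by field; rewrite ?q_neq0 ?r_neq0 ?expf_neq0.
pose d := dn d'; have ld' := pos_le d'.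
have pd : pos d = (pos d').-1 by rewrite vxK //; lia.
have hd : pos d' = (pos d).+1 by rewrite pd; lia.
have dd : pos (dual d) = (pos (dual d')).+1 by rewrite !pos_dual hd; lia.
rewrite (bigD1 d) ?hd //= (eq_bigl (fun b => (pos b < pos d)%N)); last first.
  by move=> b; rewrite -pos_eq ltnS ltn_neqAle andbC.
rewrite mulrDr IH; last by move: hk; rewrite hd; lia.
have me c : (c == mid) = (pos c == n) by rewrite -pos_eq pos_mid.
have [lt|gt|e] := ltngtP (pos d) n.
- have nd : d != mid by rewrite me; lia.
  have -> : (pos (dual d) < pos d)%N = false by rewrite pos_dual; lia.
  have [e|nd'] := eqVneq d' mid.
    have pn : (pos d).+1 = n by rewrite -hd e pos_mid.
    rewrite e dual_mid pos_mid pn ltnn (sgd _ nd) /L lw_dual // (sg_mid q mid).1.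
    rewrite dual_mid; by field; rewrite ?q_neq0 ?l0 ?r_neq0 ?expf_neq0 ?oppr_eq0 ?oner_neq0.
  have ndd' : dual d' != mid by rewrite dual_neq_mid.
  have ndd : dual d != mid by rewrite dual_neq_mid.
  have -> : (pos (dual d') < (pos d).+1)%N = false.
    by move: nd'; rewrite me pos_dual hd; lia.
  rewrite !sgd // /L (lw_step hd nd nd') (lw_step dd ndd' ndd).
  by field; rewrite ?q_neq0 ?l0 ?r_neq0 ?expf_neq0 ?oppr_eq0 ?oner_neq0.
- have nd : d != mid by rewrite me; lia.
  have nd' : d' != mid by rewrite me; lia.
  have ndd' : dual d' != mid by rewrite dual_neq_mid.
  have ndd : dual d != mid by rewrite dual_neq_mid.
  have -> : (pos (dual d) < pos d)%N by rewrite pos_dual; lia.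
  have -> : (pos (dual d') < (pos d).+1)%N by rewrite pos_dual; lia.
  rewrite !sgd // /L (lw_step hd nd nd') (lw_step dd ndd' ndd).
  by field; rewrite ?q_neq0 ?l0 ?r_neq0 ?expf_neq0 ?oppr_eq0 ?oner_neq0.
- have ed : d = mid by apply/eqP; rewrite me e.
  have nd' : d' != mid by rewrite me; lia.
  have pd' : (pos (dual d')).+1 = n by rewrite pos_dual hd e; lia.
  have h5 : (pos (dual d') < n.+1)%N by move: pd'; clear; lia.
  rewrite ed pos_mid h5 dual_mid pos_mid ltnn (sgd _ nd') /L (sg_mid q mid).1 dual_mid.
  have := lw_dual pd'; rewrite dualK => ->.
  by rewrite /=; field; rewrite ?q_neq0 ?l0 ?r_neq0 ?expf_neq0 ?oppr_eq0 ?oner_neq0.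
Qed.

(** Forced by the relations: multiplying [G^-1 = G - z + z e] by [G] and using [e G = r^-1 e] gives
    [1 = G^2 - z G + (z / r) e]. *)
Definition eop : op F VV := (r / z) *: ((1 : op F VV) + z *: gop - gop * gop).
Definition gopV : op F VV := gop - z *: (1 : op F VV) + z *: eop.
(** The value of a closed loop, that is the scalar in [e e = xi e]. *)
Definition xi : F := 1 + (r - r^-1) / z.

Lemma eop_bv (v : 'cV[F]_#|VV|) :
  eop *m v = (r / z) *: (v + z *: (gop *m v) - gop *m (gop *m v)).
Proof. by rewrite -scalemxAl mulmxBl mulmxDl mul1mx -scalemxAl -mulmxA. Qed.

Lemma gop_Omt : gop *m Omt = r^-1 *: Omt.
Proof.
have l0 := lw_neq0 q_neq0.
pose S (f : V -> F) := \sum_(c : V) f c *: bv2 (dual c) c.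
have SD f g : S f + S g = S (fun c => f c + g c).
  by rewrite -big_split; apply: eq_bigr => c _; rewrite scalerDl.
have SN f : - S f = S (fun c => - f c).
  by rewrite -sumrN; apply: eq_bigr => c _; rewrite scaleNr.
have eS f g : f =1 g -> S f = S g by move=> h; apply: eq_bigr => c _; rewrite h.
have -> : Omt = S lw by [].
have -> : r^-1 *: S lw = S (fun c => r^-1 * lw c).
  by rewrite scaler_sumr; apply: eq_bigr => c _; rewrite scalerA.
have e1 : \sum_(c : V) lw c *: (sg (dual c) c *: bv2 c (dual c)) =
    S (fun d => lw (dual d) * sg d (dual d)).
  rewrite (reindex_inj (can_inj (@dualK n))); apply: eq_bigr => c _.
  by rewrite scalerA dualK.
have e2 : \sum_(c : V) lw c *: ((z * (pos (dual c) < pos c)%N%:R) *: bv2 (dual c) c) =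
    S (fun d => lw d * (z * (pos (dual d) < pos d)%N%:R)).
  by apply: eq_bigr => c _; rewrite scalerA.
have e3 : \sum_(c : V) lw c *: ((z / lw (dual c)) *: Om (dual c)) =
    S (fun d => lw d * (z * \sum_(b : V | (pos b < pos d)%N) L b)).
  rewrite (reindex_inj (can_inj (@dualK n))) /=.
  transitivity (\sum_(b : V) \sum_(d : V)
     ((z * L b * (pos b < pos d)%N%:R * lw d) *: bv2 (dual d) d)).
    apply: eq_bigr => b _; rewrite dualK /Om !scaler_sumr.
    by apply: eq_bigr => d _; rewrite !scalerA /L; congr (_ *: _); ring.
  rewrite exchange_big; apply: eq_bigr => d _.
  rewrite -scaler_suml; congr (_ *: _).
  rewrite mulr_sumr mulr_sumr [RHS]big_mkcond; apply: eq_bigr => b _.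
  by case: ifP => _ /=; ring.
transitivity (S (fun d => lw (dual d) * sg d (dual d)) +
  S (fun d => lw d * (z * (pos (dual d) < pos d)%N%:R)) -
  S (fun d => lw d * (z * \sum_(b : V | (pos b < pos d)%N) L b))).
  rewrite -e1 -e2 -e3 -big_split -sumrB mulmx_sumr; apply: eq_bigr => c _.
  by rewrite -scalemxAr gop_bv dualK eqxx mulr1 scalerBr scalerDr.
rewrite SD SN SD; apply: eS => d; rewrite geom_sum /L.
by field; rewrite ?q_neq0 ?l0 ?r_neq0 ?expf_neq0 ?oppr_eq0 ?oner_neq0.
Qed.

(** Off the zero weight space [gop] satisfies the Hecke relation [(G - q) (G + q^-1) = 0], and [eop]
    is a multiple of its left-hand side. *)
Lemma eop_kill a d : d != dual a -> eop *m bv2 a d = 0.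
Proof.
move=> nd; have nd' : a != dual d by rewrite eq_dual.
have g1 a' d' : d' != dual a' -> gop *m bv2 a' d' =
    sg a' d' *: bv2 d' a' + (z * (pos a' < pos d')%N%:R) *: bv2 a' d'.
  by move=> h; rewrite gop_bv (negbTE h) mulr0 scale0r subr0.
rewrite eop_bv !g1 // mulmxDr -!scalemxAr !g1 //.
rewrite -[RHS](scaler0 _ (r / z)); congr (_ *: _).
have [ead|nad] := eqVneq a d.
  have nm : a != mid by move: nd; rewrite -ead eq_dual_self.
  rewrite -ead ltnn sg_out // eqxx eq_dual_self (negbTE nm) subr0 expr1z.
  apply: cV_eq => y; rewrite ?cvE !mulr0 !mul0r !addr0.
  move: (bv2 a a _ _) => x; move: q_neq0; clear => q0.
  suff -> : x + (q - q^-1) * (q * x) - q * (q * x) = x * (1 - q^-1 * q) by rewrite mulVf // subrr mulr0.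
  by ring.
have [s1 s2] : sg d a = sg a d /\ (sg a d = 1 \/ sg a d = -1).
  have [e ->] := sg_ne q (negbT (introF eqP (fun h => elimN eqP nad (esym h)))) nd.
  by split=> //; rewrite e; case: ifP => _; [right|left].
have [lt|gt|/pos_inj e] := ltngtP (pos a) (pos d); last by rewrite e eqxx in nad.
- by rewrite s1; apply: cV_eq => y; rewrite ?cvE; case: s2 => -> /=; ring.
- by rewrite s1; apply: cV_eq => y; rewrite ?cvE; case: s2 => -> /=; ring.
Qed.

Local Ltac side := rewrite ?q_neq0 ?r_neq0 ?expf_neq0 ?oppr_eq0 ?oner_neq0 ?subr_eq0 -?expr2 ?q2_neq1.

Lemma eop_topbot : eop *m bv2 top bot = (r / q) *: Omt.
Proof.
have [h1 h2 h3] := top_neq.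
rewrite eop_bv gop_top sg_topbot -scalemxAr gop_bv sg_topbot lw_bot pos_bot pos_top.
have -> : (0 < 2 * n)%N by lia.
rewrite eqxx Omt_bot; apply: cV_eq => y; rewrite ?cvE /=.
by field; side.
Qed.

Lemma eop_commutant : super_commutant act2 eop.
Proof.
apply: super_commutantZ; apply: super_commutantD; last first.
  by apply: super_commutantN; apply: super_commutantM; apply: gop_commutant.
apply: super_commutantD; first exact: super_commutant1.
by apply: super_commutantZ; apply: gop_commutant.
Qed.

Lemma commutant_eq2 (A A' : op F VV) : super_commutant act2 A -> super_commutant act2 A' ->
  A *m bv2 top bot = A' *m bv2 top bot -> A = A'.
Proof.
move=> cA cA' h; apply/eqP; rewrite -subr_eq0; apply/eqP.
apply: (cyclic2 q_neq0); last by rewrite mulmxBl h subrr.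
exact: (super_commutantD cA (super_commutantN cA')).
Qed.

Lemma gop_eop : gop * eop = r^-1 *: eop.
Proof.
apply: commutant_eq2.
- by apply: super_commutantM; [apply: gop_commutant | apply: eop_commutant].
- by apply: super_commutantZ; apply: eop_commutant.
rewrite -[LHS]mulmxA -[RHS]scalemxAl eop_topbot -scalemxAr gop_Omt.
by rewrite !scalerA mulrC.
Qed.

Lemma eop_gop : eop * gop = r^-1 *: eop.
Proof.
rewrite -gop_eop /eop -op_scaleAl -op_scaleAr !mulrBl !mulrBr !mulrDl !mulrDr mul1r mulr1.
by rewrite -op_scaleAl -op_scaleAr mulrA.
Qed.

Lemma gop_sqr : gop * gop = 1 + z *: gop - (z / r) *: eop.
Proof.
rewrite /eop scalerA; have -> : z / r * (r / z) = 1.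
  by field; side.
by rewrite scale1r opprB addrC addrNK.
Qed.

Lemma gop_gopV : gop * gopV = 1.
Proof.
rewrite /gopV mulrDr mulrBr -(op_scaleAr z gop 1) -(op_scaleAr z gop eop) mulr1 gop_eop gop_sqr (scalerA z r^-1 eop).
by rewrite addrAC addrNK addrK.
Qed.

Lemma gopV_gop : gopV * gop = 1.
Proof.
rewrite /gopV mulrDl mulrBl -(op_scaleAl z 1 gop) -(op_scaleAl z eop gop) mul1r eop_gop gop_sqr (scalerA z r^-1 eop).
by rewrite addrAC addrNK addrK.
Qed.

Lemma eop_gopE : eop = 1 - z^-1 *: (gop - gopV).
Proof.
rewrite /gopV opprD opprB addrA addrCA subrr addr0 -scalerBr scalerA mulVf ?z_neq0 //.
by rewrite scale1r opprB addrC subrK.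
Qed.

Lemma eop_Omt : eop *m Omt = xi *: Omt.
Proof.
rewrite eop_bv !gop_Omt -scalemxAr gop_Omt; apply: cV_eq => y; rewrite ?cvE /xi.
by field; side.
Qed.

Lemma eop_eop : eop * eop = xi *: eop.
Proof.
apply: commutant_eq2.
- by apply: super_commutantM; apply: eop_commutant.
- by apply: super_commutantZ; apply: eop_commutant.
rewrite -[LHS]mulmxA -[RHS]scalemxAl eop_topbot -scalemxAr eop_Omt.
by rewrite !scalerA mulrC.
Qed.

Lemma eop_bottop : eop *m bv2 bot top = Omt.
Proof.
have e : bv2 bot top = q *: (gop *m bv2 top bot).
  by rewrite gop_top sg_topbot scalerA mulfV // scale1r.
rewrite e -scalemxAr mulmxA -[eop *m gop]/(eop * gop) eop_gop -scalemxAl eop_topbot.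
rewrite !scalerA -[RHS]scale1r; congr (_ *: _).
by field; side.
Qed.

End BMWTwo.

(** * Braid and loop relations on three tensor factors *)

Section BMWThree.
Variables (F : fieldType) (n : nat) (q : F).
Hypothesis q_neq0 : q != 0.
Hypothesis q2_neq1 : q ^+ 2 != 1.
Hypothesis n_gt0 : (0 < n)%N.
Implicit Types (a b c d : V n).
Local Notation z := (q - q^-1).
Local Notation r := (- q ^+ (2 * n)).
Local Notation V := (V n).
Local Notation VV := (tens_space V V).
Local Notation T3 := (tens_space V VV).
Local Notation bv2 a d := (@bv F VV (a, d)).
Local Notation bv3 a b d := (@bv F T3 (a, (b, d))).
Local Notation gop := (@gop F n q).
Local Notation eop := (@eop F n q).
Local Notation gopV := (@gopV F n q).
Local Notation lw := (@lw F n q).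
Local Notation sg := (@sg F n q).
Local Notation xi := (@xi F n q).
Local Notation bot := (bot n).
Local Notation top := (top n).
Local Notation act2 := (coprod_action (V_action q) (V_action q)).
Local Notation act3 := (coprod_action (V_action q) act2).

(** Tensoring with [v_a] on the left, as [insr] does with [v_d] on the right, reduces computations
    on three factors to two. *)
Definition insl a : 'M[F]_(#|T3|, #|VV|) :=
  \matrix_(i, j) (((enum_val i).1 == a)%:R * ((enum_val i).2 == enum_val j)%:R).

Definition insr d : 'M[F]_(#|T3|, #|VV|) :=
  \matrix_(i, j) (((enum_val i).2.2 == d)%:R *
     (((enum_val i).1, (enum_val i).2.1) == enum_val j)%:R).

Lemma inslE a (w : 'cV[F]_#|VV|) (y : T3) :
  (insl a *m w) (enum_rank y) 0 = (y.1 == a)%:R * w (enum_rank y.2) 0.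
Proof.
rewrite mxE (bigD1 (enum_rank y.2)) //= mxE !enum_rankK eqxx mulr1 big1 ?addr0 // => j nj.
have ny : (y.2 == enum_val j) = false.
  by apply: contraNF nj => /eqP ->; rewrite enum_valK.
by rewrite mxE enum_rankK ny mulr0 mul0r.
Qed.

Lemma insrE d (w : 'cV[F]_#|VV|) (y : T3) :
  (insr d *m w) (enum_rank y) 0 =
  (y.2.2 == d)%:R * w (enum_rank ((y.1, y.2.1) : VV)) 0.
Proof.
rewrite mxE (bigD1 (enum_rank ((y.1, y.2.1) : VV))) //= mxE !enum_rankK eqxx mulr1.
rewrite big1 ?addr0 // => j nj.
have ny : (((y.1, y.2.1) : VV) == enum_val j) = false.
  by apply: contraNF nj => /eqP ->; rewrite enum_valK.
by rewrite mxE enum_rankK ny mulr0 mul0r.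
Qed.

Lemma insl_bv a b d : insl a *m bv2 b d = bv3 a b d.
Proof.
by apply: cV_eq => -[y1 y2]; rewrite inslE !bvE xpair_eqE -natrM mulnb.
Qed.

Lemma insr_bv a b d : insr d *m bv2 a b = bv3 a b d.
Proof.
apply: cV_eq => -[y1 [y2 y3]]; rewrite insrE !bvE /= !xpair_eqE -natrM mulnb.
by rewrite andbC andbA.
Qed.

(** Evenness removes the sign of moving [A] past [v_a]; for [op12] nothing has to be passed. *)
Lemma op23_bv (A : op F VV) a b d : even_op A ->
  op23 A *m bv3 a b d = insl a *m (A *m bv2 b d).
Proof.
move=> eA; apply: cV_eq => -[y1 y2]; rewrite inslE !op_bv ent_tens ent1 /=.
have [h|h] := eqVneq (spar ((b, d) : VV)) (spar y2); last by rewrite eA // !mulr0.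
by move: h => /= ->; rewrite addbb mul1r.
Qed.

Lemma op12_bv (A : op F VV) a b d :
  op12 A *m bv3 a b d = insr d *m (A *m bv2 a b).
Proof.
apply: cV_eq => -[y1 [y2 y3]]; rewrite insrE !op_bv ent_reassoc ent_tens ent1 /=.
have [->|_] := eqVneq y3 d; last by rewrite mulr0 mul0r mulr0.
by rewrite addbb mulr1 !mul1r.
Qed.

Lemma op12_commutant (A : op F VV) : super_commutant act2 A ->
  super_commutant act3 (op12 A).
Proof. by move=> cA; apply: super_commutant_reassoc; apply: super_commutant_tensA1. Qed.

Lemma op23_commutant (A : op F VV) : super_commutant act2 A ->
  super_commutant act3 (op23 A).
Proof. exact: super_commutant_tens1. Qed.

Lemma commutant_eq3 (A A' : op F T3) : super_commutant act3 A -> super_commutant act3 A' ->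
  (forall b, A *m bv3 top b bot = A' *m bv3 top b bot) -> A = A'.
Proof.
move=> cA cA' h; apply/eqP; rewrite -subr_eq0; apply/eqP.
apply: (cyclic3 q_neq0); last by move=> b; rewrite mulmxBl h subrr.
exact: (super_commutantD cA (super_commutantN cA')).
Qed.

Let cg : super_commutant act2 gop := gop_commutant n q_neq0.
Let ce : super_commutant act2 eop := eop_commutant n q_neq0.
Let eg : even_op gop := cg.1.
Let ee : even_op eop := ce.1.

Lemma op12_top b d : op12 gop *m bv3 top b d = sg top b *: bv3 b top d.
Proof. by rewrite op12_bv gop_top -scalemxAr insr_bv. Qed.

Lemma op12_bot b d : op12 gop *m bv3 b bot d = sg b bot *: bv3 bot b d.
Proof. by rewrite op12_bv gop_bot -scalemxAr insr_bv. Qed.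

Lemma op23_top a b : op23 gop *m bv3 a top b = sg top b *: bv3 a b top.
Proof. by rewrite op23_bv // gop_top -scalemxAr insl_bv. Qed.

Lemma op23_bot a b : op23 gop *m bv3 a b bot = sg b bot *: bv3 a bot b.
Proof. by rewrite op23_bv // gop_bot -scalemxAr insl_bv. Qed.

(** Starting from [v_1 (x) v_b (x) v_(-1)], each braiding meets [v_1] on its left or [v_(-1)] on its
    right and is there a scaled exchange. Both sides reverse the three factors with the same three
    scalars. *)
Lemma braid_gop : op12 gop * op23 gop * op12 gop = op23 gop * op12 gop * op23 gop.
Proof.
have c12 := op12_commutant cg; have c23 := op23_commutant cg.
apply: commutant_eq3.
- by do 2?apply: super_commutantM.
- by do 2?apply: super_commutantM.
move=> b; rewrite -[LHS]mulmxA -[RHS]mulmxA -[op12 gop * op23 gop]/(op12 gop *m op23 gop).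
rewrite -[op23 gop * op12 gop]/(op23 gop *m op12 gop) -!mulmxA.
rewrite !(op12_top, op23_bot, =^~ scalemxAr) -/top.
rewrite !(op12_top, op23_top, op12_bot, =^~ scalemxAr) !scalerA; congr (_ *: _).
by ring.
Qed.

Lemma eop23_cyclic b : b != top -> op23 eop *m bv3 top b bot = 0.
Proof. by move=> nb; rewrite op23_bv // eop_kill ?mulmx0 // eq_dual. Qed.

Lemma eop23_top : op23 eop *m bv3 top top bot =
  \sum_(c : V) (r / q * lw c) *: bv3 top (dual c) c.
Proof.
rewrite op23_bv // eop_topbot // -scalemxAr mulmx_sumr scaler_sumr.
by apply: eq_bigr => c _; rewrite -scalemxAr insl_bv scalerA.
Qed.

(* The sum collapses because [eop] kills [v_b (x) v_d] unless [d] is dual to [b]. *)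
Lemma loop_gop : op23 eop * op12 gop * op23 eop = r *: op23 eop.
Proof.
have c12 := op12_commutant cg; have c23 := op23_commutant ce.
apply: commutant_eq3.
- by do 2?apply: super_commutantM.
- exact: super_commutantZ.
move=> b; rewrite -[LHS]mulmxA -[op23 eop * op12 gop]/(op23 eop *m op12 gop) -!mulmxA.
rewrite -[RHS]scalemxAl; have [->|nb] := eqVneq b top; last first.
  by rewrite eop23_cyclic // !mulmx0 scaler0.
rewrite [in LHS]eop23_top !mulmx_sumr (bigD1 bot) //= big1 ?addr0; last first.
  move=> c nc; rewrite -!scalemxAr op12_bv gop_top -!scalemxAr insr_bv.
  by rewrite op23_bv // eop_kill ?mulmx0 ?scaler0 // dualK.
rewrite -!scalemxAr op12_bv gop_top -!scalemxAr insr_bv !scalerA -/top.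
(* The surviving term has [c = bot]; its scalar is [r / q] from [e] times [sg top top = q]. *)
congr (_ *: _); rewrite sg_topbot // lw_bot //.
by field.
Qed.

(** Needed for the second loop relation, because [gopV] contains [eop]. *)
Lemma eop_eop_eop : op23 eop * op12 eop * op23 eop = op23 eop.
Proof.
have c12 := op12_commutant ce; have c23 := op23_commutant ce.
apply: commutant_eq3 => //.
  by do 2?apply: super_commutantM.
move=> b; rewrite -[LHS]mulmxA -[op23 eop * op12 eop]/(op23 eop *m op12 eop) -!mulmxA.
have [->|nb] := eqVneq b top; last first.
  by rewrite eop23_cyclic // !mulmx0.
(* The middle [e] selects [c = top], and in the new sum the outer [e] selects [bot]; the factor
   [lw top = q / r] cancels one of the two factors [r / q]. *)
rewrite [in LHS]eop23_top !mulmx_sumr (bigD1 top) //= big1 ?addr0; last first.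
  move=> c nc; rewrite -!scalemxAr op12_bv eop_kill ?mulmx0 ?scaler0 //.
  by rewrite dual_eq.
have -> : dual top = bot by rewrite dualK.
rewrite -!scalemxAr op12_bv eop_topbot // -!scalemxAr mulmx_sumr.
rewrite (mulmx_sumr (op23 eop)) (bigD1 bot) //= big1 ?addr0; last first.
  move=> c nc; rewrite -!scalemxAr insr_bv op23_bv // eop_kill ?mulmx0 ?scaler0 //.
  by rewrite dual_eq eq_sym.
rewrite -!scalemxAr insr_bv -/top op23_bv // op23_bv // eop_bottop // eop_topbot //.
rewrite -!scalemxAr !scalerA; congr (_ *: _); rewrite lw_top // lw_bot //.
by field; rewrite ?q_neq0 ?r_neq0 ?expf_neq0.
Qed.

Lemma op12D (A A' : op F VV) : op12 (A + A') = op12 A + op12 A'.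
Proof. by rewrite /op12 tensDl reassocD. Qed.

Lemma op12Z k (A : op F VV) : op12 (k *: A) = k *: op12 A.
Proof.
by apply: opP => y x; rewrite entZ !ent_reassoc !ent_tens entZ; ring.
Qed.

Lemma op12_1 : op12 (1 : op F VV) = 1.
Proof. by rewrite /op12 tens11 reassoc1. Qed.

(** Expanding [gopV] leaves the scalar [r - z * xi + z], which is [r^-1] by the value of [xi]. *)
Lemma loop_gopV : op23 eop * op12 gopV * op23 eop = r^-1 *: op23 eop.
Proof.
have e2 : op23 eop * op23 eop = xi *: op23 eop.
  by rewrite /op23 tensM ?mul1r ?eop_eop // ?tensZr //; left; apply: even_op1.
have -> : op12 gopV = op12 gop - z *: (1 : op F T3) + z *: op12 eop.
  by rewrite /gopV -scaleNr !op12D !op12Z op12_1 scaleNr.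
rewrite mulrDr mulrBr -(op_scaleAr z (op23 eop) 1) -(op_scaleAr z (op23 eop) (op12 eop)).
rewrite mulrDl mulrBl -(op_scaleAl z (op23 eop * 1)) -(op_scaleAl z (op23 eop * op12 eop)).
rewrite loop_gop eop_eop_eop mulr1 e2 !scalerA -scalerBl -scalerDl; congr (_ *: _).
rewrite /xi; field.
by rewrite ?q_neq0 ?r_neq0 ?expf_neq0 ?oppr_eq0 ?oner_neq0 ?subr_eq0 -?expr2 ?q2_neq1.
Qed.

End BMWThree.

(** * The representation *)

Section BWRep.
Variables (F : fieldType) (n t : nat) (q : F).
Hypothesis q_neq0 : q != 0.
Hypothesis q2_neq1 : q ^+ 2 != 1.
Hypothesis n_gt0 : (0 < n)%N.
Local Notation r := (- q ^+ (2 * n)).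
Local Notation z := (q - q^-1).
Local Notation gop := (@gop F n q).
Local Notation eop := (@eop F n q).
Local Notation gopV := (@gopV F n q).

Definition bw_op (x : BW_gen t) : op F (Vpow n t) :=
  op_at (if x.2 then gopV else gop) t x.1.

Local Notation rep := (free_rep bw_op).

Lemma bw_lt (i : 'I_t.-1) : (i.+1 < t)%N.
Proof. by case: t i => [|u] [i hi] //=; rewrite ltnS. Qed.

Lemma rep_g i : rep (BW_sg F i) = op_at gop t i. Proof. exact: free_rep_gen. Qed.
Lemma rep_gV i : rep (BW_sgV F i) = op_at gopV t i. Proof. exact: free_rep_gen. Qed.

Lemma rep_e i : rep (BW_se q i) = op_at eop t i.
Proof.
have h := bw_lt i.
rewrite /BW_se linearB linearZ linearB /= free_rep1 rep_g rep_gV (eop_gopE n q_neq0 q2_neq1).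
have opB A A' : op_at (A - A') t i = op_at A t i - op_at A' t i :> op F (Vpow n t).
  by rewrite op_atD // -[- A']scaleN1r op_atZ // scaleN1r.
by rewrite opB op_at1 op_atZ // opB.
Qed.

Lemma op3_loop (A A' B : op F (tens_space (V n) (V n))) i :
  (i.+2 < t)%N -> op23 A * op12 B * op23 A = op23 A' ->
  op_at A t i.+1 * op_at B t i * op_at A t i.+1 = op_at A' t i.+1.
Proof. by move=> h e; rewrite -!op3_at23 // -op3_at12 // -!op3_atM e. Qed.

Lemma op23Z k (A : op F (tens_space (V n) (V n))) : k *: op23 A = op23 (k *: A).
Proof. by rewrite /op23 tensZr. Qed.

Lemma bw_op_rel x : BW_rel r q x -> rep x = 0.
Proof.
have opM A A' i : op_at A t i * op_at A' t i = op_at (A * A') t i.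
  by rewrite op_atM.
case=> [i|i|i j h|i j h|i|i j h|i j h]; rewrite linearB /= ?free_repM ?free_rep1.
- by rewrite rep_g rep_gV opM gop_gopV // op_at1 subrr.
- by rewrite rep_g rep_gV opM gopV_gop // op_at1 subrr.
- have eg : even_op gop := (gop_commutant n q_neq0).1.
  rewrite !rep_g; apply/eqP; rewrite subr_eq0; apply/eqP.
  by case/orP: h => h; [|symmetry]; apply: op_at_far.
- have hj := bw_lt j; rewrite h in hj; rewrite !rep_g h.
  rewrite -!op3_at23 // -!op3_at12 // -!op3_atM braid_gop // subrr //.
- rewrite linearZ /= rep_e rep_g opM eop_gop // op_atZ ?subrr //.
  exact: bw_lt.
- have hj := bw_lt j; rewrite h in hj; rewrite linearZ /= !rep_e rep_g h.
  have e := loop_gop q_neq0 q2_neq1 n_gt0; rewrite op23Z in e.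
  by rewrite (op3_loop hj e) op_atZ // subrr.
- have hj := bw_lt j; rewrite h in hj; rewrite linearZ /= !rep_e rep_gV h.
  have e := loop_gopV q_neq0 q2_neq1 n_gt0; rewrite op23Z in e.
  by rewrite (op3_loop hj e) op_atZ // subrr.
Qed.

Lemma gopV_commutant :
  super_commutant (coprod_action (V_action q) (V_action q)) gopV.
Proof.
apply: super_commutantD.
  apply: super_commutantD; first exact: gop_commutant.
  by apply: super_commutantN; apply: super_commutantZ; apply: super_commutant1.
by apply: super_commutantZ; apply: eop_commutant.
Qed.

Lemma bw_op_End x : End_Uq (n := n) q (bw_op x).
Proof.
apply: (@op_at_commutant F n q); case: x.2; first exact: gopV_commutant.
exact: gop_commutant.
Qed.

Lemma invmx_eq m (A B : 'M[F]_m) : A *m B = 1%:M -> invmx A = B.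
Proof.
by move=> h; have [u _] := mulmx1_unit h; rewrite -[invmx A]mulmx1 -h mulKmx.
Qed.

Section Range.
Variables (s : seq (weight n)) (E Fv : weight n -> Uq n q) (a : weight n -> F).
Variable pi : {linear Uq n q -> op F (V n)}.
Hypothesis RE : - Rcheck s E Fv a pi = gop.

Lemma R_atE i : (i.+1 < t)%N -> R_at s E Fv a pi t i = - op_at gop t i.
Proof.
move=> h; have -> : R_at s E Fv a pi t i = op_at (Rcheck s E Fv a pi) t i.
  by elim: i t {h} => [|i IH] [|[|u]] //=; rewrite IH.
by rewrite -RE -[- Rcheck _ _ _ _ _]scaleN1r op_atZ // scaleN1r opprK.
Qed.

Lemma rep_Ct x : Ct s E Fv a pi (rep x).
Proof.
split.
  elim/free_alg_ind: x => [|x|c x y|x y].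
  - by rewrite free_rep1; apply: super_commutant1.
  - by rewrite free_rep_gen; apply: bw_op_End.
  - by rewrite linearP => hx hy; apply: super_commutantD => //; apply: super_commutantZ.
  - by rewrite free_repM; apply: super_commutantM.
move=> S [S1 SD SM] _ Sgen.
have S0 : S 0 by have := SD (-1) _ _ S1 S1; rewrite scaleN1r addNr.
have SN A : S A -> S (- A) by move=> SA; have := SD (-1) _ _ SA S0; rewrite scaleN1r addr0.
elim/free_alg_ind: x => [|[i b]|c x y|x y].
- by rewrite free_rep1.
- have h := bw_lt i; have [Sg SgV] := Sgen i; rewrite free_rep_gen /bw_op /=.
  case: b; last by rewrite -[op_at _ _ _]opprK -R_atE //; apply: SN.
  (* Since the braiding is minus [gop], its inverse is minus [gopV]; the subalgebra is closed under
     the sign. *)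
  have : invmx (R_at s E Fv a pi t i) = - op_at gopV t i.
    apply: invmx_eq; rewrite R_atE //.
    have e : op_at gop t i * op_at gopV t i = 1 by rewrite -op_atM gop_gopV // op_at1.
    by rewrite mulNmx mulmxN opprK.
  by move=> e; rewrite e in SgV; rewrite -[op_at _ _ _]opprK; apply: SN.
- by rewrite linearP => Sx Sy; apply: SD.
- by rewrite free_repM; apply: SM.
Qed.

End Range.
End BWRep.

Theorem lemma8p4 (R : realType) (n t : nat) (q : R[i])
    (n_gt0 : (0 < n)%N) (t_ge2 : (2 <= t)%N)
    (q_neq0 : q != 0) (q_not_root1 : forall k : nat, (0 < k)%N -> q ^+ k != 1)
    (s : seq (weight n)) (s_normal : normal_ordering s)
    (E Fv : weight n -> Uq n q) (EF_root : root_vectors s E Fv)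
    (a : weight n -> R[i]) (a_root : root_scalars E Fv a)
    (pi : {linear Uq n q -> op R[i] (V n)}) (pi_V : affords_V pi) :
  exists Y : {linear BW t (- q ^+ (2 * n)) q -> op R[i] (Vpow n t)},
    [/\ GRing.monoid_morphism Y,
        forall x, Ct s E Fv a pi (Y x)
      & forall i : 'I_t.-1,
          Y (BW_g (- q ^+ (2 * n)) q i) = - R_at s E Fv a pi t i].
Proof.
have q2 := q_not_root1 2 isT.
(* From here on the normal ordering and the root vectors enter only through this equality. *)
have RE := RcheckE q_neq0 q2 s_normal EF_root a_root pi_V.
exists (pres_rep (bw_op_rel q_neq0 q2 n_gt0)); split.
- exact: pres_rep_monoid.
- by move=> x; apply: (rep_Ct q_neq0 q2 n_gt0 RE).
- by move=> i; rewrite (R_atE RE) ?bw_lt // opprK; apply: pres_rep_gen.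
Qed.
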